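(* The following two statements are equivalent: 1) $\mathsf{GBT}$: For all separable metrizable spaces $X,Y$ and every function $f: X\rightarrow Y$, $f$ is Baire class $1$ if and only if $f{\upharpoonright} K$ has a point of continuity for every nonempty compact $K\subseteq X$. 2) $\mathsf{WHSP}$: For every pair of disjoint sets $A,B\subseteq \mathbb{N}^\mathbb{N}$ such that there is no $F_\sigma$ subset of $\mathbb{N}^{\mathbb{N}}$ separating $A$ from $B$, there is a Cantor set $\mathcal{C}\subseteq A\cup B$ with $\mathcal{C}\cap A$ dense and codense in $\mathcal{C}$.
   Context: Base theory: the equivalence is to be understood over $\mathsf{ZF}$ together with $\mathsf{AC}_\omega(\mathbb{R})$ (every countable family of nonempty subsets of $\mathbb{R}$ has a choice function); the full axiom of choice is not assumed. A function $f:X\to Y$ between topological spaces is Baire class $1$ if for every open $V\subseteq Y$ the preimage $f^{-1}(V)$ is an $F_\sigma$ subset of $X$ (a countable union of closed subsets of $X$). A point of continuity of $f{\upharpoonright}K$ is a point $x\in K$ at which $f{\upharpoonright}K$ is continuous, where $K$ carries the subspace topology. $\mathbb{N}^{\mathbb{N}}$ is the Baire space with the product of discrete topologies. A set $S$ separates $A$ from $B$ if $A\subseteq S$ and $B\cap S=\emptyset$. A Cantor set in $\mathbb{N}^{\mathbb{N}}$ is a subset homeomorphic to the Cantor space $2^{\mathbb{N}}$. A subset $D\subseteq\mathcal{C}$ is codense in $\mathcal{C}$ if $\mathcal{C}\setminus D$ is dense in $\mathcal{C}$. *)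

(* Defs.v *)
Set Implicit Arguments.
Unset Strict Implicit.
Unset Printing Implicit Defensive.

(** The base theory is ZF + AC_ω(ℝ).  Rocq types with the usual classical
    axioms satisfy full choice, under which GBT and WHSP are both refutable (by
    Bernstein sets), so the equivalence is stated inside an arbitrary structure
    [(M, ∈)] satisfying the first-order axioms of ZF.  Everything below that is
    said about [M] quantifies over elements of [M] only, i.e. it is the
    satisfaction in [M] of a formula of the language of set theory. *)

Record eps_structure : Type := EpsStructure {
  carrier :> Type;
  mem : carrier -> carrier -> Prop
}.

Notation "x ∈ y" := (mem x y) (at level 70, no associativity).
Notation "x ∉ y" := (~ mem x y) (at level 70, no associativity).

(** ** Formulas of the language of set theory, with de Bruijn indices *)

Inductive formula : Type :=
| FMem (i j : nat)
| FEq (i j : nat)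
| FBot
| FImp (p q : formula)
| FAll (p : formula).

Definition scons {T : Type} (x : T) (rho : nat -> T) (i : nat) : T :=
  match i with O => x | S j => rho j end.

Fixpoint sat {M : eps_structure} (rho : nat -> M) (p : formula) : Prop :=
  match p with
  | FMem i j => rho i ∈ rho j
  | FEq i j => rho i = rho j
  | FBot => False
  | FImp p q => sat rho p -> sat rho q
  | FAll p => forall x : M, sat (scons x rho) p
  end.

(** ** Elementary set-theoretic notions *)

(** [s] is the set [{x | P x}]. *)
Definition set_of {M : eps_structure} (P : M -> Prop) (s : M) : Prop :=
  forall x : M, x ∈ s <-> P x.

Definition nonempty {M : eps_structure} (s : M) : Prop := exists x : M, x ∈ s.

Definition subset {M : eps_structure} (a b : M) : Prop :=
  forall x : M, x ∈ a -> x ∈ b.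

Definition is_empty {M : eps_structure} (s : M) : Prop :=
  set_of (fun _ => False) s.

Definition is_upair {M : eps_structure} (a b s : M) : Prop :=
  set_of (fun x => x = a \/ x = b) s.

Definition is_union {M : eps_structure} (a s : M) : Prop :=
  set_of (fun x => exists y : M, y ∈ a /\ x ∈ y) s.

Definition is_power {M : eps_structure} (a s : M) : Prop :=
  set_of (fun x => subset x a) s.

Definition is_inter {M : eps_structure} (a b s : M) : Prop :=
  set_of (fun x => x ∈ a /\ x ∈ b) s.

Definition is_diff {M : eps_structure} (a b s : M) : Prop :=
  set_of (fun x => x ∈ a /\ x ∉ b) s.

Definition is_succ {M : eps_structure} (n s : M) : Prop :=
  set_of (fun x => x ∈ n \/ x = n) s.

Definition inductive_set {M : eps_structure} (s : M) : Prop :=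
  (forall e : M, is_empty e -> e ∈ s) /\
  (forall n m : M, n ∈ s -> is_succ n m -> m ∈ s).

(** ** The axioms of ZF *)

Definition extensionality (M : eps_structure) : Prop :=
  forall a b : M, (forall x : M, x ∈ a <-> x ∈ b) -> a = b.

Definition foundation (M : eps_structure) : Prop :=
  forall a : M, nonempty a ->
  exists x : M, x ∈ a /\ forall y : M, y ∈ x -> y ∉ a.

Definition pairing (M : eps_structure) : Prop :=
  forall a b : M, exists s : M, is_upair a b s.

Definition union (M : eps_structure) : Prop :=
  forall a : M, exists s : M, is_union a s.

Definition power_set (M : eps_structure) : Prop :=
  forall a : M, exists s : M, is_power a s.

Definition infinity (M : eps_structure) : Prop :=
  exists s : M, nonempty s /\ inductive_set s.

Definition separation (M : eps_structure) : Prop :=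
  forall (p : formula) (rho : nat -> M) (a : M),
  exists s : M, set_of (fun x => x ∈ a /\ sat (scons x rho) p) s.

Definition replacement (M : eps_structure) : Prop :=
  forall (p : formula) (rho : nat -> M) (a : M),
  (forall x y z : M, x ∈ a -> sat (scons x (scons y rho)) p ->
     sat (scons x (scons z rho)) p -> y = z) ->
  exists s : M,
    set_of (fun y => exists x : M, x ∈ a /\ sat (scons x (scons y rho)) p) s.

Record ZF (M : eps_structure) : Prop := {
  ZF_extensionality : extensionality M;
  ZF_foundation : foundation M;
  ZF_pairing : pairing M;
  ZF_union : union M;
  ZF_power_set : power_set M;
  ZF_infinity : infinity M;
  ZF_separation : separation M;
  ZF_replacement : replacement M
}.

(** ** Functions, natural numbers, cardinality *)

(** Kuratowski pairs: [p = {{a}, {a, b}}]. *)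
Definition is_pair {M : eps_structure} (a b p : M) : Prop :=
  exists s t : M, is_upair a a s /\ is_upair a b t /\ is_upair s t p.

(** [(x, y) ∈ r]; for a function [r] this reads [r(x) = y]. *)
Definition related {M : eps_structure} (r x y : M) : Prop :=
  exists p : M, is_pair x y p /\ p ∈ r.

(** [related2 r x y z] reads [r(x, y) = z]. *)
Definition related2 {M : eps_structure} (r x y z : M) : Prop :=
  exists p : M, is_pair x y p /\ related r p z.

Definition is_prod {M : eps_structure} (a b s : M) : Prop :=
  set_of (fun p => exists x y : M, x ∈ a /\ y ∈ b /\ is_pair x y p) s.

Definition is_fun {M : eps_structure} (f a b : M) : Prop :=
  (forall p : M, p ∈ f -> exists x y : M, x ∈ a /\ y ∈ b /\ is_pair x y p) /\
  (forall x : M, x ∈ a -> exists! y : M, related f x y).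

Definition is_fun2 {M : eps_structure} (f a b c : M) : Prop :=
  exists s : M, is_prod a b s /\ is_fun f s c.

Definition is_injection {M : eps_structure} (f a b : M) : Prop :=
  is_fun f a b /\
  (forall x x' y : M, related f x y -> related f x' y -> x = x').

Definition is_bijection {M : eps_structure} (f a b : M) : Prop :=
  is_injection f a b /\
  (forall y : M, y ∈ b -> exists x : M, related f x y).

Definition is_image {M : eps_structure} (f u s : M) : Prop :=
  set_of (fun y => exists x : M, x ∈ u /\ related f x y) s.

Definition is_preimage {M : eps_structure} (f v s : M) : Prop :=
  set_of (fun x => exists y : M, y ∈ v /\ related f x y) s.

Definition is_restriction {M : eps_structure} (f k s : M) : Prop :=
  set_of (fun p => p ∈ f /\ exists x y : M, x ∈ k /\ is_pair x y p) s.

Definition is_omega {M : eps_structure} (w : M) : Prop :=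
  inductive_set w /\ forall v : M, inductive_set v -> subset w v.

Definition finite {M : eps_structure} (a : M) : Prop :=
  exists w n f : M, is_omega w /\ n ∈ w /\ is_bijection f a n.

Definition countable {M : eps_structure} (a : M) : Prop :=
  exists w f : M, is_omega w /\ is_injection f a w.

(** ** The real numbers

    ℝ is given by any complete ordered field of [M]; in ZF there is exactly one
    up to isomorphism. *)

Record real_structure (M : eps_structure) : Type := RealStructure {
  Rcarrier : M;
  Rzero : M;
  Rone : M;
  Radd : M;
  Rmul : M;
  Rle : M
}.

Definition rle {M : eps_structure} (R : real_structure M) (x y : M) : Prop :=
  related (Rle R) x y.

Definition rlt {M : eps_structure} (R : real_structure M) (x y : M) : Prop :=
  rle R x y /\ x <> y.

Definition upper_bound {M : eps_structure} (R : real_structure M) (s b : M)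
    : Prop :=
  b ∈ Rcarrier R /\ forall x : M, x ∈ s -> rle R x b.

Record complete_ordered_field {M : eps_structure} (R : real_structure M)
    : Prop := {
  Rzero_in : Rzero R ∈ Rcarrier R;
  Rone_in : Rone R ∈ Rcarrier R;
  Radd_fun : is_fun2 (Radd R) (Rcarrier R) (Rcarrier R) (Rcarrier R);
  Rmul_fun : is_fun2 (Rmul R) (Rcarrier R) (Rcarrier R) (Rcarrier R);
  Rone_neq_zero : Rone R <> Rzero R;
  Radd_comm : forall x y z : M,
    related2 (Radd R) x y z -> related2 (Radd R) y x z;
  Radd_assoc : forall x y z xy yz s : M,
    related2 (Radd R) x y xy -> related2 (Radd R) y z yz ->
    (related2 (Radd R) xy z s <-> related2 (Radd R) x yz s);
  Radd_zero : forall x : M,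
    x ∈ Rcarrier R -> related2 (Radd R) x (Rzero R) x;
  Radd_opp : forall x : M, x ∈ Rcarrier R ->
    exists y : M, y ∈ Rcarrier R /\ related2 (Radd R) x y (Rzero R);
  Rmul_comm : forall x y z : M,
    related2 (Rmul R) x y z -> related2 (Rmul R) y x z;
  Rmul_assoc : forall x y z xy yz s : M,
    related2 (Rmul R) x y xy -> related2 (Rmul R) y z yz ->
    (related2 (Rmul R) xy z s <-> related2 (Rmul R) x yz s);
  Rmul_one : forall x : M,
    x ∈ Rcarrier R -> related2 (Rmul R) x (Rone R) x;
  Rmul_inv : forall x : M, x ∈ Rcarrier R -> x <> Rzero R ->
    exists y : M, y ∈ Rcarrier R /\ related2 (Rmul R) x y (Rone R);
  Rdistr : forall x y z yz xy xz s : M,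
    related2 (Radd R) y z yz -> related2 (Rmul R) x y xy ->
    related2 (Rmul R) x z xz ->
    (related2 (Rmul R) x yz s <-> related2 (Radd R) xy xz s);
  Rle_in : forall p : M, p ∈ Rle R ->
    exists x y : M, x ∈ Rcarrier R /\ y ∈ Rcarrier R /\ is_pair x y p;
  Rle_antisym : forall x y : M, rle R x y -> rle R y x -> x = y;
  Rle_trans : forall x y z : M, rle R x y -> rle R y z -> rle R x z;
  Rle_total : forall x y : M,
    x ∈ Rcarrier R -> y ∈ Rcarrier R -> rle R x y \/ rle R y x;
  Rle_add : forall x y z xz yz : M, rle R x y ->
    related2 (Radd R) x z xz -> related2 (Radd R) y z yz -> rle R xz yz;
  Rle_mul : forall x y xy : M, rle R (Rzero R) x -> rle R (Rzero R) y ->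
    related2 (Rmul R) x y xy -> rle R (Rzero R) xy;
  Rcomplete : forall s : M, subset s (Rcarrier R) -> nonempty s ->
    (exists b : M, upper_bound R s b) ->
    exists l : M, upper_bound R s l /\
      forall b : M, upper_bound R s b -> rle R l b
}.

(** Every family [F : ω -> P(ℝ) \ {∅}] has a choice function. *)
Definition AC_omega {M : eps_structure} (R : real_structure M) : Prop :=
  forall w P F : M, is_omega w -> is_power (Rcarrier R) P -> is_fun F w P ->
  (forall n s : M, related F n s -> nonempty s) ->
  exists c : M, is_fun c w (Rcarrier R) /\
    forall n s x : M, related F n s -> related c n x -> x ∈ s.

(** ** Topology; a space is a set [X] with its set [T] of open subsets *)

Definition is_topology {M : eps_structure} (X T : M) : Prop :=
  (forall U : M, U ∈ T -> subset U X) /\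
  X ∈ T /\
  (forall S U : M, subset S T -> is_union S U -> U ∈ T) /\
  (forall U V W : M, U ∈ T -> V ∈ T -> is_inter U V W -> W ∈ T).

Definition is_closed {M : eps_structure} (X T F : M) : Prop :=
  subset F X /\ exists U : M, is_diff X F U /\ U ∈ T.

Definition is_Fsigma {M : eps_structure} (X T A : M) : Prop :=
  exists S : M, countable S /\ (forall F : M, F ∈ S -> is_closed X T F) /\
    is_union S A.

Definition is_subspace {M : eps_structure} (T K TK : M) : Prop :=
  set_of (fun W => exists U : M, U ∈ T /\ is_inter U K W) TK.

Definition is_dense {M : eps_structure} (X T D : M) : Prop :=
  subset D X /\
  forall U : M, U ∈ T -> nonempty U -> exists x : M, x ∈ U /\ x ∈ D.

Definition is_codense {M : eps_structure} (X T D : M) : Prop :=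
  subset D X /\ exists D' : M, is_diff X D D' /\ is_dense X T D'.

Definition is_compact {M : eps_structure} (X T : M) : Prop :=
  forall S : M, subset S T -> is_union S X ->
  exists S' : M, subset S' S /\ finite S' /\ is_union S' X.

Definition continuous_at {M : eps_structure} (TX TY f x : M) : Prop :=
  forall y V : M, related f x y -> V ∈ TY -> y ∈ V ->
  exists U : M, U ∈ TX /\ x ∈ U /\
    forall x' y' : M, x' ∈ U -> related f x' y' -> y' ∈ V.

Definition is_homeomorphism {M : eps_structure} (X TX Y TY f : M) : Prop :=
  is_bijection f X Y /\
  (forall V : M, V ∈ TY -> exists U : M, is_preimage f V U /\ U ∈ TX) /\
  (forall U : M, U ∈ TX -> exists V : M, is_image f U V /\ V ∈ TY).

(** [X = Y^ω] with the product of the discrete topologies: the coarsest topology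
    containing the subbasic sets [{x | x(i) ∈ V}] for [i ∈ ω] and [V ⊆ Y]. *)
Definition has_cylinders {M : eps_structure} (w Y X T : M) : Prop :=
  forall i V W : M, i ∈ w -> subset V Y ->
  set_of (fun x => x ∈ X /\ exists v : M, v ∈ V /\ related x i v) W -> W ∈ T.

Definition is_product_space {M : eps_structure} (w Y X T : M) : Prop :=
  set_of (fun x => is_fun x w Y) X /\
  is_topology X T /\ has_cylinders w Y X T /\
  forall T' : M, is_topology X T' -> has_cylinders w Y X T' -> subset T T'.

Definition is_Baire_space {M : eps_structure} (X T : M) : Prop :=
  exists w : M, is_omega w /\ is_product_space w w X T.

Definition is_Cantor_space {M : eps_structure} (X T : M) : Prop :=
  exists w e o two : M, is_omega w /\ is_empty e /\ is_succ e o /\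
    is_succ o two /\ is_product_space w two X T.

Definition is_Cantor_set {M : eps_structure} (X T C : M) : Prop :=
  subset C X /\
  exists TC Z TZ h : M, is_subspace T C TC /\ is_Cantor_space Z TZ /\
    is_homeomorphism C TC Z TZ h.

(** ** Separable metrizable spaces *)

Definition is_metric {M : eps_structure} (R : real_structure M) (X d : M)
    : Prop :=
  is_fun2 d X X (Rcarrier R) /\
  (forall x y r : M, related2 d x y r -> rle R (Rzero R) r) /\
  (forall x y : M, x ∈ X -> y ∈ X -> (related2 d x y (Rzero R) <-> x = y)) /\
  (forall x y r : M, related2 d x y r -> related2 d y x r) /\
  (forall x y z r s t u : M, related2 d x y r -> related2 d y z s ->
     related2 d x z t -> related2 (Radd R) r s u -> rle R t u).

Definition metric_open {M : eps_structure} (R : real_structure M) (X d U : M)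
    : Prop :=
  subset U X /\
  forall x : M, x ∈ U ->
  exists e : M, rlt R (Rzero R) e /\
    forall y r : M, related2 d x y r -> rlt R r e -> y ∈ U.

Definition is_metrizable {M : eps_structure} (R : real_structure M) (X T : M)
    : Prop :=
  exists d : M, is_metric R X d /\ set_of (metric_open R X d) T.

Definition is_separable {M : eps_structure} (X T : M) : Prop :=
  exists D : M, countable D /\ is_dense X T D.

Definition separable_metrizable {M : eps_structure} (R : real_structure M)
    (X T : M) : Prop :=
  is_topology X T /\ is_metrizable R X T /\ is_separable X T.

(** ** The two principles *)

Definition Baire_class_1 {M : eps_structure} (X TX TY f : M) : Prop :=
  forall V : M, V ∈ TY -> exists P : M, is_preimage f V P /\ is_Fsigma X TX P.

Definition restriction_has_continuity_point {M : eps_structure}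
    (TX TY f K : M) : Prop :=
  exists TK g x : M, is_subspace TX K TK /\ is_restriction f K g /\
    x ∈ K /\ continuous_at TK TY g x.

Definition GBT {M : eps_structure} (R : real_structure M) : Prop :=
  forall X TX Y TY f : M,
  separable_metrizable R X TX -> separable_metrizable R Y TY -> is_fun f X Y ->
  (Baire_class_1 X TX TY f <->
   forall K TK : M, subset K X -> nonempty K ->
     is_subspace TX K TK -> is_compact K TK ->
     restriction_has_continuity_point TX TY f K).

Definition separates {M : eps_structure} (S A B : M) : Prop :=
  subset A S /\ forall x : M, x ∈ B -> x ∉ S.

Definition WHSP (M : eps_structure) : Prop :=
  forall N T A B : M, is_Baire_space N T ->
  subset A N -> subset B N -> (forall x : M, x ∈ A -> x ∉ B) ->
  ~ (exists S : M, subset S N /\ is_Fsigma N T S /\ separates S A B) ->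
  exists C TC D : M,
    is_Cantor_set N T C /\ (forall x : M, x ∈ C -> x ∈ A \/ x ∈ B) /\
    is_subspace T C TC /\ is_inter C A D /\
    is_dense C TC D /\ is_codense C TC D.

(* Main.v *)
From Stdlib Require Import ssreflect ssrfun Classical ClassicalEpsilon Setoid.
Require Import Defs.
Set Implicit Arguments.
Unset Strict Implicit.
Unset Printing Implicit Defensive.
Set SsrOldRewriteGoalsOrder.

(** Why the theorem holds.

    From [WHSP] to [GBT].  That a function of the first class has a point of
    continuity on every nonempty compact set does not need [WHSP]: the
    preimages of the sets of a countable base are countable unions of closed
    sets, and a point of the compact set that avoids the boundaries of all these
    closed sets is a point of continuity; it exists by the Baire category
    theorem ([Baire_class_1_continuity_point]).  Conversely, let [f : X -> Y]
    have points of continuity on compact sets, and suppose that the preimage of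
    an open set [V] is not [F_σ].  Then there is a basic open set [W] with
    closure in [V] such that no [F_σ] set separates the preimage of [W] from that
    of the complement of [V]; otherwise a choice of separating sets would
    decompose the preimage of [V].  Points of [X] have binary expansions along a
    countable base, and the relation between expansions and points is a closed
    continuous map from a set of binary sequences onto [X] ([expanded_closed],
    [expansion_continuous]).  So the two sets of expansions are not separated
    either, and [WHSP] gives a Cantor set of expansions in which each of them is
    dense.  The image of the Cantor set is compact, and near each of its points
    [f] takes values in [W] and values outside [V]: there is no point of
    continuity ([Fsigma_between]).

    From [GBT] to [WHSP].  If [A] and [B] are not separated, the characteristic
    function of [A] on [A ∪ B] is not of the first class.  By [GBT] there is a
    nonempty compact [K] in [A ∪ B] such that the restriction to [K] has no
    point of continuity, that is to say, [A ∩ K] and [B ∩ K] are dense in [K].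
    In particular [K] has no isolated points, so that it is itself a Cantor set
    by Brouwer's theorem ([perfect_compact_Cantor]).

    Choice is used to decompose countably many [F_σ] sets at once, and to find a
    countable dense subset of [A ∪ B].  In both cases the choice is among subsets
    of [ω × ω], hence, coding these by the sums of the subseries of a geometric
    series, among real numbers ([countable_choice]).

    All this takes place in a model [M] whose natural numbers may be nonstandard
    and in which only definable classes can be separated.  So sets are formed
    with operations whose graphs are definable, all of them built from the
    description operator [the]; recursion is along the natural numbers of [M]
    ([natrec]); and the side conditions of definability are left to the tactic
    [definability]. *)

(** * Definability with parameters *)

Existing Class ZF.

Fixpoint rename (f : nat -> nat) (p : formula) : formula :=
  match p with
  | FMem i j => FMem (f i) (f j)
  | FEq i j => FEq (f i) (f j)
  | FBot => FBot
  | FImp p q => FImp (rename f p) (rename f q)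
  | FAll p => FAll (rename (fun i => match i with O => O | S j => S (f j) end) p)
  end.

Lemma sat_ext (M : eps_structure) (p : formula) (r s : nat -> M) :
  (forall i, r i = s i) -> (sat r p <-> sat s p).
Proof.
  elim: p r s => [i j|i j||p IHp q IHq|p IHp] r s H //=.
  - by rewrite !H.
  - by rewrite !H.
  - by rewrite (IHp r s H) (IHq r s H).
  - by split=> K x; move: (K x); apply (IHp (scons x r) (scons x s)); case.
Qed.

Lemma sat_rename (M : eps_structure) (p : formula) f (r : nat -> M) :
  sat r (rename f p) <-> sat (fun i => r (f i)) p.
Proof.
  elim: p f r => [i j|i j||p IHp q IHq|p IHp] f r //=.
  - by rewrite IHp IHq.
  - split=> K x; move: (K x); rewrite IHp; apply sat_ext; by case.
Qed.

(** The assignment [r], in which the variable [i] of the formula is replaced by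
    the variable or by the parameter [s i]. *)
Definition look {M : eps_structure} (s : nat -> nat + M) (r : nat -> M)
    (i : nat) : M :=
  match s i with inl j => r j | inr a => a end.

(** The predicate [P] on assignments of the variables is the satisfaction of a
    formula with parameters. *)
Definition definable {M : eps_structure} (P : (nat -> M) -> Prop) : Prop :=
  exists (p : formula) (s : nat -> nat + M),
    forall r, P r <-> sat (look s r) p.

(** A term is definable when its graph is. *)
Definition definable_term {M : eps_structure} (t : (nat -> M) -> M) : Prop :=
  definable (fun r => r O = t (fun i => r (S i))).

(** The same notions for the predicates and the operations of [M] themselves;
    these are classes, so that instances are found by their heads. *)
Class definable1 {M : eps_structure} (P : M -> Prop) : Prop :=
  definable1P : definable (fun r => P (r 0)).

Class definable2 {M : eps_structure} (P : M -> M -> Prop) : Prop :=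
  definable2P : definable (fun r => P (r 0) (r 1)).

Class definable3 {M : eps_structure} (P : M -> M -> M -> Prop) : Prop :=
  definable3P : definable (fun r => P (r 0) (r 1) (r 2)).

Class definable4 {M : eps_structure} (P : M -> M -> M -> M -> Prop) : Prop :=
  definable4P : definable (fun r => P (r 0) (r 1) (r 2) (r 3)).

Class definable_fun {M : eps_structure} (F : M -> M) : Prop :=
  definable_funP : definable_term (fun r => F (r 0)).

Class definable_fun2 {M : eps_structure} (F : M -> M -> M) : Prop :=
  definable_fun2P : definable_term (fun r => F (r 0) (r 1)).

Class definable_fun3 {M : eps_structure} (F : M -> M -> M -> M) : Prop :=
  definable_fun3P : definable_term (fun r => F (r 0) (r 1) (r 2)).

Section Definability.
Context {M : eps_structure}.
Implicit Types (P Q : (nat -> M) -> Prop) (t : (nat -> M) -> M).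

Lemma def_ext P Q : (forall r, P r <-> Q r) -> definable P -> definable Q.
Proof. by move=> H [p [s K]]; exists p, s => r; rewrite -H K. Qed.

Lemma def_const (A : Prop) : definable (fun _ : nat -> M => A).
Proof.
  case: (classic A) => H.
  - by exists (FImp FBot FBot), (fun i => inl i) => r /=; tauto.
  - by exists FBot, (fun i => inl i) => r /=; tauto.
Qed.

(** Two copies of the variables, to keep the variables and parameters of the
    two sides of an implication apart. *)
Fixpoint even_odd (i : nat) : nat + nat :=
  match i with
  | 0 => inl 0
  | S 0 => inr 0
  | S (S j) => match even_odd j with inl k => inl (S k) | inr k => inr (S k) end
  end.

Fixpoint dbl (i : nat) : nat := match i with 0 => 0 | S j => S (S (dbl j)) end.

Lemma even_odd_dbl i : even_odd (dbl i) = inl i.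
Proof. by elim: i => [|i IH] //=; rewrite IH. Qed.

Lemma even_odd_dblS i : even_odd (S (dbl i)) = inr i.
Proof.
  elim: i => [|i IH] //.
  change (even_odd (S (dbl (S i)))) with
    (match even_odd (S (dbl i)) with inl k => inl (S k) | inr k => inr (S k) end).
  by rewrite IH.
Qed.

Lemma def_imp P Q :
  definable P -> definable Q -> definable (fun r => P r -> Q r).
Proof.
  move=> [p [s Hp]] [q [u Hq]].
  exists (FImp (rename dbl p) (rename (fun i => S (dbl i)) q)).
  exists (fun i => match even_odd i with inl k => s k | inr k => u k end) => r.
  set v := fun i => _.
  have E1 : sat (look v r) (rename dbl p) <-> P r.
    rewrite sat_rename Hp; apply sat_ext => i.
    by rewrite /look /v even_odd_dbl.
  have E2 : sat (look v r) (rename (fun i => S (dbl i)) q) <-> Q r.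
    rewrite sat_rename Hq; apply sat_ext => i.
    by rewrite /look /v even_odd_dblS.
  by rewrite /= E1 E2.
Qed.

Lemma def_all (G : (nat -> M) -> M -> Prop) :
  definable (fun r => G (fun i => r (S i)) (r 0)) ->
  definable (fun r => forall x, G r x).
Proof.
  move=> [p [s H]].
  exists (FAll (rename (fun i => match s i with inl 0 => 0 | _ => S i end) p)).
  exists (fun i => match s i with inl (S j) => inl j | inl 0 => inl 0
                   | inr a => inr a end) => r /=.
  have E x : G r x <->
      sat (scons x (look (fun i => match s i with inl (S j) => inl j
                 | inl 0 => inl 0 | inr a => inr a end) r))
        (rename (fun i => match s i with inl 0 => 0 | _ => S i end) p).
    rewrite sat_rename; rewrite (H (scons x r)); apply sat_ext => i.
    by rewrite /look; case E: (s i) => [[|j]|a] //=; rewrite E.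
  by split=> K x; apply E.
Qed.

Lemma def_not P : definable P -> definable (fun r => ~ P r).
Proof. move=> H; apply: def_imp H (def_const False). Qed.

Lemma def_and P Q :
  definable P -> definable Q -> definable (fun r => P r /\ Q r).
Proof.
  move=> HP HQ; apply: (def_ext (P := fun r => ~ (P r -> ~ Q r))).
  - by move=> r; tauto.
  - by apply: def_not; apply: def_imp HP (def_not HQ).
Qed.

Lemma def_or P Q :
  definable P -> definable Q -> definable (fun r => P r \/ Q r).
Proof.
  move=> HP HQ; apply: (def_ext (P := fun r => ~ P r -> Q r)).
  - by move=> r; tauto.
  - by apply: def_imp => //; apply: def_not.
Qed.

Lemma def_iff P Q :
  definable P -> definable Q -> definable (fun r => P r <-> Q r).
Proof. by move=> HP HQ; apply: def_and; apply: def_imp. Qed.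

Lemma def_ex (G : (nat -> M) -> M -> Prop) :
  definable (fun r => G (fun i => r (S i)) (r 0)) ->
  definable (fun r => exists x, G r x).
Proof.
  move=> H; apply: (def_ext (P := fun r => ~ forall x, ~ G r x)).
  - move=> r; split=> [K|[x K] L]; last by apply: (L x).
    by apply NNPP => L; apply: K => x Gx; apply: L; exists x.
  - by apply: def_not; apply: (@def_all (fun r x => ~ G r x)); apply: def_not.
Qed.

Lemma def_mem_var i j : definable (fun r : nat -> M => r i ∈ r j).
Proof. by exists (FMem i j), (fun i => inl i). Qed.

Lemma def_eq_var i j : definable (fun r : nat -> M => r i = r j).
Proof. by exists (FEq i j), (fun i => inl i). Qed.

Lemma def_rename (f : nat -> nat) P :
  definable P -> definable (fun r => P (fun i => r (f i))).
Proof.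
  move=> [p [s H]].
  exists p, (fun i => match s i with inl j => inl (f j) | inr a => inr a end).
  move=> r; rewrite H; apply sat_ext => i; rewrite /look.
  by case: (s i).
Qed.

(** All variables but the first may be given values. *)
Lemma def_inst (e : nat -> M) P :
  definable P ->
  definable (fun r => P (fun i => match i with 0 => r 0 | S j => e j end)).
Proof.
  move=> [p [s H]].
  exists p, (fun i => match s i with inl 0 => inl 0 | inl (S j) => inr (e j)
                      | inr a => inr a end).
  move=> r; rewrite H; apply sat_ext => i; rewrite /look.
  by case: (s i) => [[|j]|a].
Qed.

Lemma term_var i : definable_term (fun r : nat -> M => r i).
Proof. exact: def_eq_var. Qed.

Lemma term_const (a : M) : definable_term (fun _ => a).
Proof.
  by exists (FEq 0 1), (fun i => match i with 0 => inl 0 | _ => inr a end).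
Qed.

(** Substitution of definable terms into a definable relation. *)
Lemma def_app1 (A : M -> Prop) t :
  definable1 A -> definable_term t -> definable (fun r => A (t r)).
Proof.
  move=> HA Ht.
  apply: (def_ext (P := fun r => exists x, x = t r /\ A x)).
  - by move=> r; split=> [[x [-> ?]]|?] //; exists (t r).
  - apply: (@def_ex (fun r x => x = t r /\ A x)); apply: def_and => //.
Qed.

Lemma def_app2 (A : M -> M -> Prop) t u :
  definable2 A -> definable_term t -> definable_term u ->
  definable (fun r => A (t r) (u r)).
Proof.
  move=> HA Ht Hu.
  apply: (def_ext (P := fun r => exists x, x = t r /\ exists y, y = u r /\ A x y)).
  - by move=> r; split=> [[x [-> [y [-> ?]]]]|?] //; exists (t r); split => //; exists (u r).
  - apply: (@def_ex (fun r x => x = t r /\ exists y, y = u r /\ A x y)).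
    apply: def_and => //.
    apply: (@def_ex (fun r y => y = u (fun i => r (S i)) /\ A (r 0) y)).
    apply: def_and.
    + exact: (def_rename (fun i => match i with 0 => 0 | S j => S (S j) end) Hu).
    + exact: (def_rename (fun i => match i with 0 => 1 | 1 => 0 | _ => i end) HA).
Qed.

(** Substitution of one term; relations of several arguments are treated by
    substituting for one argument at a time. *)
Lemma def_subst (P : (nat -> M) -> M -> Prop) t :
  definable (fun r => P (fun i => r (S i)) (r 0)) -> definable_term t ->
  definable (fun r => P r (t r)).
Proof.
  move=> HP Ht.
  apply: (def_ext (P := fun r => exists x, x = t r /\ P r x)).
  - by move=> r; split=> [[x [-> ?]]|?] //; exists (t r).
  - by apply: (@def_ex (fun r x => x = t r /\ P r x)); apply: def_and.
Qed.

Lemma term_shift t (k : nat) :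
  definable_term t -> definable_term (fun r => t (fun i => r (k + i))).
Proof.
  move=> Ht.
  exact: (def_rename (fun i => match i with 0 => 0 | S j => S (k + j) end) Ht).
Qed.

Lemma def_app3 (A : M -> M -> M -> Prop) t u v :
  definable3 A -> definable_term t -> definable_term u -> definable_term v ->
  definable (fun r => A (t r) (u r) (v r)).
Proof.
  move=> HA Ht Hu Hv.
  apply: (@def_subst (fun r x => A x (u r) (v r))) => //=.
  apply: (@def_subst (fun r x => A (r 0) x (v (fun i => r (S i))))) => /=;
    last exact: (@term_shift u 1).
  apply: (@def_subst (fun r x => A (r 1) (r 0) x)) => /=;
    last exact: (@term_shift v 2).
  exact: (def_rename (fun i => match i with 0 => 2 | 2 => 0 | _ => i end) HA).
Qed.

Lemma def_app4 (A : M -> M -> M -> M -> Prop) t u v w :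
  definable4 A -> definable_term t -> definable_term u -> definable_term v ->
  definable_term w ->
  definable (fun r => A (t r) (u r) (v r) (w r)).
Proof.
  move=> HA Ht Hu Hv Hw.
  apply: (@def_subst (fun r x => A x (u r) (v r) (w r))) => //=.
  apply: (@def_subst (fun r x => A (r 0) x (v (fun i => r (S i))) (w (fun i => r (S i))))) => /=;
    last exact: (@term_shift u 1).
  apply: (@def_subst (fun r x => A (r 1) (r 0) x (w (fun i => r (S (S i)))))) => /=;
    last exact: (@term_shift v 2).
  apply: (@def_subst (fun r x => A (r 2) (r 1) (r 0) x)) => /=;
    last exact: (@term_shift w 3).
  exact: (def_rename (fun i => match i with 0 => 3 | 1 => 2 | 2 => 1 | 3 => 0 | _ => i end) HA).
Qed.

Lemma def_mem t u :
  definable_term t -> definable_term u -> definable (fun r => t r ∈ u r).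
Proof. by apply: def_app2; apply: def_mem_var. Qed.

Lemma def_eq t u :
  definable_term t -> definable_term u -> definable (fun r => t r = u r).
Proof. by apply: def_app2; apply: def_eq_var. Qed.

Lemma def_ex_unique (G : (nat -> M) -> M -> Prop) :
  definable (fun r => G (fun i => r (S i)) (r 0)) ->
  definable (fun r => exists! x, G r x).
Proof.
  move=> H; rewrite /unique.
  apply: (@def_ex (fun r x => G r x /\ forall y, G r y -> x = y)).
  apply: def_and => //.
  apply: (@def_all (fun r y => G (fun i => r (S i)) y -> r 0 = y)).
  apply: def_imp (def_eq_var _ _).
  exact: (def_rename (fun i => match i with 0 => 0 | S j => S (S j) end) H).
Qed.

Lemma term_app1 (F : M -> M) t :
  definable_fun F -> definable_term t -> definable_term (fun r => F (t r)).
Proof.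
  move=> HF Ht; apply: (@def_subst (fun r x => r 0 = F x)) => /=;
    last exact: (@term_shift t 1).
  exact: (def_rename (fun i => match i with 0 => 1 | 1 => 0 | _ => i end) HF).
Qed.

Lemma term_app2 (F : M -> M -> M) t u :
  definable_fun2 F -> definable_term t -> definable_term u ->
  definable_term (fun r => F (t r) (u r)).
Proof.
  move=> HF Ht Hu; apply: (@def_app3 (fun z x y => z = F x y) (fun r => r 0)).
  - exact: HF.
  - exact: term_var.
  - exact: (@term_shift t 1).
  - exact: (@term_shift u 1).
Qed.

Lemma term_app3 (F : M -> M -> M -> M) t u v :
  definable_fun3 F -> definable_term t -> definable_term u ->
  definable_term v -> definable_term (fun r => F (t r) (u r) (v r)).
Proof.
  move=> HF Ht Hu Hv;
    apply: (@def_app4 (fun z x y w => z = F x y w) (fun r => r 0)).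
  - exact: HF.
  - exact: term_var.
  - exact: (@term_shift t 1).
  - exact: (@term_shift u 1).
  - exact: (@term_shift v 1).
Qed.

End Definability.

(** * Operations on sets *)

#[global] Hint Mode definable1 - ! : typeclass_instances.
#[global] Hint Mode definable2 - ! : typeclass_instances.
#[global] Hint Mode definable3 - ! : typeclass_instances.
#[global] Hint Mode definable4 - ! : typeclass_instances.
#[global] Hint Mode definable_fun - ! : typeclass_instances.
#[global] Hint Mode definable_fun2 - ! : typeclass_instances.
#[global] Hint Mode definable_fun3 - ! : typeclass_instances.

(** The tactic [definability] proves that an explicit predicate or term is
    definable, by recursion on its structure: connectives and quantifiers, then
    operations that bind variables, which are registered in the hint base
    [definable_binders], then relations and operations that have an instance of
    one of the classes above. *)
Create HintDb definable_binders.

Ltac definability_step :=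
  lazymatch goal with
  | |- definable1 _ => red; cbv beta
  | |- definable2 _ => red; cbv beta
  | |- definable3 _ => red; cbv beta
  | |- definable4 _ => red; cbv beta
  | |- definable_fun _ => red; cbv beta
  | |- definable_fun2 _ => red; cbv beta
  | |- definable_fun3 _ => red; cbv beta
  | |- definable (fun _ => ?P) => exact (def_const P)
  | |- definable (fun r => @?P r -> @?Q r) => apply (@def_imp _ P Q); cbv beta
  | |- definable (fun r => forall x, @?G r x) => apply (@def_all _ G); cbv beta
  | |- definable (fun r => exists x, @?G r x) => apply (@def_ex _ G); cbv beta
  | |- definable (fun r => exists! x, @?G r x) =>
      apply (@def_ex_unique _ G); cbv beta
  | |- definable (fun r => @?P r /\ @?Q r) => apply (@def_and _ P Q); cbv beta
  | |- definable (fun r => @?P r \/ @?Q r) => apply (@def_or _ P Q); cbv beta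
  | |- definable (fun r => @?P r <-> @?Q r) => apply (@def_iff _ P Q); cbv beta
  | |- definable (fun r => ~ @?P r) => apply (@def_not _ P); cbv beta
  | |- definable (fun r => @?t r ∈ @?u r) => apply (@def_mem _ t u); cbv beta
  | |- definable (fun r => @?t r = @?u r) => apply (@def_eq _ t u); cbv beta
  | |- definable_term (fun _ => ?a) => exact (term_const a)
  | |- definable_term (fun r => r ?i) => exact (term_var i)
  | |- _ => first [ solve [auto 1 with nocore definable_binders] | definability_atom ]
  end
with definability_atom :=
  multimatch goal with
  | |- definable (fun r => ?A (@?t r) (@?u r) (@?v r) (@?w r)) =>
      apply (@def_app4 _ A t u v w); [ solve [typeclasses eauto] | .. ]; cbv beta
  | |- definable (fun r => ?A (@?t r) (@?u r) (@?v r)) =>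
      apply (@def_app3 _ A t u v); [ solve [typeclasses eauto] | .. ]; cbv beta
  | |- definable (fun r => ?A (@?t r) (@?u r)) =>
      apply (@def_app2 _ A t u); [ solve [typeclasses eauto] | .. ]; cbv beta
  | |- definable (fun r => ?A (@?t r)) =>
      apply (@def_app1 _ A t); [ solve [typeclasses eauto] | .. ]; cbv beta
  | |- definable_term (fun r => ?A (@?t r) (@?u r) (@?v r)) =>
      apply (@term_app3 _ A t u v); [ solve [typeclasses eauto] | .. ]; cbv beta
  | |- definable_term (fun r => ?A (@?t r) (@?u r)) =>
      apply (@term_app2 _ A t u); [ solve [typeclasses eauto] | .. ]; cbv beta
  | |- definable_term (fun r => ?A (@?t r)) =>
      apply (@term_app1 _ A t); [ solve [typeclasses eauto] | .. ]; cbv beta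
  end.

Ltac definability := repeat (once definability_step).

(* The hints below are for abstractions only: on the name of a predicate that
   has no instance they would loop. *)
Ltac is_lambda P := lazymatch P with (fun _ => _) => idtac end.

#[global] Hint Extern 1 (definable1 ?P) =>
  is_lambda P; solve [definability] : typeclass_instances core.
#[global] Hint Extern 1 (definable2 ?P) =>
  is_lambda P; solve [definability] : typeclass_instances core.
#[global] Hint Extern 1 (definable_fun ?P) =>
  is_lambda P; solve [definability] : typeclass_instances core.
#[global] Hint Extern 1 (definable_fun2 ?P) =>
  is_lambda P; solve [definability] : typeclass_instances core.

Section Partial.
Context {M : eps_structure}.

#[export] Instance def_partial1 (A : M -> M -> Prop) a :
  definable2 A -> definable1 (A a).
Proof. by move=> H; red; apply: def_app2 (term_const a) (term_var 0). Qed.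
#[export] Instance def_partial2 (A : M -> M -> M -> Prop) a :
  definable3 A -> definable2 (A a).
Proof. by move=> H; red; apply: def_app3 (term_const a) (term_var 0) (term_var 1). Qed.
#[export] Instance def_partial3 (A : M -> M -> M -> M -> Prop) a :
  definable4 A -> definable3 (A a).
Proof.
  by move=> H; red; apply: def_app4 (term_const a) (term_var 0) (term_var 1) (term_var 2).
Qed.
#[export] Instance def_fun_partial1 (F : M -> M -> M) a :
  definable_fun2 F -> definable_fun (F a).
Proof. by move=> H; red; apply: term_app2 (term_const a) (term_var 0). Qed.
#[export] Instance def_fun_partial2 (F : M -> M -> M -> M) a :
  definable_fun3 F -> definable_fun2 (F a).
Proof.
  by move=> H; red; apply: term_app3 (term_const a) (term_var 0) (term_var 1).
Qed.
End Partial.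

Section Basic.
Context {M : eps_structure} {hZF : ZF M}.
Implicit Types a b c f s x y z : M.

#[export] Instance def_subset : definable2 (@subset M).
Proof. rewrite /subset; definability. Qed.
#[export] Instance def_is_empty : definable1 (@is_empty M).
Proof. rewrite /is_empty /set_of; definability. Qed.
#[export] Instance def_nonempty : definable1 (@nonempty M).
Proof. rewrite /nonempty; definability. Qed.
#[export] Instance def_is_upair : definable3 (@is_upair M).
Proof. rewrite /is_upair /set_of; definability. Qed.
#[export] Instance def_is_pair : definable3 (@is_pair M).
Proof. rewrite /is_pair; definability. Qed.
#[export] Instance def_related : definable3 (@related M).
Proof. rewrite /related; definability. Qed.
#[export] Instance def_is_fun : definable3 (@is_fun M).
Proof. rewrite /is_fun; definability. Qed.

Lemma set_ext a b : (forall x, x ∈ a <-> x ∈ b) -> a = b.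
Proof. exact: (ZF_extensionality hZF). Qed.

Lemma model_inhabited : inhabited M.
Proof. by case: (ZF_infinity hZF) => s _; exists. Qed.

Lemma ex_empty : exists s : M, is_empty s.
Proof.
  case: (ZF_infinity hZF) => s _.
  case: (ZF_separation hZF FBot (fun _ => s) s) => e He.
  by exists e => x; rewrite (He x) /=; tauto.
Qed.

(** Opaque, so that conversion never looks inside [the]. *)
Lemma the_sig : {t : (M -> Prop) -> M | forall P : M -> Prop,
  (exists! z, P z) /\ P (t P) \/ ~ (exists! z, P z) /\ is_empty (t P)}.
Proof.
  exists (fun P => epsilon model_inhabited (fun y =>
    (exists! z, P z) /\ P y \/ ~ (exists! z, P z) /\ is_empty y)) => P.
  apply: (epsilon_spec model_inhabited (fun y =>
    (exists! z, P z) /\ P y \/ ~ (exists! z, P z) /\ is_empty y)).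
  case: (classic (exists! z, P z)) => H.
  - by case: (H) => z [Hz _]; exists z; left.
  - by case: ex_empty => e He; exists e; right.
Qed.

(** The unique element of [M] with a property; the empty set if there is no
    such element or more than one.  Every operation on [M] below is defined
    through [the], so that its graph is definable. *)
Definition the : (M -> Prop) -> M := proj1_sig the_sig.

Lemma the_spec (P : M -> Prop) :
  (exists! z, P z) /\ P (the P) \/ ~ (exists! z, P z) /\ is_empty (the P).
Proof. exact: (proj2_sig the_sig). Qed.

Lemma theP (P : M -> Prop) : (exists! z, P z) -> P (the P).
Proof. by move=> H; case: (the_spec P) => [[]|[]]. Qed.

Lemma the_eq (P : M -> Prop) y :
  P y -> (forall z, P z -> z = y) -> the P = y.
Proof.
  move=> Hy U; apply: (U); apply: theP.
  by exists y; split => // z Hz; rewrite (U z).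
Qed.

Lemma term_the (P : (nat -> M) -> M -> Prop) :
  definable (fun r => P (fun i => r (S i)) (r 0)) ->
  definable_term (fun r => the (P r)).
Proof.
  move=> H.
  apply: (@def_ext _ (fun r =>
    (exists! z, P (fun i => r (S i)) z) /\ P (fun i => r (S i)) (r 0) \/
    ~ (exists! z, P (fun i => r (S i)) z) /\ is_empty (r 0))).
  - move=> r; split; last by move=> ->; exact: the_spec.
    case: (the_spec (P (fun i => r (S i)))) => [[E K]|[E K]] [[E' K']|[E' K']] //.
    + by case: E => z [Hz U]; rewrite -(U _ K) -(U _ K').
    + by apply: set_ext => x; rewrite (K x) (K' x).
  - have H2 : definable (fun r => P (fun i => r (S (S i))) (r 0)).
      exact: (def_rename (fun i => match i with 0 => 0 | S j => S (S j) end) H).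
    by definability.
Qed.
End Basic.

#[global] Hint Extern 0 (definable_term _) =>
  lazymatch goal with |- definable_term (fun r => the (@?P r)) =>
    apply (@term_the _ _ P); cbv beta; definability end : definable_binders.

(** The operations are sealed: unfolding them during conversion is never useful
    and can be very long. *)
Lemma seal : unit. Proof. exact: tt. Qed.

Section Operations.
Context {M : eps_structure} {hZF : ZF M}.

Lemma the_set_of (P : M -> Prop) s : set_of P s -> set_of P (the (set_of P)).
Proof.
  move=> H; apply: theP; exists s; split => // t Ht.
  by apply: set_ext => x; rewrite (H x) (Ht x).
Qed.

Lemma in_the_set_of (P : M -> Prop) s :
  set_of P s -> forall x, x ∈ the (set_of P) <-> P x.
Proof. by move=> H x; apply: (the_set_of H). Qed.

Lemma set_ofE (P : M -> Prop) s t :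
  (forall x, x ∈ t <-> P x) -> (set_of P s <-> s = t).
Proof.
  by move=> H; split=> [K|-> //]; apply: set_ext => x; rewrite (K x) H.
Qed.

(** [{x ∈ a | P x}], for definable [P]. *)
Definition sep : M -> (M -> Prop) -> M :=
  locked_with seal (fun a P => the (set_of (fun x => x ∈ a /\ P x))).

Lemma separation_def (P : M -> Prop) a :
  definable1 P -> exists s, set_of (fun x => x ∈ a /\ P x) s.
Proof.
  move=> [p [s H]].
  pose e i := match s i with inl j => a | inr b => b end.
  pose f i := match s i with inl 0 => 0 | _ => S i end.
  case: (ZF_separation hZF (rename f p) e a) => t Ht.
  exists t => x; rewrite (Ht x) sat_rename (H (fun i => match i with 0 => x | _ => a end)).
  suff E : sat (fun i => scons x e (f i)) p <->
     sat (look s (fun i => match i with 0 => x | _ => a end)) p by rewrite E.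
  apply sat_ext => i; rewrite /look /f /e.
  by case E: (s i) => [[|j]|b] //=; rewrite E.
Qed.

Lemma in_sep a (P : M -> Prop) {H : definable1 P} x :
  x ∈ sep a P <-> x ∈ a /\ P x.
Proof. rewrite /sep locked_withE. by case: (separation_def a H) => s H0; apply: (in_the_set_of H0). Qed.

Lemma term_sep (t : (nat -> M) -> M) (P : (nat -> M) -> M -> Prop) :
  definable_term t -> definable (fun r => P (fun i => r (S i)) (r 0)) ->
  definable_term (fun r => sep (t r) (P r)).
Proof.
  move=> Ht HP; rewrite /sep locked_withE.
  apply: (@term_the _ _ (fun r => set_of (fun x => x ∈ t r /\ P r x))).
  rewrite /set_of; have Ht2 := @term_shift _ t 2 Ht.
  have HP2 := def_rename (fun i => match i with 0 => 0 | S j => S (S j) end) HP.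
  apply: (@def_all _ (fun r x => x ∈ r 0 <->
     x ∈ t (fun i => r (S i)) /\ P (fun i => r (S i)) x)).
  apply: def_iff; first by definability.
  apply: def_and; last exact: HP2.
  by apply: def_mem Ht2; definability.
Qed.

(** The usual operations. Outside of their intended domain they take arbitrary
    values. *)
Definition empty : M := locked_with seal (the is_empty).
Definition upair : M -> M -> M :=
  locked_with seal (fun a b => the (is_upair a b)).
Definition union : M -> M :=
  locked_with seal (fun a => the (is_union a)).
Definition power : M -> M :=
  locked_with seal (fun a => the (is_power a)).
Definition pair : M -> M -> M :=
  locked_with seal (fun a b => upair (upair a a) (upair a b)).
Definition cup : M -> M -> M :=
  locked_with seal (fun a b => union (upair a b)).
Definition single : M -> M :=
  locked_with seal (fun a => upair a a).
Definition succ : M -> M :=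
  locked_with seal (fun a => cup a (single a)).

#[export] Instance def_upair : definable_fun2 upair.
Proof. rewrite /upair locked_withE /is_upair /set_of; definability. Qed.
#[export] Instance def_union : definable_fun union.
Proof. rewrite /union locked_withE /is_union /set_of; definability. Qed.
#[export] Instance def_power : definable_fun power.
Proof. rewrite /power locked_withE /is_power /set_of; definability. Qed.
#[export] Instance def_pair : definable_fun2 pair.
Proof. rewrite /pair locked_withE; definability. Qed.
#[export] Instance def_cup : definable_fun2 cup.
Proof. rewrite /cup locked_withE; definability. Qed.
#[export] Instance def_single : definable_fun single.
Proof. rewrite /single locked_withE; definability. Qed.
#[export] Instance def_succ : definable_fun succ.
Proof. rewrite /succ locked_withE; definability. Qed.

Lemma not_in_empty x : ~ x ∈ empty.
Proof. rewrite /empty locked_withE.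
  have : is_empty (the is_empty) by case: (@ex_empty M _) => e He; exact: (the_set_of (P := fun _ => False) He).
  by move=> H /H.
Qed.

Lemma in_upair a b x : x ∈ upair a b <-> x = a \/ x = b.
Proof. rewrite /upair locked_withE. by case: (ZF_pairing hZF a b) => s H0; apply: (in_the_set_of H0). Qed.

Lemma in_union a x : x ∈ union a <-> exists y, y ∈ a /\ x ∈ y.
Proof. rewrite /union locked_withE. by case: (ZF_union hZF a) => s H0; apply: (in_the_set_of H0). Qed.

Lemma in_power a x : x ∈ power a <-> subset x a.
Proof. rewrite /power locked_withE. by case: (ZF_power_set hZF a) => s H0; apply: (in_the_set_of H0). Qed.

Lemma in_cup a b x : x ∈ cup a b <-> x ∈ a \/ x ∈ b.
Proof. rewrite /cup locked_withE.
  rewrite in_union; split=> [[y [/in_upair [->|->]]]|[]]; try tauto.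
  - by exists a; rewrite in_upair; tauto.
  - by exists b; rewrite in_upair; tauto.
Qed.

Lemma in_single a x : x ∈ single a <-> x = a.
Proof. rewrite /single locked_withE. rewrite in_upair; tauto. Qed.

Lemma in_succ a x : x ∈ succ a <-> x ∈ a \/ x = a.
Proof. rewrite /succ locked_withE. by rewrite in_cup in_single. Qed.

Lemma is_emptyE s : is_empty s <-> s = empty.
Proof. by apply: set_ofE => x; split=> // /not_in_empty. Qed.

Lemma is_upairE a b s : is_upair a b s <-> s = upair a b.
Proof. exact: set_ofE (in_upair a b). Qed.

Lemma is_unionE a s : is_union a s <-> s = union a.
Proof. exact: set_ofE (in_union a). Qed.

Lemma is_powerE a s : is_power a s <-> s = power a.
Proof. exact: set_ofE (in_power a). Qed.

Lemma is_succE a s : is_succ a s <-> s = succ a.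
Proof. exact: set_ofE (in_succ a). Qed.

Lemma upair_inj a b c d : upair a b = upair c d ->
  a = c /\ b = d \/ a = d /\ b = c.
Proof.
  move=> E.
  have Ha : a ∈ upair c d by rewrite -E in_upair; left.
  have Hb : b ∈ upair c d by rewrite -E in_upair; right.
  have Hc : c ∈ upair a b by rewrite E in_upair; left.
  have Hd : d ∈ upair a b by rewrite E in_upair; right.
  move: Ha Hb Hc Hd; rewrite !in_upair.
  by intuition congruence.
Qed.

Lemma pair_inj a b c d : pair a b = pair c d -> a = c /\ b = d.
Proof. rewrite /pair locked_withE.
  case/upair_inj=> [[/upair_inj E /upair_inj F]|[/upair_inj E /upair_inj F]];
    intuition congruence.
Qed.

Lemma is_pairE a b p : is_pair a b p <-> p = pair a b.
Proof. rewrite /pair locked_withE.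
  split=> [[s [t [/is_upairE -> [/is_upairE -> /is_upairE]]]]|->] //.
  by exists (upair a a), (upair a b); rewrite !is_upairE.
Qed.

Lemma relatedE r x y : related r x y <-> pair x y ∈ r.
Proof.
  split=> [[p [/is_pairE -> //]]|H].
  by exists (pair x y); rewrite is_pairE.
Qed.

Lemma related2E r x y z : related2 r x y z <-> pair (pair x y) z ∈ r.
Proof.
  split=> [[p [/is_pairE -> /relatedE]] //|H].
  by exists (pair x y); rewrite is_pairE relatedE.
Qed.

Definition inter : M -> M -> M :=
  locked_with seal (fun a b => sep a (fun x => x ∈ b)).
Definition diff : M -> M -> M :=
  locked_with seal (fun a b => sep a (fun x => x ∉ b)).
Definition fst : M -> M :=
  locked_with seal (fun x => the (fun y => exists z, x = pair y z)).
Definition snd : M -> M :=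
  locked_with seal (fun x => the (fun z => exists y, x = pair y z)).
(** The value of the function [f] at [x]. *)
Definition app : M -> M -> M :=
  locked_with seal (fun f x => the (fun y => pair x y ∈ f)).
(** [x] if [P] holds, and [y] otherwise. *)
Definition ite : Prop -> M -> M -> M :=
  locked_with seal (fun P x y => the (fun z => P /\ z = x \/ ~ P /\ z = y)).
(** The image of [a] under a definable operation. *)
Definition img : M -> (M -> M) -> M :=
  locked_with seal (fun a F => the (set_of (fun y => exists x, x ∈ a /\ y = F x))).
(** The function with domain [a] given by the definable operation [F]. *)
Definition lam : M -> (M -> M) -> M :=
  locked_with seal (fun a F => img a (fun x => pair x (F x))).
Definition prod : M -> M -> M :=
  locked_with seal (fun a b => union (img a (fun x => img b (fun y => pair x y)))).

Lemma fst_pair x y : fst (pair x y) = x.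
Proof. rewrite /fst locked_withE.
  by apply: the_eq; [exists y | move=> z [u /pair_inj []]].
Qed.

Lemma snd_pair x y : snd (pair x y) = y.
Proof. rewrite /snd locked_withE.
  by apply: the_eq; [exists x | move=> z [u /pair_inj []]].
Qed.

Lemma ite_true (P : Prop) x y : P -> ite P x y = x.
Proof. rewrite /ite locked_withE. by move=> H; apply: the_eq; [left | move=> z [[]|[]]]. Qed.

Lemma ite_false (P : Prop) x y : ~ P -> ite P x y = y.
Proof. rewrite /ite locked_withE. by move=> H; apply: the_eq; [right | move=> z [[]|[]]]. Qed.

Lemma replacement_def (F : M -> M) a :
  definable_fun F -> exists s, set_of (fun y => exists x, x ∈ a /\ y = F x) s.
Proof.
  move=> HF.
  have : definable (fun r : nat -> M => r 1 = F (r 0)) by definability.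
  move=> [p [s H]].
  pose e i := match s i with inl j => a | inr b => b end.
  pose f i := match s i with inl 0 => 0 | inl 1 => 1 | _ => S (S i) end.
  have E x y : y = F x <-> sat (scons x (scons y e)) (rename f p).
    rewrite sat_rename (H (fun i => match i with 0 => x | 1 => y | _ => a end)).
    apply sat_ext => i; rewrite /look /f /e.
    by case E: (s i) => [[|[|j]]|b] //=; rewrite E.
  case: (ZF_replacement hZF (rho := e) (p := rename f p) (a := a)).
  - by move=> x y z _; rewrite -!E => -> ->.
  - move=> t Ht; exists t => y; rewrite (Ht y).
    by split=> -[x [Hx K]]; exists x; split => //; apply/E.
Qed.

Lemma in_img a (F : M -> M) {H : definable_fun F} y :
  y ∈ img a F <-> exists x, x ∈ a /\ y = F x.
Proof. rewrite /img locked_withE. by case: (replacement_def a H) => s H0; apply: (in_the_set_of H0). Qed.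

Lemma term_img (t : (nat -> M) -> M) (F : (nat -> M) -> M -> M) :
  definable_term t -> definable_term (fun r => F (fun i => r (S i)) (r 0)) ->
  definable_term (fun r => img (t r) (F r)).
Proof.
  move=> Ht HF; rewrite /img locked_withE.
  apply: (@term_the _ _ (fun r => set_of (fun y => exists x, x ∈ t r /\ y = F r x))).
  rewrite /set_of; have Ht3 := @term_shift _ t 3 Ht.
  have HF3 : definable_term (fun r => F (fun i => r (S (S (S i)))) (r 0)).
    exact: (def_rename (fun i => match i with 0 => 0 | 1 => 1 | S (S j) => S (S (S (S j))) end) HF).
  apply: (@def_all _ (fun r y => y ∈ r 0 <->
     exists x, x ∈ t (fun i => r (S i)) /\ y = F (fun i => r (S i)) x)).
  apply: def_iff; first by definability.
  apply: (@def_ex _ (fun r x => x ∈ t (fun i => r (S (S i))) /\ r 0 = F (fun i => r (S (S i))) x)).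
  apply: def_and; first by apply: def_mem Ht3; definability.
  by apply: def_eq HF3; definability.
Qed.

Lemma term_lam (t : (nat -> M) -> M) (F : (nat -> M) -> M -> M) :
  definable_term t -> definable_term (fun r => F (fun i => r (S i)) (r 0)) ->
  definable_term (fun r => lam (t r) (F r)).
Proof.
  move=> Ht HF; rewrite /lam locked_withE.
  apply: (@term_img t (fun r x => pair x (F r x))) => //.
  by apply: term_app2; definability.
Qed.

Lemma term_ite (P : (nat -> M) -> Prop) (t u : (nat -> M) -> M) :
  definable P -> definable_term t -> definable_term u ->
  definable_term (fun r => ite (P r) (t r) (u r)).
Proof.
  move=> HP Ht Hu; rewrite /ite locked_withE.
  have HP1 : definable (fun r => P (fun i => r (S i))) by exact: (def_rename S HP).
  have Ht1 := @term_shift _ t 1 Ht; have Hu1 := @term_shift _ u 1 Hu.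
  apply: (@term_the _ _ (fun r z => P r /\ z = t r \/ ~ P r /\ z = u r)).
  by definability.
Qed.
End Operations.

#[global] Hint Extern 0 (definable_term _) =>
  lazymatch goal with
  | |- definable_term (fun r => sep (@?t r) (@?P r)) =>
      apply (@term_sep _ _ t P); cbv beta; definability
  | |- definable_term (fun r => img (@?t r) (@?F r)) =>
      apply (@term_img _ _ t F); cbv beta; definability
  | |- definable_term (fun r => lam (@?t r) (@?F r)) =>
      apply (@term_lam _ _ t F); cbv beta; definability
  | |- definable_term (fun r => ite (@?P r) (@?t r) (@?u r)) =>
      apply (@term_ite _ _ P t u); cbv beta; definability
  end : definable_binders.

Section Functions.
Context {M : eps_structure} {hZF : ZF M}.
Implicit Types a b c f s x y z : M.

#[export] Instance def_inter : definable_fun2 inter.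
Proof. rewrite /inter locked_withE; definability. Qed.
#[export] Instance def_diff : definable_fun2 diff.
Proof. rewrite /diff locked_withE; definability. Qed.
#[export] Instance def_fst : definable_fun fst.
Proof. rewrite /fst locked_withE; definability. Qed.
#[export] Instance def_snd : definable_fun snd.
Proof. rewrite /snd locked_withE; definability. Qed.
#[export] Instance def_app : definable_fun2 app.
Proof. rewrite /app locked_withE; definability. Qed.
#[export] Instance def_prod : definable_fun2 prod.
Proof. rewrite /prod locked_withE; definability. Qed.

Lemma in_inter a b x : x ∈ inter a b <-> x ∈ a /\ x ∈ b.
Proof. rewrite /inter locked_withE. exact: in_sep. Qed.

Lemma in_diff a b x : x ∈ diff a b <-> x ∈ a /\ x ∉ b.
Proof. rewrite /diff locked_withE. exact: in_sep. Qed.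

Lemma in_prod a b p :
  p ∈ prod a b <-> exists x y, x ∈ a /\ y ∈ b /\ p = pair x y.
Proof. rewrite /prod locked_withE.
  rewrite in_union; split.
  - case=> s [/in_img [x [Hx ->]] /in_img [y [Hy ->]]].
    by exists x, y.
  - case=> x [y [Hx [Hy ->]]]; exists (img b (fun y => pair x y)).
    by rewrite !in_img; split; [exists x | exists y].
Qed.

Lemma pair_in_prod a b x y : pair x y ∈ prod a b <-> x ∈ a /\ y ∈ b.
Proof.
  rewrite in_prod; split=> [[u [v [Hu [Hv /pair_inj [-> ->]]]]]|[Hx Hy]] //.
  by exists x, y.
Qed.

Lemma is_interE a b s : is_inter a b s <-> s = inter a b.
Proof. exact: set_ofE (in_inter a b). Qed.

Lemma is_diffE a b s : is_diff a b s <-> s = diff a b.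
Proof. exact: set_ofE (in_diff a b). Qed.

Lemma is_prodE a b s : is_prod a b s <-> s = prod a b.
Proof.
  apply: set_ofE => p; rewrite in_prod.
  by split=> -[x [y]]; rewrite ?is_pairE; exists x, y; rewrite ?is_pairE.
Qed.

Lemma app_eq f a b x y : is_fun f a b -> pair x y ∈ f -> app f x = y.
Proof. rewrite /app locked_withE.
  move=> [Hs Hf] H.
  case: (Hs _ H) => [x' [y' [Hx [Hy /is_pairE /pair_inj [E1 E2]]]]]; subst x' y'.
  apply: the_eq => // z Hz.
  case: (Hf x Hx) => w [_ U].
  by rewrite -(U y) ?relatedE // -(U z) ?relatedE.
Qed.

Lemma app_pair f a b x : is_fun f a b -> x ∈ a -> pair x (app f x) ∈ f.
Proof.
  move=> Hf Hx; case: (Hf) => [Hs F].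
  by case: (F x Hx) => y [/relatedE K _]; rewrite (app_eq Hf K).
Qed.

Lemma fun_dom f a b x y : is_fun f a b -> pair x y ∈ f -> x ∈ a /\ y ∈ b.
Proof.
  move=> [Hs _] /Hs [x' [y' [Hx [Hy /is_pairE /pair_inj [E1 E2]]]]].
  by rewrite E1 E2.
Qed.

Lemma app_in f a b x : is_fun f a b -> x ∈ a -> app f x ∈ b.
Proof. by move=> Hf Hx; case: (fun_dom Hf (app_pair Hf Hx)). Qed.

Lemma fun_pair f a b x y :
  is_fun f a b -> (pair x y ∈ f <-> x ∈ a /\ y = app f x).
Proof.
  move=> Hf; split=> [H|[Hx ->]]; last exact: app_pair Hf Hx.
  by rewrite (app_eq Hf H); case: (fun_dom Hf H).
Qed.

Lemma fun_related f a b x y :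
  is_fun f a b -> (related f x y <-> x ∈ a /\ y = app f x).
Proof. by move=> Hf; rewrite relatedE (fun_pair _ _ Hf). Qed.

Lemma fun_ext f g a b c : is_fun f a b -> is_fun g a c ->
  (forall x, x ∈ a -> app f x = app g x) -> f = g.
Proof.
  move=> Hf Hg E; apply: set_ext => p; split=> Hp.
  - case: (Hf) => [Hs _]; case: (Hs p Hp) => x [y [Hx [_ /is_pairE Ep]]].
    move: Hp; rewrite Ep (fun_pair _ _ Hf) (fun_pair _ _ Hg) => -[_ ->].
    by rewrite E.
  - case: (Hg) => [Hs _]; case: (Hs p Hp) => x [y [Hx [_ /is_pairE Ep]]].
    move: Hp; rewrite Ep (fun_pair _ _ Hf) (fun_pair _ _ Hg) => -[_ ->].
    by rewrite E.
Qed.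

Lemma in_lam a (F : M -> M) {H : definable_fun F} p :
  p ∈ lam a F <-> exists x, x ∈ a /\ p = pair x (F x).
Proof. by rewrite /lam locked_withE in_img. Qed.

Lemma pair_in_lam a (F : M -> M) {H : definable_fun F} x y :
  pair x y ∈ lam a F <-> x ∈ a /\ y = F x.
Proof.
  rewrite in_lam; split=> [[z [Hz /pair_inj [-> ->]]]|[Hx ->]] //.
  by exists x.
Qed.

Lemma app_lam a (F : M -> M) {H : definable_fun F} x :
  x ∈ a -> app (lam a F) x = F x.
Proof. rewrite /app locked_withE.
  move=> Hx; apply: the_eq; first by apply/pair_in_lam.
  by move=> z /pair_in_lam [].
Qed.

Lemma lam_fun a b (F : M -> M) {H : definable_fun F} :
  (forall x, x ∈ a -> F x ∈ b) -> is_fun (lam a F) a b.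
Proof.
  move=> K; split=> [p /in_lam [x [Hx ->]]|x Hx].
  - by exists x, (F x); rewrite is_pairE; split => //; split => //; apply: K.
  - exists (F x); split=> [|y]; rewrite relatedE pair_in_lam //.
    by case.
Qed.

Lemma is_fun_sub f a b c : subset b c -> is_fun f a b -> is_fun f a c.
Proof.
  move=> H [K L]; split => // p /K [x [y [Hx [Hy E]]]].
  by exists x, y; split => //; split => //; apply: H.
Qed.

Lemma is_fun2E f a b c : is_fun2 f a b c <-> is_fun f (prod a b) c.
Proof.
  split=> [[s [/is_prodE -> //]]|H].
  by exists (prod a b); rewrite is_prodE.
Qed.

Lemma fun2_related f a b c x y z : is_fun f (prod a b) c ->
  (related2 f x y z <-> x ∈ a /\ y ∈ b /\ z = app f (pair x y)).
Proof.
  by move=> Hf; rewrite related2E (fun_pair _ _ Hf) pair_in_prod; tauto.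
Qed.
End Functions.

(** * Natural numbers and recursion *)

Section Naturals.
Context {M : eps_structure} {hZF : ZF M}.
Implicit Types a b c f s x y z m n k : M.

#[export] Instance def_is_succ : definable2 (@is_succ M).
Proof. rewrite /is_succ /set_of; definability. Qed.
#[export] Instance def_inductive_set : definable1 (@inductive_set M).
Proof. rewrite /inductive_set; definability. Qed.
#[export] Instance def_is_omega : definable1 (@is_omega M).
Proof. rewrite /is_omega; definability. Qed.

Definition omega : M := locked_with seal (the is_omega).
Definition one : M := locked_with seal (succ empty).
Definition two : M := locked_with seal (succ one).

Lemma oneE : one = succ empty. Proof. by rewrite /one locked_withE. Qed.
Lemma twoE : two = succ one. Proof. by rewrite /two locked_withE. Qed.

Lemma inductive_setE s :
  inductive_set s <-> empty ∈ s /\ forall n, n ∈ s -> succ n ∈ s.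
Proof.
  split=> -[H K]; split.
  - by apply: H; apply/is_emptyE.
  - by move=> n Hn; apply: K Hn _; apply/is_succE.
  - by move=> e /is_emptyE ->.
  - by move=> n m Hn /is_succE ->; apply: K.
Qed.

Lemma omega_spec : is_omega omega.
Proof. rewrite /omega locked_withE.
  apply: theP; case: (ZF_infinity hZF) => s [_ Hs].
  pose (w := sep s (fun x => forall v, inductive_set v -> x ∈ v)).
  have Hw : is_omega w.
  { split; last by move=> v Hv x /in_sep [_ H]; apply: H.
    apply/inductive_setE; split.
    - rewrite in_sep; split; first by case/inductive_setE: Hs.
      by move=> v /inductive_setE [].
    - move=> n /in_sep [Hn K]; rewrite in_sep; split.
        by case/inductive_setE: Hs => _; apply.
      by move=> v Hv; case/inductive_setE: (Hv) => _; apply; apply: K. }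
  exists w; split => // v [Hv Kv]; apply: set_ext => x; split.
  - by case: Hw => _ /(_ v Hv); apply.
  - by case: Hw => Iw _; apply: Kv.
Qed.

Lemma is_omegaE w : is_omega w <-> w = omega.
Proof.
  split=> [[Hv Kv]|->]; last exact: omega_spec.
  have [Hw Kw] := omega_spec.
  by apply: set_ext => x; split; [apply: Kv | apply: Kw].
Qed.

Lemma zero_in : empty ∈ omega.
Proof. by case: omega_spec => /inductive_setE []. Qed.

Lemma succ_in n : n ∈ omega -> succ n ∈ omega.
Proof. by case: omega_spec => /inductive_setE [_ H] _; apply: H. Qed.

Lemma omega_ind (P : M -> Prop) {H : definable1 P} :
  P empty -> (forall n, n ∈ omega -> P n -> P (succ n)) ->
  forall n, n ∈ omega -> P n.
Proof.
  move=> H0 HS n Hn.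
  have K : n ∈ sep omega P; last by move: K; rewrite in_sep => -[].
  case: omega_spec => _; apply => //.
  apply/inductive_setE; split; first by rewrite in_sep; split => //; exact: zero_in.
  move=> m /in_sep [Hm K]; rewrite in_sep; split; first exact: succ_in.
  exact: HS.
Qed.

Lemma omega_case n : n ∈ omega -> n = empty \/ exists m, m ∈ omega /\ n = succ m.
Proof.
  move: n; apply: omega_ind; first by left.
  by move=> n Hn _; right; exists n.
Qed.

Lemma omega_trans n m k : n ∈ omega -> m ∈ n -> k ∈ m -> k ∈ n.
Proof.
  move=> Hn; move: n Hn m k; apply: omega_ind.
  - by move=> m k /not_in_empty.
  - move=> n Hn IH m k; rewrite !in_succ => -[Hm|->] Hk; left => //.
    exact: IH Hm Hk.
Qed.

Lemma omega_mem n m : n ∈ omega -> m ∈ n -> m ∈ omega.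
Proof.
  move=> Hn; move: n Hn m; apply: omega_ind.
  - by move=> m /not_in_empty.
  - by move=> n Hn IH m /in_succ [/IH|->].
Qed.

Lemma mem_irrefl x : ~ x ∈ x.
Proof.
  move=> H; case: (ZF_foundation hZF (a := single x)).
  - by exists x; apply/in_single.
  - by move=> y [/in_single -> K]; apply: (K x H); apply/in_single.
Qed.

Lemma mem_asym x y : x ∈ y -> ~ y ∈ x.
Proof.
  move=> H K; case: (ZF_foundation hZF (a := upair x y)).
  - by exists x; apply/in_upair; left.
  - move=> z [/in_upair [->|->] L]; [apply: (L y K)|apply: (L x H)];
      apply/in_upair; tauto.
Qed.

Lemma succ_inj n m : succ n = succ m -> n = m.
Proof.
  move=> E.
  have : n ∈ succ m by rewrite -E in_succ; right.
  have : m ∈ succ n by rewrite E in_succ; right.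
  rewrite !in_succ => -[H|-> //] [K|-> //].
  by case: (mem_asym H K).
Qed.

Lemma succ_neq0 n : succ n <> empty.
Proof. by move=> E; apply: (@not_in_empty M _ n); rewrite -E in_succ; right. Qed.

Lemma mem_succ n : n ∈ succ n. Proof. by apply/in_succ; right. Qed.

Lemma succ_mono n m : n ∈ omega -> m ∈ omega -> m ∈ n -> succ m ∈ succ n.
Proof.
  move=> Hn; move: n Hn m; apply: omega_ind; first by move=> m _ /not_in_empty.
  move=> n Hn IH m Hm /in_succ [H|->]; last exact: mem_succ.
  by apply/in_succ; left; apply: IH.
Qed.

Lemma omega_total n m : n ∈ omega -> m ∈ omega -> n ∈ m \/ n = m \/ m ∈ n.
Proof.
  move=> Hn; move: n Hn m; apply: omega_ind.
  - apply: omega_ind; first by tauto.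
    move=> m Hm; rewrite !in_succ => -[H|[H|/not_in_empty //]]; tauto.
  - move=> n Hn IH m Hm.
    case: (IH m Hm) => [H|[->|H]].
    + case: (omega_case Hm) => [E|[k [Hk E]]].
        by move: H; rewrite E => /not_in_empty.
      move: H; rewrite E => /in_succ [H|->]; last by tauto.
      by left; apply: succ_mono.
    + by right; right; exact: mem_succ.
    + by right; right; apply/in_succ; left.
Qed.

Lemma mem_succ_iff n m : n ∈ omega -> m ∈ omega -> (n ∈ succ m <-> ~ m ∈ n).
Proof.
  move=> Hn Hm; rewrite in_succ; split.
  - move=> [H|->]; [exact: mem_asym|exact: mem_irrefl].
  - by case: (omega_total Hn Hm); tauto.
Qed.

Lemma omega_least (P : M -> Prop) {H : definable1 P} :
  (exists n, n ∈ omega /\ P n) ->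
  exists n, n ∈ omega /\ P n /\ forall m, m ∈ n -> ~ P m.
Proof.
  move=> [n [Hn Pn]]; apply: NNPP => C.
  suff K : forall k, k ∈ omega -> forall m, m ∈ k -> ~ P m.
    by apply: (K _ (succ_in Hn) n (mem_succ n)).
  apply: omega_ind; first by move=> m /not_in_empty.
  move=> k Hk IH m /in_succ [|->]; first exact: IH.
  by move=> Pk; apply: C; exists k.
Qed.

Lemma in_two x : x ∈ two <-> x = empty \/ x = one.
Proof.
  rewrite twoE oneE !in_succ; split; last by tauto.
  by move=> [[/not_in_empty|]|]; tauto.
Qed.

Lemma one_neq0 : one <> empty. Proof. rewrite oneE; exact: succ_neq0. Qed.

Lemma one_in : one ∈ omega. Proof. rewrite oneE; exact: succ_in zero_in. Qed.

Lemma two_sub : subset two omega.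
Proof. by move=> x /in_two [->|->]; [apply: zero_in|apply: one_in]. Qed.

(** The least natural number with a property; [empty] if there is none. *)
Definition least : (M -> Prop) -> M := locked_with seal
  (fun P => the (fun n => n ∈ omega /\ P n /\ forall m, m ∈ n -> ~ P m)).

Lemma leastP (P : M -> Prop) {H : definable1 P} :
  (exists n, n ∈ omega /\ P n) ->
  least P ∈ omega /\ P (least P) /\ forall m, m ∈ least P -> ~ P m.
Proof. rewrite /least locked_withE.
  move=> /omega_least [n [Hn [Pn Ln]]].
  apply: (theP (P := fun n => n ∈ omega /\ P n /\ forall m, m ∈ n -> ~ P m)).
  exists n; split=> // m [Hm [Pm Lm]].
  case: (omega_total Hn Hm) => [K|[//|K]]; [by case: (Lm n)|by case: (Ln m)].
Qed.

Lemma least_eq (P : M -> Prop) n :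
  n ∈ omega -> P n -> (forall m, m ∈ n -> ~ P m) -> least P = n.
Proof. rewrite /least locked_withE.
  move=> Hn Pn Ln; apply: the_eq => // m [Hm [Pm Lm]].
  case: (omega_total Hn Hm) => [K|[//|K]]; [by case: (Lm n)|by case: (Ln m)].
Qed.

Lemma term_least (P : (nat -> M) -> M -> Prop) :
  definable (fun r => P (fun i => r (S i)) (r 0)) ->
  definable_term (fun r => least (P r)).
Proof.
  move=> HP; rewrite /least locked_withE.
  apply: (@term_the _ _ (fun r n => n ∈ omega /\ P r n /\ forall m, m ∈ n -> ~ P r m)).
  apply: def_and; first by definability.
  apply: def_and; first exact: HP.
  apply: (@def_all _ (fun r m => m ∈ r 0 -> ~ P (fun i => r (S i)) m)).
  apply: def_imp; first by definability.
  apply: def_not.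
  exact: (def_rename (fun i => match i with 0 => 0 | S j => S (S j) end) HP).
Qed.

(** A set of pairs is an attempt at the function with value [a] at [0] and
    [G n y] at [succ n] when each of its pairs is justified by another one. *)
Definition attempt a (G : M -> M -> M) f : Prop :=
  forall p, p ∈ f -> p = pair empty a \/
    exists i y, i ∈ omega /\ pair i y ∈ f /\ p = pair (succ i) (G i y).

(** Definition by recursion on the natural numbers of [M], along a definable
    operation [G]. *)
Definition natrec : M -> (M -> M -> M) -> M -> M := locked_with seal
  (fun a G n => the (fun y => exists f, attempt a G f /\ pair n y ∈ f)).

Section Recursion.
Context (a : M) (G : M -> M -> M) {HG : definable_fun2 G}.

Lemma attempt_unique n : n ∈ omega -> forall f g y z,
  attempt a G f -> attempt a G g -> pair n y ∈ f -> pair n z ∈ g -> y = z.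
Proof.
  move: n; apply: omega_ind; first by rewrite /attempt; definability.
  - move=> f g y z Hf Hg Hy Hz.
    case: (Hf _ Hy) => [/pair_inj [_ ->]|[i [u [_ [_ /pair_inj [E _]]]]]];
      last by case: (@succ_neq0 i).
    case: (Hg _ Hz) => [/pair_inj [_ ->] //|[i [u [_ [_ /pair_inj [E _]]]]]].
    by case: (@succ_neq0 i).
  - move=> n Hn IH f g y z Hf Hg Hy Hz.
    case: (Hf _ Hy) => [/pair_inj [E _]|[i [u [_ [Hu /pair_inj [E ->]]]]]];
      first by case: (@succ_neq0 n).
    case: (Hg _ Hz) => [/pair_inj [E' _]|[j [v [_ [Hv /pair_inj [E' ->]]]]]];
      first by case: (@succ_neq0 n).
    move: (succ_inj E) (succ_inj E') => E1 E2; subst i j.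
    by rewrite (IH f g u v).
Qed.

Lemma attempt_exists n : n ∈ omega ->
  exists y f, attempt a G f /\ pair n y ∈ f.
Proof.
  move: n; apply: omega_ind; first by rewrite /attempt; definability.
  - exists a, (single (pair empty a)); split; last by apply/in_single.
    by move=> p /in_single; left.
  - move=> n Hn [y [f [Hf Hy]]].
    exists (G n y), (cup f (single (pair (succ n) (G n y)))); split.
    + move=> p /in_cup [/Hf [->|[i [u [Hi [Hu ->]]]]]|/in_single ->].
      * by left.
      * by right; exists i, u; rewrite in_cup; tauto.
      * by right; exists n, y; rewrite in_cup; tauto.
    + by apply/in_cup; right; apply/in_single.
Qed.

Lemma natrec_eq n y f :
  n ∈ omega -> attempt a G f -> pair n y ∈ f -> natrec a G n = y.
Proof. rewrite /natrec locked_withE.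
  move=> Hn Hf Hy; apply: the_eq; first by exists f.
  by move=> z [g [Hg Hz]]; apply: (attempt_unique Hn Hg Hf).
Qed.

Lemma natrec0 : natrec a G empty = a.
Proof.
  apply: (natrec_eq (f := single (pair empty a))); first exact: zero_in.
  - by move=> p /in_single; left.
  - by apply/in_single.
Qed.

Lemma natrecS n : n ∈ omega -> natrec a G (succ n) = G n (natrec a G n).
Proof.
  move=> Hn; case: (attempt_exists Hn) => y [f [Hf Hy]].
  rewrite (natrec_eq Hn Hf Hy).
  apply: (natrec_eq (f := cup f (single (pair (succ n) (G n y)))));
    first exact: succ_in.
  - move=> p /in_cup [/Hf [->|[i [u [Hi [Hu ->]]]]]|/in_single ->].
    + by left.
    + by right; exists i, u; rewrite in_cup; tauto.
    + by right; exists n, y; rewrite in_cup; tauto.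
  - by apply/in_cup; right; apply/in_single.
Qed.

Lemma natrec_in b : a ∈ b ->
  (forall n y, n ∈ omega -> y ∈ b -> G n y ∈ b) ->
  forall n, n ∈ omega -> natrec a G n ∈ b.
Proof.
  move=> Ha HS n Hn.
  have K : forall n, n ∈ omega -> forall y f, attempt a G f -> pair n y ∈ f -> y ∈ b.
  { apply: omega_ind; first by rewrite /attempt; definability.
    - move=> y f Hf Hy.
      case: (Hf _ Hy) => [/pair_inj [_ -> //]|[i [u [_ [_ /pair_inj [E _]]]]]].
      by case: (@succ_neq0 i).
    - move=> m Hm IH y f Hf Hy.
      case: (Hf _ Hy) => [/pair_inj [E _]|[i [u [Hi [Hu /pair_inj [E ->]]]]]];
        first by case: (@succ_neq0 m).
      move: (succ_inj E) => E1; subst i.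
      by apply: HS => //; apply: IH Hf Hu. }
  case: (attempt_exists Hn) => y [f [Hf Hy]].
  by rewrite (natrec_eq Hn Hf Hy); apply: K Hf Hy.
Qed.
End Recursion.

Lemma term_natrec (t u : (nat -> M) -> M) (G : (nat -> M) -> M -> M -> M) :
  definable_term t -> definable_term u ->
  definable_term (fun r => G (fun i => r (S (S i))) (r 1) (r 0)) ->
  definable_term (fun r => natrec (t r) (G r) (u r)).
Proof.
  move=> Ht Hu HG; rewrite /natrec locked_withE /attempt.
  apply: (@term_the _ _ (fun r y => exists f, (forall p, p ∈ f ->
    p = pair empty (t r) \/ exists i y, i ∈ omega /\ pair i y ∈ f /\
      p = pair (succ i) (G r i y)) /\ pair (u r) y ∈ f)).
  have Ht3 := @term_shift _ t 3 Ht. have Hu2 := @term_shift _ u 2 Hu.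
  apply: (@def_ex _ (fun r f => (forall p, p ∈ f ->
    p = pair empty (t (fun i => r (S i))) \/
      exists i y, i ∈ omega /\ pair i y ∈ f /\
      p = pair (succ i) (G (fun i => r (S i)) i y)) /\
      pair (u (fun i => r (S i))) (r 0) ∈ f)).
  apply: def_and; last first.
    by apply: def_mem; [apply: term_app2; definability|definability].
  apply: (@def_all _ (fun r p => p ∈ r 0 ->
    p = pair empty (t (fun i => r (S (S i)))) \/
      exists i y, i ∈ omega /\ pair i y ∈ r 0 /\
      p = pair (succ i) (G (fun i => r (S (S i))) i y))).
  apply: def_imp; first by definability.
  apply: def_or.
    by apply: def_eq; [definability|apply: term_app2; definability].
  apply: (@def_ex _ (fun r i => exists y, i ∈ omega /\ pair i y ∈ r 1 /\
      r 0 = pair (succ i) (G (fun i => r (S (S (S i)))) i y))).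
  apply: (@def_ex _ (fun r y => r 0 ∈ omega /\ pair (r 0) y ∈ r 2 /\
      r 1 = pair (succ (r 0)) (G (fun i => r (S (S (S (S i))))) (r 0) y))).
  apply: def_and; first by definability.
  apply: def_and; first by definability.
  apply: def_eq; first by definability.
  apply: term_app2; first by definability.
  exact: (def_rename (fun i => match i with 0 => 0 | 1 => 1 | 2 => 2
     | S (S (S j)) => S (S (S (S (S (S j))))) end) HG).
Qed.
End Naturals.

#[global] Hint Extern 0 (definable_term _) =>
  lazymatch goal with
  | |- definable_term (fun r => least (@?P r)) =>
      apply (@term_least _ _ P); cbv beta; definability
  | |- definable_term (fun r => natrec (@?t r) (@?G r) (@?u r)) =>
      apply (@term_natrec _ _ t u G); cbv beta; definability
  end : definable_binders.

(** * Pairing of numbers, countable and finite sets *)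

Section Pairing.
Context {M : eps_structure} {hZF : ZF M}.

(** The walk through [ω × ω] along the shells [max u v = n]. *)
Definition walk_step : M -> M := locked_with seal (fun p =>
  ite (fst p ∈ snd p) (pair (succ (fst p)) (snd p))
    (ite (fst p = snd p)
       (ite (snd p = empty) (pair empty one) (pair (snd p) empty))
       (ite (succ (snd p) = fst p) (pair empty (succ (fst p)))
          (pair (fst p) (succ (snd p)))))).

#[export] Instance def_walk_step : definable_fun walk_step.
Proof. rewrite /walk_step locked_withE; definability. Qed.

(** The walk is a surjection from [ω] onto [ω × ω]; [code] inverts it. *)
Definition unpair : M -> M := locked_with seal
  (fun n => natrec (pair empty empty) (fun _ p => walk_step p) n).

#[export] Instance def_unpair : definable_fun unpair.
Proof. rewrite /unpair locked_withE; definability. Qed.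

Lemma walk_step_in p : p ∈ prod omega omega -> walk_step p ∈ prod omega omega.
Proof.
  move=> /in_prod [u [v [Hu [Hv ->]]]]; rewrite /walk_step locked_withE fst_pair snd_pair.
  case: (classic (u ∈ v)) => H1; [rewrite ite_true //|rewrite ite_false //].
    by rewrite pair_in_prod; split => //; apply: succ_in.
  case: (classic (u = v)) => H2; [rewrite ite_true //|rewrite ite_false //].
  { case: (classic (v = empty)) => H3; [rewrite ite_true //|rewrite ite_false //].
    - by rewrite pair_in_prod; split; [apply: zero_in|apply: one_in].
    - by rewrite pair_in_prod; split; [|apply: zero_in]. }
  case: (classic (succ v = u)) => H3; [rewrite ite_true //|rewrite ite_false //].
  - by rewrite pair_in_prod; split; [apply: zero_in|apply/succ_in].
  - by rewrite pair_in_prod; split; [|apply: succ_in].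
Qed.

Lemma unpairS n : n ∈ omega -> unpair (succ n) = walk_step (unpair n).
Proof.
  rewrite /unpair locked_withE => Hn.
  exact: (natrecS (G := fun _ p => walk_step p) (pair empty empty) Hn).
Qed.

Lemma unpair0 : unpair empty = pair empty empty.
Proof. rewrite /unpair locked_withE; exact: natrec0. Qed.

Lemma unpair_in n : n ∈ omega -> unpair n ∈ prod omega omega.
Proof.
  rewrite /unpair locked_withE; apply: natrec_in; first by rewrite pair_in_prod; split; apply: zero_in.
  by move=> k y _; apply: walk_step_in.
Qed.

Lemma unpair_eta n : n ∈ omega ->
  fst (unpair n) ∈ omega /\ snd (unpair n) ∈ omega /\
  unpair n = pair (fst (unpair n)) (snd (unpair n)).
Proof.
  by move=> /unpair_in /in_prod [u [v [Hu [Hv ->]]]]; rewrite fst_pair snd_pair.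
Qed.

Definition reached p : Prop := exists n, n ∈ omega /\ unpair n = p.

Lemma reached_step p : reached p -> reached (walk_step p).
Proof.
  move=> [n [Hn E]]; exists (succ n); split; first exact: succ_in.
  by rewrite unpairS // E.
Qed.

Lemma reached_up n : n ∈ omega -> reached (pair empty n) ->
  forall u, u ∈ omega -> u ∈ n \/ u = n -> reached (pair u n).
Proof.
  move=> Hn H; apply: omega_ind; first by rewrite /reached; definability.
  - by [].
  - move=> u Hu IH C.
    have K : u ∈ n.
    { case: C => [C|<-]; last exact: mem_succ.
      exact: (omega_trans Hn C (mem_succ u)). }
    have := reached_step (IH (or_introl K)).
    by rewrite /walk_step locked_withE fst_pair snd_pair ite_true.
Qed.

Lemma reached_right n : n ∈ omega -> reached (pair empty n) ->
  forall v, v ∈ omega -> v ∈ n -> reached (pair n v).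
Proof.
  move=> Hn H; apply: omega_ind; first by rewrite /reached; definability.
  - move=> N.
    have := reached_step (reached_up Hn H Hn (or_intror eq_refl)).
    rewrite /walk_step locked_withE fst_pair snd_pair ite_false; last exact: mem_irrefl.
    rewrite ite_true // ite_false // => E.
    by move: N; rewrite E => /not_in_empty.
  - move=> v Hv IH C.
    have K : v ∈ n by exact: (omega_trans Hn C (mem_succ v)).
    have := reached_step (IH K).
    rewrite /walk_step locked_withE fst_pair snd_pair ite_false; last exact: mem_asym.
    rewrite ite_false; last by move=> E; apply: (@mem_irrefl _ _ v); rewrite -{2}E.
    rewrite ite_false //.
    by move=> E; apply: (@mem_irrefl _ _ n); rewrite -{1}E.
Qed.

Lemma reached_shell n : n ∈ omega -> reached (pair empty n).
Proof.
  move: n; apply: omega_ind; first by rewrite /reached; definability.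
  - exists empty; split; [exact: zero_in|exact: unpair0].
  - move=> n Hn H.
    case: (omega_case Hn) => [E|[m [Hm E]]].
    + subst n; have := reached_step H.
      rewrite /walk_step locked_withE fst_pair snd_pair ite_false; last exact: not_in_empty.
      by rewrite !ite_true // oneE.
    + have K : m ∈ n by rewrite E; apply: mem_succ.
      have := reached_step (reached_right Hn H Hm K).
      rewrite /walk_step locked_withE fst_pair snd_pair ite_false; last exact: mem_asym.
      rewrite ite_false; last by move=> E'; apply: (@mem_irrefl _ _ m); rewrite -{2}E'.
      by rewrite ite_true.
Qed.

Lemma unpair_surj x y : x ∈ omega -> y ∈ omega ->
  exists n, n ∈ omega /\ unpair n = pair x y.
Proof.
  move=> Hx Hy; case: (omega_total Hx Hy) => [H|[H|H]].
  - by apply: (reached_up Hy (reached_shell Hy) Hx); left.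
  - by apply: (reached_up Hy (reached_shell Hy) Hx); right.
  - exact: (reached_right Hx (reached_shell Hx) Hy H).
Qed.

Definition code : M -> M -> M := locked_with seal
  (fun x y => least (fun n => unpair n = pair x y)).

Lemma codeP x y : x ∈ omega -> y ∈ omega ->
  code x y ∈ omega /\ unpair (code x y) = pair x y.
Proof.
  move=> Hx Hy; rewrite /code locked_withE.
  by case: (leastP (P := fun n => unpair n = pair x y) (unpair_surj Hx Hy)) => ? [].
Qed.
End Pairing.

Section Cardinality.
Context {M : eps_structure} {hZF : ZF M}.

#[export] Instance def_is_bijection : definable3 (@is_bijection M).
Proof. rewrite /is_bijection /is_injection; definability. Qed.
#[export] Instance def_is_injection : definable3 (@is_injection M).
Proof. rewrite /is_injection; definability. Qed.
#[export] Instance def_finite : definable1 (@finite M).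
Proof. rewrite /finite; definability. Qed.
#[export] Instance def_countable : definable1 (@countable M).
Proof. rewrite /countable; definability. Qed.
#[export] Instance def_is_union : definable2 (@is_union M).
Proof. rewrite /is_union /set_of; definability. Qed.

Lemma is_injectionE f a b : is_injection f a b <->
  is_fun f a b /\
  forall x y, x ∈ a -> y ∈ a -> app f x = app f y -> x = y.
Proof.
  split=> -[Hf H]; split => //.
  - move=> x y Hx Hy E; apply: (H x y (app f x)); apply/(fun_related _ _ Hf) => //.
  - move=> x y z /(fun_related _ _ Hf) [Hx ->] /(fun_related _ _ Hf) [Hy E].
    exact: H.
Qed.

Lemma is_bijectionE f a b : is_bijection f a b <->
  is_fun f a b /\
  (forall x y, x ∈ a -> y ∈ a -> app f x = app f y -> x = y) /\
  forall y, y ∈ b -> exists x, x ∈ a /\ app f x = y.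
Proof.
  split.
  - move=> [/is_injectionE [Hf H] K]; split => //; split => // y /K [x].
    by rewrite (fun_related _ _ Hf) => -[Hx ->]; exists x.
  - move=> [Hf [H K]]; split; first by apply/is_injectionE.
    move=> y /K [x [Hx E]]; exists x; by rewrite (fun_related _ _ Hf).
Qed.

Lemma countableE a : countable a <-> exists f, is_fun f a omega /\
  forall x y, x ∈ a -> y ∈ a -> app f x = app f y -> x = y.
Proof.
  split=> [[w [f [/is_omegaE -> /is_injectionE H]]]|[f H]]; first by exists f.
  by exists omega, f; rewrite is_omegaE is_injectionE.
Qed.

Lemma countable_img a (F : M -> M) {HF : definable_fun F} :
  countable a -> countable (img a F).
Proof.
  move=> /countableE [f [Hf inj]]; apply/countableE.
  pose (P := fun y n => exists x, x ∈ a /\ F x = y /\ app f x = n).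
  have HP y : y ∈ img a F -> least (P y) ∈ omega /\ P y (least (P y)).
  { rewrite in_img => -[x [Hx E]].
    case: (@leastP M _ (P y)).
    - by rewrite /P; definability.
    - by exists (app f x); split; [apply: app_in Hf Hx|exists x].
    - by move=> ? []. }
  exists (lam (img a F) (fun y => least (P y))).
  have D : definable_fun (fun y => least (P y)) by rewrite /P; definability.
  split; first by apply: lam_fun => y /HP [].
  move=> x y Hx Hy; rewrite !app_lam // => E.
  case: (HP x Hx) => _ [u [Hu [E1 E2]]].
  case: (HP y Hy) => _ [v [Hv [E3 E4]]].
  by rewrite -E1 -E3; congr F; apply: inj => //; rewrite E2 E4.
Qed.

Lemma countable_omega : countable omega.
Proof.
  apply/countableE; exists (lam omega (fun x => x)); split.
  - by apply: lam_fun.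
  - by move=> x y Hx Hy; rewrite !app_lam.
Qed.

Lemma countable_omega2 : countable (prod omega omega).
Proof.
  have -> : prod omega omega = img omega unpair.
  { apply: set_ext => p; rewrite in_img; split.
    - move=> /in_prod [x [y [Hx [Hy ->]]]].
      by case: (unpair_surj Hx Hy) => n [Hn E]; exists n.
    - by move=> [n [Hn ->]]; apply: unpair_in. }
  exact: countable_img countable_omega.
Qed.

Lemma finiteE a : finite a <-> exists n f, n ∈ omega /\ is_bijection f a n.
Proof.
  split=> [[w [n [f [/is_omegaE -> [Hn H]]]]]|[n [f [Hn H]]]]; first by exists n, f.
  by exists omega, n, f; rewrite is_omegaE.
Qed.

Lemma finite_empty : finite empty.
Proof.
  apply/finiteE; exists empty, empty; split; first exact: zero_in.
  apply/is_bijectionE; split; last by split=> [x y|y] /not_in_empty.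
  by split=> [p|p] /not_in_empty.
Qed.

Lemma finite_add s x : finite s -> finite (cup s (single x)).
Proof.
  move=> Hs; case: (classic (x ∈ s)) => [H|N].
    have -> : cup s (single x) = s; last by [].
    by apply: set_ext => y; rewrite in_cup in_single; split=> [[|->]|]; tauto.
  case/finiteE: Hs => n [f [Hn /is_bijectionE [Hf [inj surj]]]].
  apply/finiteE; exists (succ n), (lam (cup s (single x)) (fun y => ite (y = x) n (app f y))).
  split; first exact: succ_in.
  have E1 : ite (x = x) n (app f x) = n by rewrite ite_true.
  have E2 y : y ∈ s -> ite (y = x) n (app f y) = app f y.
    by move=> Hy; rewrite ite_false // => E; subst y.
  apply/is_bijectionE; split; last split.
  - apply: lam_fun => y; rewrite in_cup in_single => -[Hy|->].
    + by rewrite E2 // in_succ; left; apply: app_in Hf Hy.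
    + by rewrite E1; apply: mem_succ.
  - move=> y z Hy Hz; rewrite !app_lam //.
    move: Hy Hz; rewrite !in_cup !in_single => -[Hy|->] [Hz|->] //.
    + by rewrite !E2 //; apply: inj.
    + rewrite E1 E2 // => E.
      by case: (@mem_irrefl M _ n); rewrite -{1}E; apply: app_in Hf Hy.
    + rewrite E1 E2 // => E.
      by case: (@mem_irrefl M _ n); rewrite {1}E; apply: app_in Hf Hz.
  - move=> y; rewrite in_succ => -[/surj [z [Hz E]]|->].
    + have Hz' : z ∈ cup s (single x) by rewrite in_cup; left.
      by exists z; split=> //; rewrite app_lam // E2.
    + have Hx' : x ∈ cup s (single x) by rewrite in_cup in_single; right.
      by exists x; split=> //; rewrite app_lam // E1.
Qed.

Lemma finite_ind (P : M -> Prop) {H : definable1 P} :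
  P empty -> (forall s x, finite s -> P s -> P (cup s (single x))) ->
  forall s, finite s -> P s.
Proof.
  move=> H0 HS s /finiteE [n [f [Hn Hf]]]; move: n Hn s f Hf.
  have K : forall n, n ∈ omega -> forall s f, is_bijection f s n -> finite s /\ P s.
  { apply: omega_ind.
    - move=> s f /is_bijectionE [Hf _].
      have -> : s = empty.
      { apply: set_ext => x; split=> [Hx|/not_in_empty //].
        by case: (@not_in_empty M _ (app f x)); apply: app_in Hf Hx. }
      by split=> //; apply: finite_empty.
    - move=> n Hn IH s f /is_bijectionE [Hf [inj surj]].
      case: (surj n (mem_succ n)) => x [Hx E].
      have Es : s = cup (diff s (single x)) (single x).
      { apply: set_ext => y; rewrite in_cup in_diff !in_single.
        split=> [Hy|[[]|->]] //.
        by case: (classic (y = x)); tauto. }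
      have [F1 F2] : finite (diff s (single x)) /\ P (diff s (single x)).
      { apply: (IH _ (lam (diff s (single x)) (app f))).
        have D : definable_fun (app f) by red; definability.
        apply/is_bijectionE; split; last split.
        - apply: lam_fun => y; rewrite in_diff in_single => -[Hy N].
          have : app f y ∈ succ n by exact: (app_in Hf Hy).
          rewrite in_succ => -[//|Ey].
          by case: N; apply: inj => //; rewrite Ey E.
        - move=> y z Hy Hz; rewrite !app_lam //.
          by move: Hy Hz; rewrite !in_diff => -[? _] [? _]; apply: inj.
        - move=> y Hy; have Hy' : y ∈ succ n by rewrite in_succ; left.
          case: (surj y Hy') => z [Hz Ez].
          have Hz' : z ∈ diff s (single x).
          { rewrite in_diff in_single; split=> // E'; subst z.
            by case: (@mem_irrefl M _ n); rewrite -{1}E Ez. }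
          by exists z; rewrite app_lam. }
      by rewrite Es; split; [apply: finite_add|apply: HS]. }
  by move=> n Hn s f /(K n Hn) [].
Qed.

Lemma finite_cup a b : finite a -> finite b -> finite (cup a b).
Proof.
  move=> Ha; move: b; apply: finite_ind.
  - have -> : cup a empty = a; last by [].
    by apply: set_ext => x; rewrite in_cup; split=> [[|/not_in_empty]|]; tauto.
  - move=> s x _ H.
    have -> : cup a (cup s (single x)) = cup (cup a s) (single x); last exact: finite_add.
    by apply: set_ext => y; rewrite !in_cup; tauto.
Qed.
End Cardinality.

(** * Sequences and the product topology *)

Section Sequences.
Context {M : eps_structure} {hZF : ZF M}.
Implicit Types m n x y z X Y U V W K T : M.

(** [x] and [y] take the same values below [n]. *)
Definition agree n x y : Prop := forall i, i ∈ n -> app x i = app y i.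

#[export] Instance def_agree : definable3 agree.
Proof. rewrite /agree; definability. Qed.

(** [U] is a union of basic neighbourhoods [{y ∈ X | agree n x y}]. *)
Definition agree_open X U : Prop :=
  subset U X /\ forall x, x ∈ U ->
  exists n, n ∈ omega /\ forall y, y ∈ X -> agree n x y -> y ∈ U.

#[export] Instance def_agree_open : definable2 agree_open.
Proof. rewrite /agree_open; definability. Qed.

(** The topology on a set [X] of sequences in which a basic neighbourhood of
    [x] consists of the points that agree with [x] below some [n]. *)
Definition agree_top : M -> M := locked_with seal
  (fun X => sep (power X) (agree_open X)).

(** The set [Y^ω]. *)
Definition seqs : M -> M := locked_with seal
  (fun Y => sep (power (prod omega Y)) (fun x => is_fun x omega Y)).

Lemma in_seqs Y x : x ∈ seqs Y <-> is_fun x omega Y.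
Proof.
  rewrite /seqs locked_withE in_sep in_power; split=> [[] //|H]; split => // p Hp.
  case: (H) => K _; case: (K p Hp) => u [v [Hu [Hv /is_pairE ->]]].
  by rewrite pair_in_prod.
Qed.

Lemma in_agree_top X U : U ∈ agree_top X <-> agree_open X U.
Proof.
  rewrite /agree_top locked_withE in_sep in_power.
  by split=> [[] //|H]; split => //; case: H.
Qed.

Lemma seqs_app Y x n : x ∈ seqs Y -> n ∈ omega -> app x n ∈ Y.
Proof. by rewrite in_seqs; apply: app_in. Qed.

Lemma seqs_ext Y Y' x y : x ∈ seqs Y -> y ∈ seqs Y' ->
  (forall n, n ∈ omega -> app x n = app y n) -> x = y.
Proof. by rewrite !in_seqs; apply: fun_ext. Qed.

Lemma lam_seqs Y (F : M -> M) {H : definable_fun F} :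
  (forall n, n ∈ omega -> F n ∈ Y) -> lam omega F ∈ seqs Y.
Proof. by move=> K; rewrite in_seqs; apply: lam_fun. Qed.

Lemma agree_sym n x y : agree n x y -> agree n y x.
Proof. by move=> H i Hi; rewrite H. Qed.

Lemma agree_trans n x y z : agree n x y -> agree n y z -> agree n x z.
Proof. by move=> H K i Hi; rewrite H ?K. Qed.

Lemma agree_zero x y : agree empty x y.
Proof. by move=> i /not_in_empty. Qed.

Lemma agree_succ n x y :
  agree (succ n) x y <-> agree n x y /\ app x n = app y n.
Proof.
  split=> [H|[H K] i]; first split.
  - by move=> i Hi; apply: H; rewrite in_succ; left.
  - by apply: H; apply: mem_succ.
  - by rewrite in_succ => -[/H|->].
Qed.

Lemma agree_le n m x y : n ∈ omega -> m ∈ n -> agree n x y -> agree m x y.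
Proof. by move=> Hn Hm H i Hi; apply: H; apply: omega_trans Hi. Qed.

(** Two numbers have a common upper bound; [m ≤ n] is [m ∈ succ n]. *)
Lemma omega_max n m : n ∈ omega -> m ∈ omega ->
  exists k, k ∈ omega /\ n ∈ succ k /\ m ∈ succ k.
Proof.
  move=> Hn Hm; case: (omega_total Hn Hm) => [H|[->|H]].
  - by exists m; rewrite !in_succ; tauto.
  - by exists m; rewrite !in_succ; tauto.
  - by exists n; rewrite !in_succ; tauto.
Qed.

Lemma agree_leS n m x y : n ∈ omega -> m ∈ succ n -> agree n x y -> agree m x y.
Proof. by move=> Hn; rewrite in_succ => -[H|-> //]; apply: agree_le. Qed.

Lemma cylinder_agree_open X x n :
  n ∈ omega -> agree_open X (sep X (fun y => agree n x y)).
Proof.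
  move=> Hn; split=> [y|y]; rewrite in_sep => -[Hy H] //.
  exists n; split => // z Hz K; rewrite in_sep; split => //.
  exact: agree_trans K.
Qed.

Lemma agree_open_inter X U V :
  agree_open X U -> agree_open X V -> agree_open X (inter U V).
Proof.
  move=> [HU KU] [HV KV]; split=> [x|x]; rewrite in_inter => -[Hu Hv].
    exact: HU.
  case: (KU x Hu) => n [Hn An]; case: (KV x Hv) => m [Hm Am].
  case: (omega_max Hn Hm) => k [Hk [H1 H2]].
  exists k; split => // y Hy A; rewrite in_inter; split.
  - by apply: An => //; apply: agree_leS A.
  - by apply: Am => //; apply: agree_leS A.
Qed.

Lemma agree_open_union X S :
  (forall U, U ∈ S -> agree_open X U) -> agree_open X (union S).
Proof.
  move=> H; split=> [x|x]; rewrite in_union => -[U [HU Hx]].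
    by case: (H U HU) => K _; apply: K.
  case: (H U HU) => _ /(_ x Hx) [n [Hn K]].
  by exists n; split => // y Hy A; rewrite in_union; exists U; split => //; apply: K.
Qed.

Lemma agree_open_full X : agree_open X X.
Proof.
  by split => // x Hx; exists empty; split => //; apply: zero_in.
Qed.

Lemma agree_topology X : is_topology X (agree_top X).
Proof.
  split; last split; last split.
  - by move=> U; rewrite in_agree_top => -[].
  - by rewrite in_agree_top; apply: agree_open_full.
  - move=> S U HS /is_unionE ->; rewrite in_agree_top.
    by apply: agree_open_union => V /HS; rewrite in_agree_top.
  - move=> U V W; rewrite !in_agree_top => HU HV /is_interE ->.
    exact: agree_open_inter.
Qed.

(** A set is open as soon as each of its points has an open neighbourhood
    inside it. *)
Lemma open_local X T U : is_topology X T ->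
  (forall x, x ∈ U -> exists V, V ∈ T /\ x ∈ V /\ subset V U) -> U ∈ T.
Proof.
  move=> [_ [_ [HU _]]] H.
  apply: (HU (sep T (fun V => subset V U))).
  - by move=> V; rewrite in_sep => -[].
  - apply/is_unionE/set_ext => x; rewrite in_union; split.
    + by move=> /H [V [HV [Hx K]]]; exists V; rewrite in_sep.
    + by move=> [V []]; rewrite in_sep => -[_ K] /K.
Qed.

Lemma open_sub X T U : is_topology X T -> U ∈ T -> subset U X.
Proof. by case=> H _ /H. Qed.

Lemma open_full X T : is_topology X T -> X ∈ T.
Proof. by case=> _ []. Qed.

Lemma open_inter X T U V :
  is_topology X T -> U ∈ T -> V ∈ T -> inter U V ∈ T.
Proof. by move=> [_ [_ [_ H]]] HU HV; apply: (H U V) => //; apply/is_interE. Qed.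

Lemma open_union X T S : is_topology X T -> subset S T -> union S ∈ T.
Proof. by move=> [_ [_ [H _]]] HS; apply: (H S) => //; apply/is_unionE. Qed.

Lemma has_cylindersE Y X T : has_cylinders omega Y X T <->
  forall i V, i ∈ omega -> subset V Y ->
  sep X (fun x => exists v, v ∈ V /\ related x i v) ∈ T.
Proof.
  split=> H i V.
  - move=> Hi HV; apply: (H i V _ Hi HV) => x; by rewrite in_sep.
  - move=> W Hi HV HW.
    have -> : W = sep X (fun x => exists v, v ∈ V /\ related x i v); last exact: H.
    by apply: set_ext => x; rewrite (HW x) in_sep.
Qed.

Lemma agree_cylinders Y X : subset X (seqs Y) ->
  has_cylinders omega Y X (agree_top X).
Proof.
  move=> HX; apply/has_cylindersE => i V Hi HV; rewrite in_agree_top.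
  split=> [x|x]; rewrite in_sep => -[Hx [v [Hv R]]] //.
  exists (succ i); split; first exact: succ_in.
  move=> y Hy; rewrite agree_succ => -[_ E].
  rewrite in_sep; split => //; exists v; split => //.
  move: R; have := HX x Hx; have := HX y Hy; rewrite !in_seqs => Fy Fx.
  by rewrite (fun_related _ _ Fx) (fun_related _ _ Fy) E.
Qed.

(** The product topology on [Y^ω] is the agreement topology. *)
Lemma product_spaceE Y X T :
  is_product_space omega Y X T <-> X = seqs Y /\ T = agree_top X.
Proof.
  have EX : set_of (fun x => is_fun x omega Y) X <-> X = seqs Y.
    by apply: set_ofE => x; rewrite in_seqs.
  have Least T' : X = seqs Y -> is_topology X T' -> has_cylinders omega Y X T' ->
      subset (agree_top X) T'.
  { move=> E HT /has_cylindersE HC U; rewrite in_agree_top => -[HU KU].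
    apply: (open_local HT) => x Hx; case: (KU x Hx) => n [Hn An].
    exists (sep X (fun y => agree n x y)); split; last first.
      split; first by rewrite in_sep; split => //; apply: HU.
      by move=> y; rewrite in_sep => -[? ?]; apply: An.
    move: n Hn {An}; apply: omega_ind.
    - have -> : sep X (fun y => agree empty x y) = X; last exact: open_full HT.
      apply: set_ext => y; rewrite in_sep; split=> [[] //|H]; split => //.
      exact: agree_zero.
    - move=> n Hn IH.
      have -> : sep X (fun y => agree (succ n) x y) =
        inter (sep X (fun y => agree n x y))
          (sep X (fun y => exists v, v ∈ single (app x n) /\ related y n v)).
      { apply: set_ext => y; rewrite in_inter !in_sep agree_succ; split.
        - move=> [Hy [A E']]; split => //; split => //; exists (app x n).
          rewrite in_single; split => //; move: Hy; rewrite E in_seqs => Fy.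
          by rewrite (fun_related _ _ Fy).
        - move=> [[Hy A] [_ [v [/in_single -> R]]]]; split => //; split => //.
          by move: Hy R; rewrite E in_seqs => Fy; rewrite (fun_related _ _ Fy) => -[]. }
      apply: (open_inter HT) => //; apply: HC => //.
      move=> v /in_single ->; apply: (@seqs_app Y _ n) => //.
      by rewrite -E; apply: HU. }
  split.
  - move=> [/EX E [HT [HC HL]]]; split => //; apply: set_ext => U; split.
    + apply: HL; first exact: agree_topology.
      by apply: agree_cylinders; rewrite E.
    + exact: Least.
  - move=> [E ->]; split; first exact/EX; split; first exact: agree_topology.
    split; first by apply: agree_cylinders; rewrite E.
    by move=> T' HT HC; apply: Least.
Qed.

Lemma Baire_spaceE X T :
  is_Baire_space X T <-> X = seqs omega /\ T = agree_top X.
Proof.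
  split=> [[w [/is_omegaE -> /product_spaceE //]]|H].
  by exists omega; rewrite is_omegaE product_spaceE.
Qed.

Lemma Cantor_spaceE X T :
  is_Cantor_space X T <-> X = seqs two /\ T = agree_top X.
Proof.
  split.
  - move=> [w [e [o [t [/is_omegaE -> [/is_emptyE -> [/is_succE ->]]]]]]].
    by by rewrite -oneE => -[/is_succE ->]; rewrite -twoE => /product_spaceE.
  - move=> H; exists omega, empty, one, two.
    by rewrite is_omegaE is_emptyE !is_succE product_spaceE -oneE -twoE.
Qed.

Lemma subspaceE T K TK : is_subspace T K TK <-> TK = img T (fun U => inter U K).
Proof.
  apply: set_ofE => W; rewrite in_img.
  by split=> -[U [HU H]]; exists U; split => //; exact/is_interE.
Qed.

Lemma subspace_agree X K TK : subset K X ->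
  (is_subspace (agree_top X) K TK <-> TK = agree_top K).
Proof.
  move=> HK; rewrite subspaceE.
  have -> : img (agree_top X) (fun U => inter U K) = agree_top K; last by [].
  apply: set_ext => W; rewrite in_img in_agree_top; split.
  - move=> [U []]; rewrite in_agree_top => -[HU KU] ->.
    split=> [x|x]; rewrite in_inter => -[Hx1 Hx2] //.
    case: (KU x Hx1) => n [Hn An]; exists n; split => // y Hy A.
    by rewrite in_inter; split => //; apply: An => //; apply: HK.
  - move=> [HW KW].
    exists (sep X (fun x => exists u n, u ∈ W /\ n ∈ omega /\ agree n u x /\
       forall y, y ∈ K -> agree n u y -> y ∈ W)); split.
    + rewrite in_agree_top; split=> [x|x]; rewrite in_sep => -[Hx H] //.
      case: H => u [n [Hu [Hn [A B]]]]; exists n; split => // y Hy A'.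
      rewrite in_sep; split => //; exists u, n; do 2 (split => //); split => //.
      exact: agree_trans A'.
    + apply: set_ext => x; rewrite in_inter in_sep; split.
      * move=> Hx; split; last exact: HW.
        split; first by apply: HK; apply: HW.
        by case: (KW x Hx) => n [Hn An]; exists x, n.
      * by move=> [[_ [u [n [Hu [Hn [A B]]]]]] Hx]; apply: B.
Qed.

Lemma subspace_topology X T K TK : is_topology X T -> is_subspace T K TK ->
  subset K X -> is_topology K TK.
Proof.
  move=> HT /subspaceE -> HK; split; last split; last split.
  - by move=> W; rewrite in_img => -[U [_ ->]] x; rewrite in_inter => -[].
  - rewrite in_img; exists X; split; first exact: open_full HT.
    apply: set_ext => x; rewrite in_inter; split=> [H|[] //].
    by split => //; apply: HK.
  - move=> S U HS /is_unionE ->; rewrite in_img.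
    exists (union (sep T (fun V => inter V K ∈ S))); split.
      by apply: (open_union HT) => V; rewrite in_sep => -[].
    apply: set_ext => x; rewrite in_inter !in_union; split.
    + move=> [W [HW Hx]]; have := HS W HW; rewrite in_img => -[V [HV E]].
      move: Hx; rewrite E in_inter => -[Hx1 Hx2]; split => //.
      by exists V; rewrite in_sep -E.
    + move=> [[V []]]; rewrite in_sep => -[_ HV] Hx1 Hx2.
      by exists (inter V K); rewrite in_inter.
  - move=> U V W; rewrite !in_img => -[U' [HU' ->]] [V' [HV' ->]] /is_interE ->.
    exists (inter U' V'); split; first exact: open_inter HT _ _.
    by apply: set_ext => x; rewrite !in_inter; tauto.
Qed.
End Sequences.

(** * Compactness *)

Section Compactness.
Context {M : eps_structure} {hZF : ZF M}.

(** An ideal of sets. *)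
Definition ideal I : Prop :=
  empty ∈ I /\ (forall a b, a ∈ I -> b ∈ I -> cup a b ∈ I) /\
  (forall a b, a ∈ I -> subset b a -> b ∈ I).

(** Compactness as an induction principle: a property of subsets that passes to
    subsets and finite unions and holds locally holds of the whole space. *)
Definition compact_ideal K T : Prop :=
  forall I, ideal I -> (forall x, x ∈ K -> exists O, O ∈ T /\ x ∈ O /\ O ∈ I) ->
  K ∈ I.

Lemma compact_ideal_use K T (P : M -> Prop) {H : definable1 P} :
  compact_ideal K T -> P empty -> (forall a b, P a -> P b -> P (cup a b)) ->
  (forall a b, P a -> subset b a -> P b) ->
  (forall x, x ∈ K -> exists O, O ∈ T /\ subset O K /\ x ∈ O /\ P O) -> P K.
Proof.
  move=> HK H0 HU HS HL.
  have K1 : K ∈ sep (power K) P; last by move: K1; rewrite in_sep => -[].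
  apply: HK; [split; last split|].
  - by rewrite in_sep in_power; split => // x /not_in_empty.
  - move=> a b; rewrite !in_sep !in_power => -[Ha Pa] [Hb Pb].
    by split; [move=> x; rewrite in_cup => -[/Ha|/Hb]|exact: HU].
  - move=> a b; rewrite !in_sep !in_power => -[Ha Pa] Hb.
    by split; [move=> x /Hb /Ha|exact: HS Pa Hb].
  - move=> x /HL [O [HO [HOK [Hx PO]]]]; exists O.
    by rewrite in_sep in_power.
Qed.

(** For the converse, the sets covered by finitely many members of an open cover
    form an ideal. *)
Lemma is_compactE K T : is_topology K T -> (is_compact K T <-> compact_ideal K T).
Proof.
  move=> HT; split=> H.
  - move=> I [I0 [IU IS]] HL.
    case: (H (inter T I)) => [x||S' [HS' [Fin /is_unionE ->]]].
    + by rewrite in_inter => -[].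
    + apply/is_unionE/set_ext => x; rewrite in_union; split.
      * by move=> /HL [O [HO [Hx OI]]]; exists O; rewrite in_inter.
      * by move=> [O []]; rewrite in_inter => -[HO _]; apply: open_sub HT HO _.
    + have D : definable1 (fun s => subset s I -> union s ∈ I) by definability.
      apply: (finite_ind (P := fun s => subset s I -> union s ∈ I)) => //.
      * move=> _; apply: (IS empty) => // x; rewrite in_union.
        by move=> [y [/not_in_empty]].
      * move=> s x _ IH HI.
        apply: (IS (cup (union s) x)).
          apply: IU; first by apply: IH => y Hy; apply: HI; rewrite in_cup; left.
          by apply: HI; rewrite in_cup in_single; right.
        move=> z; rewrite in_union in_cup in_union => -[y []].
        by rewrite in_cup in_single => -[Hy|->]; [left; exists y|right].
      * by move=> y /HS'; rewrite in_inter => -[].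
  - move=> S HS HU.
    have : exists S', subset S' S /\ finite S' /\ subset K (union S').
    { apply: (compact_ideal_use (P := fun L => exists S', subset S' S /\ finite S' /\
        subset L (union S')) H).
      - exists empty; split; first by move=> x /not_in_empty.
        by split; [apply: finite_empty|move=> x /not_in_empty].
      - move=> a b [Sa [Ha [Fa Ca]]] [Sb [Hb [Fb Cb]]]; exists (cup Sa Sb).
        split; first by move=> x; rewrite in_cup => -[/Ha|/Hb].
        split; first exact: finite_cup.
        move=> x; rewrite in_cup in_union => -[/Ca|/Cb]; rewrite in_union => -[y [Hy Hx]];
          by exists y; rewrite in_cup; tauto.
      - move=> a b [S' [? [? C]]] Hb; exists S'; split => //; split => //.
        by move=> x /Hb /C.
      - move=> x /HU [O [HO Hx]]; exists O; split; first exact: HS.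
        split; first by apply: (open_sub HT); apply: HS.
        split => //; exists (cup empty (single O)); split.
          by move=> y; rewrite in_cup in_single => -[/not_in_empty //|->].
        split; first by apply: finite_add; apply: finite_empty.
        move=> y Hy; rewrite in_union; exists O; rewrite in_cup in_single; tauto. }
    move=> [S' [H1 [H2 H3]]]; exists S'; split => //; split => //.
    apply/is_unionE/set_ext => x; split; first exact: H3.
    by rewrite in_union => -[y [/H1 /HS /(open_sub HT) Hy /Hy]].
Qed.

(** The image of a compact space under a relation that is continuous in the
    sense of functions is compact. *)
Lemma compact_ideal_image C TC K TK (E : M -> M -> Prop) {HE : definable2 E} :
  compact_ideal C TC -> is_topology C TC ->
  (forall x, x ∈ K -> exists z, z ∈ C /\ E z x) ->
  (forall z, z ∈ C -> exists x, x ∈ K /\ E z x) ->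
  (forall z x O, z ∈ C -> x ∈ K -> E z x -> O ∈ TK -> x ∈ O ->
     exists W, W ∈ TC /\ z ∈ W /\
       forall z' x', z' ∈ W -> x' ∈ K -> E z' x' -> x' ∈ O) ->
  compact_ideal K TK.
Proof.
  move=> HC HT Sur Tot Con I [I0 [IU IS]] HL.
  have EK : sep K (fun x => exists z, z ∈ C /\ E z x) = K.
    by apply: set_ext => x; rewrite in_sep; split=> [[]|H] //; split => //; apply: Sur.
  rewrite -EK.
  apply: (compact_ideal_use (P := fun L => sep K (fun x => exists z, z ∈ L /\ E z x) ∈ I) HC).
  - apply: (IS empty) => // x; rewrite in_sep => -[_ [z [/not_in_empty]]] //.
  - move=> a b Ha Hb; apply: (IS _ _ (IU _ _ Ha Hb)) => x.
    rewrite in_cup !in_sep => -[Hx [z [/in_cup [Hz|Hz] R]]].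
    + by left; split => //; exists z.
    + by right; split => //; exists z.
  - move=> a b Ha Hb; apply: (IS _ _ Ha) => x; rewrite !in_sep.
    by move=> [Hx [z [/Hb Hz R]]]; split => //; exists z.
  - move=> z Hz; case: (Tot z Hz) => x [Hx R].
    case: (HL x Hx) => O [HO [HxO OI]].
    case: (Con z x O) => // W [HW [HzW HWO]]; exists W; split => //.
    split; first exact: open_sub HT HW.
    split => //; apply: (IS _ _ OI) => x'; rewrite in_sep => -[Hx' [z' [Hz' R']]].
    exact: HWO R'.
Qed.

(** A decreasing sequence of nonempty closed sets has a common point. *)
Lemma compact_nested K T (L : M -> M) {HL : definable_fun L} :
  compact_ideal K T -> is_topology K T ->
  (forall n, n ∈ omega -> exists x, x ∈ K /\ x ∈ L n) ->
  (forall n x, n ∈ omega -> x ∈ K -> x ∈ L (succ n) -> x ∈ L n) ->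
  (forall n x, n ∈ omega -> x ∈ K -> ~ x ∈ L n ->
     exists O, O ∈ T /\ x ∈ O /\ forall y, y ∈ O -> ~ y ∈ L n) ->
  exists x, x ∈ K /\ forall n, n ∈ omega -> x ∈ L n.
Proof.
  move=> HK HT NE Dec Cl; apply: NNPP => C.
  have Mono m n x : m ∈ omega -> n ∈ omega -> x ∈ K -> n ∈ succ m -> x ∈ L m -> x ∈ L n.
  { move=> Hm Hn Hx; move: m Hm; apply: omega_ind.
    - by rewrite in_succ => -[/not_in_empty|->].
    - move=> m Hm IH; rewrite in_succ => -[Hnm|-> //] Hx'.
      by apply: IH => //; apply: Dec. }
  have : exists n, n ∈ omega /\ forall x, x ∈ K -> x ∈ K -> ~ x ∈ L n.
  { apply: (compact_ideal_use (P := fun a => exists n, n ∈ omega /\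
       forall x, x ∈ K -> x ∈ a -> ~ x ∈ L n) HK); last first.
    - move=> x Hx; have : exists n, n ∈ omega /\ ~ x ∈ L n.
      { apply: NNPP => D; apply: C; exists x; split => // n Hn.
        by apply: NNPP => D'; apply: D; exists n. }
      move=> [n [Hn N]]; case: (Cl n x Hn Hx N) => O [HO [HxO A]].
      exists O; split => //; split; first exact: open_sub HT HO.
      by split => //; exists n; split => // y _; apply: A.
    - by move=> a b [n [Hn A]] Hb; exists n; split => // x Hx /Hb; apply: A.
    - move=> a b [n [Hn A]] [m [Hm B]].
      case: (omega_max Hn Hm) => k [Hk [H1 H2]]; exists k; split => // x Hx.
      rewrite in_cup => -[Hxa|Hxb] Hxk.
      + by apply: (A x) => //; apply: (Mono k).
      + by apply: (B x) => //; apply: (Mono k).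
    - by exists empty; split; [apply: zero_in|move=> x _ /not_in_empty]. }
  by move=> [n [Hn A]]; case: (NE n Hn) => x [Hx]; apply: A.
Qed.
End Compactness.

Section CantorCompact.
Context {M : eps_structure} {hZF : ZF M}.

(** Bisection: if the whole space is not in the ideal, then half of it is not,
    then half of that half, and so on; these halves shrink to a point. *)
Definition bit : M -> M -> M -> M := locked_with seal
  (fun I L n => ite (sep L (fun y => app y n = empty) ∈ I) one empty).
Definition bisect : M -> M -> M := locked_with seal (fun I n =>
  natrec (seqs two) (fun n L => sep L (fun y => app y n = bit I L n)) n).

#[local] Instance def_bit : definable_fun3 bit.
Proof. rewrite /bit locked_withE; definability. Qed.
#[local] Instance def_bisect : definable_fun2 bisect.
Proof. rewrite /bisect locked_withE; definability. Qed.

Lemma bisectS I n : n ∈ omega ->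
  bisect I (succ n) = sep (bisect I n) (fun y => app y n = bit I (bisect I n) n).
Proof.
  rewrite /bisect locked_withE => Hn.
  exact: (natrecS (G := fun n L => sep L (fun y => app y n = bit I L n)) _ Hn).
Qed.

Lemma bisect0 I : bisect I empty = seqs two.
Proof. rewrite /bisect locked_withE; exact: natrec0. Qed.

Lemma bit_in I L n : bit I L n ∈ two.
Proof.
  rewrite /bit locked_withE in_two; case: (classic (sep L (fun y => app y n = empty) ∈ I)) => H.
  - by rewrite ite_true //; right.
  - by rewrite ite_false //; left.
Qed.

Lemma bisect_agree I z n : z ∈ seqs two ->
  (forall k, k ∈ omega -> app z k = bit I (bisect I k) k) -> n ∈ omega ->
  forall y, y ∈ bisect I n <-> y ∈ seqs two /\ agree n z y.
Proof.
  move=> Hz Ez; move: n; apply: omega_ind.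
  - move=> y; rewrite bisect0; split=> [H|[] //]; split => //.
    exact: agree_zero.
  - move=> n Hn IH y; rewrite bisectS // in_sep agree_succ IH Ez //.
    by split=> [[[? ?] ->]|[? [? ->]]].
Qed.

Lemma Cantor_compact : compact_ideal (seqs two) (agree_top (seqs two)).
Proof.
  move=> I [I0 [IU IS]] HL; apply: NNPP => C.
  have K n : n ∈ omega -> ~ bisect I n ∈ I.
  { move: n; apply: omega_ind; first by rewrite bisect0.
    move=> n Hn IH; rewrite bisectS // /bit locked_withE.
    case: (classic (sep (bisect I n) (fun y => app y n = empty) ∈ I)) => H.
    - rewrite ite_true // => H1; apply: IH.
      apply: (IS _ _ (IU _ _ H H1)) => y Hy; rewrite in_cup !in_sep.
      have : app y n ∈ two.
      { have Sub m : m ∈ omega -> subset (bisect I m) (seqs two).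
        { move: m; apply: omega_ind; first by rewrite bisect0.
          by move=> m Hm IH x; rewrite bisectS // in_sep => -[/IH]. }
        exact: seqs_app (Sub n Hn y Hy) Hn. }
      by rewrite in_two => -[E|E]; tauto.
    - by rewrite ite_false. }
  have D : definable_fun (fun n => bit I (bisect I n) n) by definability.
  have [z [Hz Ez]] : exists z, z ∈ seqs two /\
      forall k, k ∈ omega -> app z k = bit I (bisect I k) k.
  { exists (lam omega (fun n => bit I (bisect I n) n)); split.
    - by apply: lam_seqs => n _; apply: bit_in.
    - by move=> k Hk; rewrite app_lam. }
  case: (HL z Hz) => O [HO [HzO OI]].
  move: HO; rewrite in_agree_top => -[_ /(_ z HzO) [n [Hn A]]].
  apply: (K n Hn); apply: (IS _ _ OI) => y; rewrite (bisect_agree Hz Ez Hn).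
  by move=> [Hy B]; apply: A.
Qed.
End CantorCompact.

(** * Compact perfect sets of sequences *)

Section Brouwer.
Context {M : eps_structure} {hZF : ZF M}.

(** The [j]-th question to a sequence [y]: is [v] its value at [n], where
    [unpair j = (n, v)]? Every basic open set is decided by finitely many
    questions. *)
Definition test j y : Prop := app y (fst (unpair j)) = snd (unpair j).
(** Both answers to the question [j] occur in [L]. *)
Definition splits L j : Prop :=
  (exists x, x ∈ L /\ test j x) /\ (exists x, x ∈ L /\ ~ test j x).
(** Cut [L] in two by the first question that splits it, and keep the part that
    is given by [b]. *)
Definition first_split : M -> M := locked_with seal (fun L => least (splits L)).
Definition half : M -> M -> M := locked_with seal
  (fun L b => sep L (fun y => test (first_split L) y <-> b = empty)).
(** The part of [K] that is left after [n] cuts, with choices given by [z]. *)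
Definition cell : M -> M -> M -> M := locked_with seal
  (fun K z n => natrec K (fun n L => half L (app z n)) n).
(** The sequence of answers of [x], and the cells that it runs through. *)
Definition cell_of : M -> M -> M -> M := locked_with seal (fun K x n =>
  natrec K (fun n L => half L (ite (test (first_split L) x) empty one)) n).
Definition address : M -> M -> M := locked_with seal (fun K x =>
  lam omega (fun n => ite (test (first_split (cell_of K x n)) x) empty one)).

#[export] Instance def_test : definable2 test.
Proof. rewrite /test; definability. Qed.
#[export] Instance def_splits : definable2 splits.
Proof. rewrite /splits; definability. Qed.
#[export] Instance def_first_split : definable_fun first_split.
Proof. rewrite /first_split locked_withE; definability. Qed.
#[export] Instance def_half : definable_fun2 half.
Proof. rewrite /half locked_withE; definability. Qed.
#[export] Instance def_cell : definable_fun3 cell.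
Proof. rewrite /cell locked_withE; definability. Qed.
#[export] Instance def_cell_of : definable_fun3 cell_of.
Proof. rewrite /cell_of locked_withE; definability. Qed.
#[export] Instance def_address : definable_fun2 address.
Proof. rewrite /address locked_withE; definability. Qed.

Lemma cell0 K z : cell K z empty = K.
Proof. rewrite /cell locked_withE; exact: natrec0. Qed.

Lemma cellS K z n : n ∈ omega ->
  cell K z (succ n) = half (cell K z n) (app z n).
Proof.
  rewrite /cell locked_withE => Hn.
  exact: (natrecS (G := fun n L => half L (app z n)) _ Hn).
Qed.

Lemma cell_of0 K x : cell_of K x empty = K.
Proof. rewrite /cell_of locked_withE; exact: natrec0. Qed.

Lemma cell_ofS K x n : n ∈ omega ->
  cell_of K x (succ n) =
  half (cell_of K x n) (ite (test (first_split (cell_of K x n)) x) empty one).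
Proof.
  rewrite /cell_of locked_withE => Hn; exact: (natrecS (G := fun n L =>
    half L (ite (test (first_split L) x) empty one)) _ Hn).
Qed.

Lemma in_half L b y :
  y ∈ half L b <-> y ∈ L /\ (test (first_split L) y <-> b = empty).
Proof. by rewrite /half locked_withE in_sep. Qed.

Context (K : M).
Context (K_seqs : subset K (seqs omega)).
Context (K_compact : compact_ideal K (agree_top K)).
Context (K_inhabited : nonempty K).
Context (K_perfect : forall U, agree_open K U -> nonempty U ->
  exists x y, x ∈ U /\ y ∈ U /\ x <> y).

Lemma splits_exists x y : x ∈ K -> y ∈ K -> x <> y ->
  exists j, j ∈ omega /\ forall L, x ∈ L -> y ∈ L -> splits L j.
Proof.
  move=> Hx Hy N.
  have [n [Hn Nn]] : exists n, n ∈ omega /\ app x n <> app y n.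
  { apply: NNPP => C; apply: N; apply: (seqs_ext (K_seqs Hx) (K_seqs Hy)) => n Hn.
    by apply: NNPP => C'; apply: C; exists n. }
  have Hv := seqs_app (K_seqs Hx) Hn.
  case: (codeP Hn Hv) => Hc Ec; exists (code n (app x n)); split => // L HxL HyL.
  split; [exists x|exists y]; split => //; rewrite /test Ec fst_pair snd_pair //.
  exact: nesym.
Qed.

Lemma first_splitP L : agree_open K L -> nonempty L ->
  first_split L ∈ omega /\ splits L (first_split L) /\
  forall i, i ∈ first_split L -> ~ splits L i.
Proof.
  move=> HO HN; rewrite /first_split locked_withE; apply: leastP.
  case: (K_perfect HO HN) => x [y [Hx [Hy N]]]; case: HO => HL _.
  case: (splits_exists (HL x Hx) (HL y Hy) N) => j [Hj S].
  by exists j; split => //; apply: S.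
Qed.

(** Relatively to [K]. *)
Definition clopen L : Prop :=
  agree_open K L /\ forall x, x ∈ K -> x ∉ L ->
  exists n, n ∈ omega /\ forall y, y ∈ K -> agree n x y -> y ∉ L.

Instance def_clopen : definable1 clopen.
Proof. rewrite /clopen; definability. Qed.

Lemma test_local j : j ∈ omega -> exists n, n ∈ omega /\
  forall x y, agree n x y -> (test j x <-> test j y).
Proof.
  move=> Hj; case: (unpair_eta Hj) => H _.
  exists (succ (fst (unpair j))); split; first exact: succ_in.
  by move=> x y; rewrite agree_succ /test => -[_ ->].
Qed.

Lemma half_clopen L b : clopen L -> nonempty L -> clopen (half L b).
Proof.
  move=> [[HL OL] CL] NL.
  case: (first_splitP (conj HL OL) NL) => Hj _.
  case: (test_local Hj) => n [Hn A]; split; first split.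
  - by move=> x; rewrite in_half => -[/HL].
  - move=> x; rewrite in_half => -[Hx E].
    case: (OL x Hx) => m [Hm B]; case: (omega_max Hn Hm) => k [Hk [H1 H2]].
    exists k; split => // y Hy Ag; rewrite in_half; split.
    + by apply: B => //; apply: agree_leS Ag.
    + by rewrite -E; symmetry; apply: A; apply: agree_leS Ag.
  - move=> x Hx; rewrite in_half => C.
    case: (classic (x ∈ L)) => HxL.
    + exists n; split => // y Hy Ag; rewrite in_half => -[_ E]; apply: C.
      by split => //; rewrite -E; apply: A.
    + case: (CL x Hx HxL) => m [Hm B]; exists m; split => // y Hy Ag.
      by rewrite in_half => -[Hy' _]; apply: (B y).
Qed.

Lemma half_nonempty L b : b ∈ two -> agree_open K L -> nonempty L ->
  nonempty (half L b).
Proof.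
  move=> Hb OL NL; case: (first_splitP OL NL) => _ [[[x [Hx Tx]] [y [Hy Ty]]] _].
  case/in_two: Hb => ->.
  - by exists x; rewrite in_half.
  - exists y; rewrite in_half; split => //; split=> // E.
    by case: one_neq0.
Qed.

Lemma cell_spec z n : z ∈ seqs two -> n ∈ omega ->
  clopen (cell K z n) /\ nonempty (cell K z n).
Proof.
  move=> Hz; move: n; apply: omega_ind.
  - rewrite cell0; split=> //; split; first exact: agree_open_full.
    by move=> x Hx [].
  - move=> n Hn [IH1 IH2]; rewrite cellS //; split; first exact: half_clopen.
    apply: half_nonempty => //; first exact: seqs_app Hz Hn.
    by case: IH1.
Qed.

Lemma cell_sub z n x : z ∈ seqs two -> n ∈ omega -> x ∈ cell K z n -> x ∈ K.
Proof. by move=> Hz Hn; case: (cell_spec Hz Hn) => -[[H _] _] _ /H. Qed.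

(** Each cut disposes of the first question that is still open. *)
Lemma cell_unsplit z n : z ∈ seqs two -> n ∈ omega ->
  forall i, i ∈ n -> ~ splits (cell K z n) i.
Proof.
  move=> Hz; move: n; apply: omega_ind; first by move=> i /not_in_empty.
  move=> n Hn IH i.
  have Sub : splits (cell K z (succ n)) i -> splits (cell K z n) i.
  { by rewrite cellS // => -[[x [Hx Tx]] [y [Hy Ty]]]; split; [exists x|exists y];
      move: Hx Hy; rewrite !in_half => -[? _] [? _]. }
  rewrite in_succ => -[Hi S|-> S]; first by apply: (IH i Hi); apply: Sub.
  case: (cell_spec Hz Hn) => -[OL _] NL.
  case: (first_splitP OL NL) => Hj [Sj Lj].
  case: (omega_total Hj Hn) => [H|[E|H]].
  - exact: (IH _ H Sj).
  - move: S; rewrite cellS // => -[[x [Hx Tx]] [y [Hy Ty]]].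
    by move: Hx Hy; rewrite !in_half E => -[_ Ex] [_ Ey]; tauto.
  - by apply: (Lj n H); case: S => [[x [Hx Tx]] [y [Hy Ty]]]; split;
      [exists x|exists y]; move: Hx Hy; rewrite cellS // !in_half => -[? _] [? _].
Qed.

Lemma cell_point z x y : z ∈ seqs two ->
  (forall n, n ∈ omega -> x ∈ cell K z n) ->
  (forall n, n ∈ omega -> y ∈ cell K z n) -> x = y.
Proof.
  move=> Hz Hx Hy; apply: NNPP => N.
  have H0 : empty ∈ omega by exact: zero_in.
  case: (splits_exists (cell_sub Hz H0 (Hx _ H0)) (cell_sub Hz H0 (Hy _ H0)) N) => j [Hj S].
  have HS := succ_in Hj.
  by apply: (cell_unsplit Hz HS (mem_succ j)); apply: S; [apply: Hx|apply: Hy].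
Qed.

Lemma cell_dec z n x : n ∈ omega -> x ∈ cell K z (succ n) -> x ∈ cell K z n.
Proof. by move=> Hn; rewrite cellS // in_half => -[]. Qed.

Lemma cell_nonempty z : z ∈ seqs two ->
  exists x, x ∈ K /\ forall n, n ∈ omega -> x ∈ cell K z n.
Proof.
  move=> Hz; apply: (compact_nested (L := cell K z) K_compact (agree_topology K)).
  - move=> n Hn; case: (cell_spec Hz Hn) => _ [x Hx]; exists x.
    by split => //; apply: cell_sub Hx.
  - by move=> n x Hn _; apply: cell_dec.
  - move=> n x Hn Hx N; case: (cell_spec Hz Hn) => -[_ /(_ x Hx N) [m [Hm A]]] _.
    exists (sep K (fun y => agree m x y)); split.
      by rewrite in_agree_top; apply: cylinder_agree_open.
    split; first by rewrite in_sep.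
    by move=> y; rewrite in_sep => -[Hy /A]; apply.
Qed.

Lemma cell_agree z z' n : n ∈ omega -> agree n z z' -> cell K z n = cell K z' n.
Proof.
  move: n; apply: omega_ind; first by rewrite !cell0.
  by move=> n Hn IH; rewrite agree_succ => -[/IH E1 E2]; rewrite !cellS // E1 E2.
Qed.

Lemma cell_common z z' n x : z ∈ seqs two -> z' ∈ seqs two -> n ∈ omega ->
  x ∈ cell K z n -> x ∈ cell K z' n -> agree n z z'.
Proof.
  move=> Hz Hz'; move: n; apply: omega_ind; first by move=> *; apply: agree_zero.
  move=> n Hn IH; rewrite !cellS // !in_half => -[H1 E1] [H2 E2].
  have A := IH H1 H2; rewrite agree_succ; split => //.
  move: E1 E2; rewrite (cell_agree Hn A) => -> E.
  have := seqs_app Hz Hn; have := seqs_app Hz' Hn; rewrite !in_two.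
  have N := one_neq0.
  move=> [E1|E1] [E2|E2]; rewrite E1 E2 //; rewrite E1 E2 in E; intuition congruence.
Qed.

Lemma addressP x : x ∈ K -> address K x ∈ seqs two /\
  forall n, n ∈ omega -> x ∈ cell K (address K x) n.
Proof.
  move=> Hx; set t := fun n => ite (test (first_split (cell_of K x n)) x) empty one.
  have Et n : n ∈ omega -> app (address K x) n = t n.
    by move=> Hn; rewrite /address locked_withE app_lam.
  split.
  - rewrite /address locked_withE; apply: lam_seqs => n Hn; rewrite in_two.
    case: (classic (test (first_split (cell_of K x n)) x)) => H.
    + by rewrite ite_true //; left.
    + by rewrite ite_false //; right.
  - have Ec n : n ∈ omega -> cell K (address K x) n = cell_of K x n.
    { move: n; apply: omega_ind; first by rewrite cell0 cell_of0.
      by move=> n Hn IH; rewrite cellS // cell_ofS // IH Et. }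
    apply: omega_ind; first by rewrite cell0.
    move=> n Hn IH; rewrite cellS // in_half; split => //; rewrite Et // /t -Ec //.
    case: (classic (test (first_split (cell K (address K x) n)) x)) => H.
    + by rewrite ite_true.
    + by rewrite ite_false //; split=> // E; case: one_neq0.
Qed.

Lemma address_unique x z : x ∈ K -> z ∈ seqs two ->
  (forall n, n ∈ omega -> x ∈ cell K z n) -> z = address K x.
Proof.
  move=> Hx Hz H; case: (addressP Hx) => Ha Ca.
  apply: (seqs_ext Hz Ha) => n Hn; have Hs := succ_in Hn.
  by apply: (cell_common Hz Ha Hs (H _ Hs) (Ca _ Hs)); apply: mem_succ.
Qed.

(** By compactness, the cells of [z] enter each neighbourhood of their common
    point. *)
Lemma cell_small z U x : z ∈ seqs two -> agree_open K U -> x ∈ U ->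
  (forall n, n ∈ omega -> x ∈ cell K z n) ->
  exists n, n ∈ omega /\ subset (cell K z n) U.
Proof.
  move=> Hz [HU OU] Hx Cx; apply: NNPP => C.
  have [y [Hy Cy]] : exists y, y ∈ K /\
      forall n, n ∈ omega -> y ∈ diff (cell K z n) U.
  { apply: (compact_nested (L := fun n => diff (cell K z n) U) K_compact (agree_topology K)).
    - move=> n Hn; apply: NNPP => D; apply: C; exists n; split => // y Hy.
      apply: NNPP => D'; apply: D; exists y; rewrite in_diff.
      by split => //; apply: cell_sub Hy.
    - by move=> n y Hn _; rewrite !in_diff => -[/(cell_dec Hn)].
    - move=> n y Hn Hy N.
      case: (classic (y ∈ U)) => HyU.
        exists U; rewrite in_agree_top; split => //; split => // u Hu.
        by rewrite in_diff => -[].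
      have N' : y ∉ cell K z n by move=> H; apply: N; rewrite in_diff.
      case: (cell_spec Hz Hn) => -[_ /(_ y Hy N') [m [Hm A]]] _.
      exists (sep K (fun u => agree m y u)); split.
        by rewrite in_agree_top; apply: cylinder_agree_open.
      split; first by rewrite in_sep.
      by move=> u; rewrite in_sep in_diff => -[Hu /(A u Hu) B] []. }
  have E : y = x.
    by apply: (cell_point Hz) => // n /Cy; rewrite in_diff => -[].
  by move: (Cy _ zero_in); rewrite in_diff E => -[].
Qed.

(** Brouwer: a nonempty compact set without isolated points is a Cantor set. *)
Lemma perfect_compact_Cantor :
  is_Cantor_set (seqs omega) (agree_top (seqs omega)) K.
Proof.
  split => //; exists (agree_top K), (seqs two), (agree_top (seqs two)), (lam K (address K)).
  split; first by apply/subspace_agree.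
  split; first by apply/Cantor_spaceE.
  have Fh : is_fun (lam K (address K)) K (seqs two).
    by apply: lam_fun => x /addressP [].
  have Rh x z : related (lam K (address K)) x z <-> x ∈ K /\ z = address K x.
    by rewrite relatedE pair_in_lam.
  split; last split.
  - apply/is_bijectionE; split => //; split.
    + move=> x y Hx Hy; rewrite (app_lam Hx) (app_lam Hy) => E.
      case: (addressP Hx) => Hz Cx; case: (addressP Hy) => _ Cy.
      by apply: (cell_point Hz Cx) => n Hn; rewrite E; apply: Cy.
    + move=> z Hz; case: (cell_nonempty Hz) => x [Hx Cx].
      by exists x; split => //; rewrite (app_lam Hx) -(address_unique Hx Hz Cx).
  - move=> V HV; exists (sep K (fun x => address K x ∈ V)); split.
    + move=> x; rewrite in_sep; split=> [[Hx HxV]|[z [HzV]]].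
        by exists (address K x); rewrite Rh.
      by rewrite Rh => -[Hx E]; rewrite -E.
    + rewrite in_agree_top; split=> [x|x]; rewrite in_sep => -[Hx HxV] //.
      move: HV; rewrite in_agree_top => -[_ /(_ _ HxV) [n [Hn A]]].
      case: (addressP Hx) => Hz Cx.
      case: (cell_spec Hz Hn) => -[[_ /(_ x (Cx n Hn)) [m [Hm B]]] _] _.
      exists m; split => // y Hy Ag; rewrite in_sep; split => //.
      case: (addressP Hy) => Hz' Cy; apply: A => //.
      apply: (cell_common Hz Hz' Hn (B y Hy Ag)); exact: Cy.
  - move=> U; rewrite in_agree_top => HU.
    exists (img U (address K)); split.
    + move=> z; rewrite in_img; split=> -[x].
      * move=> [Hx E]; exists x; rewrite Rh; split => //; split => //.
        by case: HU => H _; apply: H.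
      * by move=> [Hx]; rewrite Rh => -[_ E]; exists x.
    + rewrite in_agree_top; have HUK : subset U K by case: HU.
      split=> [z|z]; rewrite in_img => -[x [Hx ->]].
        by case: (addressP (HUK x Hx)).
      case: (addressP (HUK x Hx)) => Hz Cx.
      case: (cell_small Hz HU Hx Cx) => n [Hn A]; exists n; split => // z' Hz' Ag.
      case: (cell_nonempty Hz') => y [Hy Cy]; rewrite in_img; exists y; split.
      * by apply: A; rewrite (cell_agree Hn Ag); apply: Cy.
      * exact: address_unique.
Qed.
End Brouwer.

(** * Real numbers *)

Existing Class complete_ordered_field.

Section Reals.
Context {M : eps_structure} {hZF : ZF M} (R : real_structure M)
  {hR : complete_ordered_field R}.

Notation RR := (Rcarrier R).
Notation O := (Rzero R).
Notation "x <== y" := (rle R x y) (at level 70).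
Notation "x <<< y" := (rlt R x y) (at level 70).

(** Addition and multiplication as operations; only their values at real
    numbers matter. *)
Definition radd : M -> M -> M := locked_with seal (fun x y => app (Radd R) (pair x y)).
Definition rmul : M -> M -> M := locked_with seal (fun x y => app (Rmul R) (pair x y)).

#[export] Instance def_radd : definable_fun2 radd.
Proof. rewrite /radd locked_withE; definability. Qed.
#[export] Instance def_rmul : definable_fun2 rmul.
Proof. rewrite /rmul locked_withE; definability. Qed.
#[export] Instance def_rle : definable2 (rle R).
Proof. rewrite /rle; definability. Qed.
#[export] Instance def_rlt : definable2 (rlt R).
Proof. rewrite /rlt; definability. Qed.

Infix "+++" := radd (at level 50, left associativity).

Lemma zero_real : O ∈ RR. Proof. exact: Rzero_in. Qed.
Lemma one_real : Rone R ∈ RR. Proof. exact: Rone_in. Qed.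

Lemma raddE x y z :
  related2 (Radd R) x y z <-> x ∈ RR /\ y ∈ RR /\ z = x +++ y.
Proof.
  rewrite /radd locked_withE; apply: fun2_related.
  by apply/is_fun2E; apply: Radd_fun.
Qed.

Lemma rmulE x y z :
  related2 (Rmul R) x y z <-> x ∈ RR /\ y ∈ RR /\ z = rmul x y.
Proof.
  rewrite /rmul locked_withE; apply: fun2_related.
  by apply/is_fun2E; apply: Rmul_fun.
Qed.

Lemma radd_in x y : x ∈ RR -> y ∈ RR -> x +++ y ∈ RR.
Proof.
  move=> Hx Hy; rewrite /radd locked_withE; apply: app_in.
    by apply/is_fun2E; apply: Radd_fun.
  by rewrite pair_in_prod.
Qed.

Lemma rmul_in x y : x ∈ RR -> y ∈ RR -> rmul x y ∈ RR.
Proof.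
  move=> Hx Hy; rewrite /rmul locked_withE; apply: app_in.
    by apply/is_fun2E; apply: Rmul_fun.
  by rewrite pair_in_prod.
Qed.

Lemma radd_comm x y : x ∈ RR -> y ∈ RR -> x +++ y = y +++ x.
Proof.
  move=> Hx Hy.
  have /(Radd_comm hR) : related2 (Radd R) x y (x +++ y) by apply/raddE.
  by rewrite raddE => -[_ [_ ->]].
Qed.

Lemma radd_assoc x y z : x ∈ RR -> y ∈ RR -> z ∈ RR ->
  (x +++ y) +++ z = x +++ (y +++ z).
Proof.
  move=> Hx Hy Hz.
  have H1 : related2 (Radd R) x y (x +++ y) by apply/raddE.
  have H2 : related2 (Radd R) y z (y +++ z) by apply/raddE.
  have /(Radd_assoc hR _ H1 H2) : related2 (Radd R) (x +++ y) z ((x +++ y) +++ z).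
    by apply/raddE; split => //; apply: radd_in.
  by rewrite raddE => -[_ [_ ->]].
Qed.

Lemma radd0 x : x ∈ RR -> x +++ O = x.
Proof. by move=> /(Radd_zero hR); rewrite raddE => -[_ [_ E]]. Qed.

Lemma r0add x : x ∈ RR -> O +++ x = x.
Proof. by move=> Hx; rewrite radd_comm ?radd0 //; apply: zero_real. Qed.

Lemma ropp_exists x : x ∈ RR -> exists y, y ∈ RR /\ x +++ y = O.
Proof.
  move=> Hx; case: (Radd_opp hR Hx) => y [Hy].
  by rewrite raddE => -[_ [_ E]]; exists y.
Qed.

Lemma rle_real x y : x <== y -> x ∈ RR /\ y ∈ RR.
Proof.
  rewrite /rle relatedE => /(Rle_in hR) [u [v [Hu [Hv /is_pairE /pair_inj [-> ->]]]]].
  by [].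
Qed.

Lemma rle_refl x : x ∈ RR -> x <== x.
Proof. by move=> Hx; case: (Rle_total hR Hx Hx). Qed.

Lemma rle_trans y x z : x <== y -> y <== z -> x <== z.
Proof. exact: (Rle_trans hR). Qed.

Lemma rle_add2r x y z : z ∈ RR -> x <== y -> x +++ z <== y +++ z.
Proof.
  move=> Hz H; case: (rle_real H) => Hx Hy.
  by apply: (Rle_add hR H (z := z)); apply/raddE.
Qed.

Lemma rle_add2 x y z u : x <== y -> z <== u -> x +++ z <== y +++ u.
Proof.
  move=> H K; case: (rle_real H) => Hx Hy; case: (rle_real K) => Hz Hu.
  apply: (@rle_trans (y +++ z)); first exact: rle_add2r.
  by rewrite radd_comm // (radd_comm Hy) //; apply: rle_add2r.
Qed.

Lemma rle_cancel x y z : x ∈ RR -> y ∈ RR -> z ∈ RR ->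
  x +++ z <== y +++ z -> x <== y.
Proof.
  move=> Hx Hy Hz H; case: (ropp_exists Hz) => w [Hw E].
  by have := rle_add2r Hw H; rewrite !radd_assoc // E !radd0.
Qed.

Lemma rlt_real x y : x <<< y -> x ∈ RR /\ y ∈ RR.
Proof. by case=> /rle_real. Qed.

Lemma rltW x y : x <<< y -> x <== y. Proof. by case. Qed.

Lemma rltNge x y : x ∈ RR -> y ∈ RR -> (x <<< y <-> ~ y <== x).
Proof.
  move=> Hx Hy; split.
  - by move=> [H N] K; apply: N; apply: (Rle_antisym hR).
  - move=> N; split; first by case: (Rle_total hR Hx Hy).
    by move=> E; apply: N; rewrite E; apply: rle_refl.
Qed.

Lemma rle_lt_trans y x z : x <== y -> y <<< z -> x <<< z.
Proof.
  move=> H K; case: (rle_real H) => Hx Hy; case: (rlt_real K) => _ Hz.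
  rewrite rltNge // => L; move: K; rewrite rltNge //; apply.
  exact: rle_trans L H.
Qed.

Lemma rlt_le_trans y x z : x <<< y -> y <== z -> x <<< z.
Proof.
  move=> K H; case: (rle_real H) => Hy Hz; case: (rlt_real K) => Hx _.
  rewrite rltNge // => L; move: K; rewrite rltNge //; apply.
  exact: rle_trans H L.
Qed.

Lemma rlt_irrefl x : ~ x <<< x. Proof. by case. Qed.

Lemma rlt_add2 x y z u : x <<< y -> z <== u -> x +++ z <<< y +++ u.
Proof.
  move=> H K; case: (rlt_real H) => Hx Hy; case: (rle_real K) => Hz Hu.
  rewrite rltNge; [|exact: radd_in|exact: radd_in].
  move=> L; have : y +++ z <== x +++ z.
  { apply: rle_trans L; apply: rle_add2 => //; exact: rle_refl. }
  move/(rle_cancel Hy Hx Hz); move: H; rewrite rltNge //.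
Qed.

(** The order of the field need not be known to make [1] positive: [1] or its
    opposite is. *)
Lemma positive_exists : exists x, O <<< x.
Proof.
  have H0 := zero_real; have H1 := one_real; have N := Rone_neq_zero hR.
  case: (Rle_total hR H0 H1) => H; first by exists (Rone R); split => // E; case: N.
  case: (ropp_exists H1) => y [Hy E]; exists y; split.
  - by have := rle_add2r Hy H; rewrite E r0add.
  - by move=> E'; apply: N; move: E; rewrite -E' radd0.
Qed.

Lemma half_exists : exists h, h ∈ RR /\ forall x, x ∈ RR ->
  rmul x h ∈ RR /\ rmul x h +++ rmul x h = x.
Proof.
  have H0 := zero_real; have H1 := one_real.
  have H2 : Rone R +++ Rone R ∈ RR by apply: radd_in.
  have Hdist x y : x ∈ RR -> y ∈ RR -> rmul x (y +++ y) = rmul x y +++ rmul x y.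
  { move=> Hx Hy.
    have A : related2 (Radd R) y y (y +++ y) by apply/raddE.
    have B : related2 (Rmul R) x y (rmul x y) by apply/rmulE.
    have /(Rdistr hR _ A B B) : related2 (Rmul R) x (y +++ y) (rmul x (y +++ y)).
      by apply/rmulE; split => //; split => //; apply: radd_in.
    by rewrite raddE => -[_ [_ ->]]. }
  have Hm1 x : x ∈ RR -> rmul x (Rone R) = x.
    by move=> /(Rmul_one hR); rewrite rmulE => -[_ [_ E]].
  have Hmc x y : x ∈ RR -> y ∈ RR -> rmul x y = rmul y x.
  { move=> Hx Hy.
    have /(Rmul_comm hR) : related2 (Rmul R) x y (rmul x y) by apply/rmulE.
    by rewrite rmulE => -[_ [_ ->]]. }
  have N : Rone R +++ Rone R <> O.
  { move=> E; case: positive_exists => p Hp; case: (rlt_real Hp) => _ HpR.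
    have E0 : p +++ p = rmul p O by rewrite -E Hdist // !Hm1.
    have E1 : rmul p O = O.
    { have F : rmul p O +++ rmul p O = rmul p O by rewrite -Hdist // radd0.
      have HpO : rmul p O ∈ RR by apply: rmul_in.
      case: (ropp_exists HpO) => w [Hw G].
      by rewrite -(radd0 HpO) -{2}G -radd_assoc // F G. }
    have := rlt_add2 Hp (rltW Hp); rewrite radd0 // E0 E1; exact: rlt_irrefl. }
  case: (Rmul_inv hR H2 N) => h [Hh]; rewrite rmulE => -[_ [_ E]].
  exists h; split => // x Hx; split; first exact: rmul_in.
  have Eh : h +++ h = Rone R by rewrite E Hmc // Hdist // !Hm1.
  by rewrite -Hdist // Eh Hm1.
Qed.

(** One half. It is chosen outside of [M], once and for all, and then serves as
    a parameter; the same holds for [eps0] below. *)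
Definition half_witness : M :=
  epsilon (inhabits O) (fun h => h ∈ RR /\ forall x, x ∈ RR ->
    rmul x h ∈ RR /\ rmul x h +++ rmul x h = x).

Definition rhalf : M -> M := locked_with seal (fun x => rmul x half_witness).

#[export] Instance def_rhalf : definable_fun rhalf.
Proof. rewrite /rhalf locked_withE; definability. Qed.

Lemma rhalfP x : x ∈ RR -> rhalf x ∈ RR /\ rhalf x +++ rhalf x = x.
Proof.
  move=> Hx; rewrite /rhalf locked_withE.
  by case: (epsilon_spec (inhabits O) _ half_exists) => _; apply.
Qed.

Lemma rhalf_pos x : O <<< x -> O <<< rhalf x.
Proof.
  move=> H; case: (rlt_real H) => H0 Hx; case: (rhalfP Hx) => Hh E.
  rewrite rltNge // => C.
  have := rle_add2 C C; rewrite E radd0 // => C'.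
  by move: H; rewrite rltNge.
Qed.

(** A positive number. *)
Definition eps0 : M := epsilon (inhabits O) (fun x => O <<< x).

(** A sequence of positive numbers that tends to [0]: each term is four times
    the next one. *)
Definition eps : M -> M := locked_with seal
  (natrec eps0 (fun _ y => rhalf (rhalf y))).

#[export] Instance def_eps : definable_fun eps.
Proof. rewrite /eps locked_withE; definability. Qed.

Lemma epsS n : n ∈ omega -> eps (succ n) = rhalf (rhalf (eps n)).
Proof.
  rewrite /eps locked_withE => Hn.
  exact: (natrecS (G := fun _ y => rhalf (rhalf y)) _ Hn).
Qed.

Lemma eps_pos n : n ∈ omega -> O <<< eps n.
Proof.
  move: n; apply: omega_ind.
  - rewrite /eps locked_withE natrec0.
    exact: (epsilon_spec (inhabits O) _ positive_exists).
  - by move=> n Hn IH; rewrite epsS //; do 2 apply: rhalf_pos.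
Qed.

Lemma eps_in n : n ∈ omega -> eps n ∈ RR.
Proof. by move=> /eps_pos /rlt_real []. Qed.

Lemma eps_four n : n ∈ omega ->
  (eps (succ n) +++ eps (succ n)) +++ (eps (succ n) +++ eps (succ n)) = eps n.
Proof.
  move=> Hn; case: (rhalfP (eps_in Hn)) => H1 E1; case: (rhalfP H1) => H2 E2.
  by rewrite epsS // E2 E1.
Qed.

Lemma rle_addr x y : x ∈ RR -> O <== y -> x <== x +++ y.
Proof.
  move=> Hx Hy; have := rle_add2 (rle_refl Hx) Hy; by rewrite radd0.
Qed.

Lemma eps_two_lt n : n ∈ omega -> eps (succ n) +++ eps (succ n) <<< eps n.
Proof.
  move=> Hn; have P := eps_pos (succ_in Hn); have I := eps_in (succ_in Hn).
  have P2 := rlt_add2 P (rltW P); rewrite radd0 in P2; last exact: zero_real.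
  have I2 : eps (succ n) +++ eps (succ n) ∈ RR by apply: radd_in.
  have := rlt_add2 P2 (rle_refl I2); by rewrite eps_four // r0add.
Qed.

Lemma eps_succ_le n : n ∈ omega -> eps (succ n) <== eps n.
Proof.
  move=> Hn; apply: rle_trans (rltW (eps_two_lt Hn)).
  apply: rle_addr; first exact: eps_in (succ_in Hn).
  exact: rltW (eps_pos (succ_in Hn)).
Qed.

Lemma eps_anti n m : n ∈ omega -> m ∈ omega -> m ∈ succ n -> eps n <== eps m.
Proof.
  move=> Hn Hm; move: n Hn; apply: omega_ind.
  - by rewrite in_succ => -[/not_in_empty //|->]; apply: rle_refl; apply: eps_in; apply: zero_in.
  - move=> n Hn IH; rewrite in_succ => -[H|->].
    + apply: rle_trans (eps_succ_le Hn) (IH H).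
    + by apply: rle_refl; apply: eps_in; apply: succ_in.
Qed.

(** The Archimedean property, from completeness: if [d] is below every
    [eps n], then the lower bounds of the sequence are stable under adding [d],
    hence have no least upper bound. *)
Lemma eps_small d : O <<< d -> exists n, n ∈ omega /\ eps n <<< d.
Proof.
  move=> Hd; case: (rlt_real Hd) => H0 HdR; apply: NNPP => C.
  have Ld n : n ∈ omega -> d <== eps n.
  { move=> Hn; apply: NNPP => L; apply: C; exists n; split => //.
    by rewrite rltNge //; apply: eps_in. }
  pose (s := sep RR (fun b => forall n, n ∈ omega -> b <== eps n)).
  have Hs b : b ∈ s <-> b ∈ RR /\ forall n, n ∈ omega -> b <== eps n by rewrite in_sep.
  case: (Rcomplete hR (s := s)).
  - by move=> b /Hs [].
  - by exists d; apply/Hs.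
  - by exists (eps empty); split; [exact: eps_in zero_in|move=> x /Hs [_]; apply; apply: zero_in].
  - move=> l [[HlR Hl] Least].
    have K b : b ∈ s -> b +++ d ∈ s.
    { move=> /Hs [HbR Hb]; apply/Hs; split; first exact: radd_in.
      move=> n Hn; apply: rle_trans (rltW (eps_two_lt Hn)).
      by apply: rle_add2; [apply: Hb|apply: Ld]; apply: succ_in. }
    case: (ropp_exists HdR) => w [Hw E].
    have Hlw : l +++ w ∈ RR by apply: radd_in.
    have L : l <== l +++ w.
    { apply: Least; split => // b Hb; case/Hs: (Hb) => HbR _.
      apply: (rle_cancel HbR Hlw HdR).
      rewrite radd_assoc // (radd_comm Hw HdR) E radd0 //.
      exact: Hl (K b Hb). }
    have := rle_add2r HdR L; rewrite radd_assoc // (radd_comm Hw HdR) E radd0 // => L2.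
    have := rlt_add2 Hd (rle_refl HlR); rewrite r0add // (radd_comm HdR HlR).
    by rewrite rltNge //; apply: radd_in.
Qed.
End Reals.

(** * Countable choice for sets of reals *)

Section Choice.
Context {M : eps_structure} {hZF : ZF M} (R : real_structure M)
  {hR : complete_ordered_field R}.

Notation RR := (Rcarrier R).
Notation O := (Rzero R).
Notation "x <== y" := (rle R x y) (at level 70).
Notation "x <<< y" := (rlt R x y) (at level 70).
Notation "x +++ y" := (radd R x y) (at level 50, left associativity).
Notation eps := (eps R).

(** The partial sums of [Σ_{n ∈ A} eps n], for a set [A] of natural numbers. *)
Definition partial_sum : M -> M -> M := locked_with seal (fun A n =>
  natrec O (fun n y => ite (n ∈ A) (y +++ eps n) y) n).

#[export] Instance def_partial_sum : definable_fun2 partial_sum.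
Proof. rewrite /partial_sum locked_withE; definability. Qed.

Lemma partial_sum0 A : partial_sum A empty = O.
Proof. rewrite /partial_sum locked_withE; exact: natrec0. Qed.

Lemma partial_sumS A n : n ∈ omega -> partial_sum A (succ n) =
  ite (n ∈ A) (partial_sum A n +++ eps n) (partial_sum A n).
Proof.
  rewrite /partial_sum locked_withE => Hn.
  exact: (natrecS (G := fun n y => ite (n ∈ A) (y +++ eps n) y) _ Hn).
Qed.

Lemma partial_sum_in A n : n ∈ omega -> partial_sum A n ∈ RR.
Proof.
  move: n; apply: omega_ind; first by rewrite partial_sum0; apply: zero_real.
  move=> n Hn IH; rewrite partial_sumS //.
  case: (classic (n ∈ A)) => H; [rewrite ite_true //|rewrite ite_false //].
  by apply: radd_in => //; apply: eps_in.
Qed.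

(** The partial sums increase, and adding twice the current [eps] makes them
    decrease: this bounds the tails. *)
Lemma partial_sum_step A n : n ∈ omega ->
  partial_sum A n <== partial_sum A (succ n) /\
  partial_sum A (succ n) +++ (eps (succ n) +++ eps (succ n)) <==
  partial_sum A n +++ (eps n +++ eps n).
Proof.
  move=> Hn; have HA := partial_sum_in A Hn; have He : eps n ∈ RR by apply: eps_in.
  have He' : eps (succ n) ∈ RR by apply: eps_in; apply: succ_in.
  have L : eps (succ n) +++ eps (succ n) <== eps n by apply: rltW; apply: eps_two_lt.
  rewrite partial_sumS //.
  case: (classic (n ∈ A)) => H; [rewrite ite_true //|rewrite ite_false //].
  - split; first by apply: rle_addr => //; apply: rltW; apply: eps_pos.
    rewrite radd_assoc //; last exact: radd_in.
    apply: rle_add2; first exact: rle_refl.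
    by apply: rle_add2 L; exact: rle_refl.
  - split; first exact: rle_refl.
    apply: rle_add2; first exact: rle_refl.
    apply: rle_trans L _; apply: rle_addr => //; apply: rltW; exact: eps_pos.
Qed.

Lemma partial_sum_le A n m : n ∈ omega -> m ∈ omega -> n ∈ succ m ->
  partial_sum A n <== partial_sum A m /\
  partial_sum A m +++ (eps m +++ eps m) <== partial_sum A n +++ (eps n +++ eps n).
Proof.
  have Rfl k : k ∈ omega -> partial_sum A k <== partial_sum A k /\
    partial_sum A k +++ (eps k +++ eps k) <== partial_sum A k +++ (eps k +++ eps k).
  { move=> Hk; have HA := partial_sum_in A Hk; have He : eps k ∈ RR by apply: eps_in.
    by split; apply: rle_refl => //; do 2 (apply: radd_in => //). }
  move=> Hn; move: m; apply: omega_ind.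
  - rewrite in_succ => -[/not_in_empty //|->]; apply: Rfl; exact: zero_in.
  - move=> m Hm IH; rewrite in_succ => -[/IH [H1 H2]|->]; last exact: Rfl (succ_in Hm).
    case: (partial_sum_step A Hm) => H3 H4; split; first exact: rle_trans H3.
    exact: rle_trans H2.
Qed.

(** The sum of the series. *)
Definition real_of : M -> M := locked_with seal (fun A => the (fun l =>
  upper_bound R (img omega (partial_sum A)) l /\
  forall b, upper_bound R (img omega (partial_sum A)) b -> l <== b)).

#[export] Instance def_upper_bound : definable2 (upper_bound R).
Proof. rewrite /upper_bound; definability. Qed.
#[export] Instance def_real_of : definable_fun real_of.
Proof. rewrite /real_of locked_withE; definability. Qed.

Lemma partial_sum_upper A n : n ∈ omega ->
  upper_bound R (img omega (partial_sum A)) (partial_sum A n +++ (eps n +++ eps n)).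
Proof.
  move=> Hn; have HA := partial_sum_in A Hn; have He : eps n ∈ RR by apply: eps_in.
  have H2 : eps n +++ eps n ∈ RR by apply: radd_in.
  have P k : k ∈ omega -> O <== eps k +++ eps k.
  { move=> /eps_pos Hk; apply: (rle_trans (rltW Hk)); apply: rle_addr (rltW Hk).
    by case: (rlt_real Hk). }
  split; first exact: radd_in.
  move=> x; rewrite in_img => -[m [Hm ->]].
  have Hm' := partial_sum_in A Hm.
  case: (classic (n ∈ succ m)) => H.
  - case: (partial_sum_le A Hn Hm H) => _; apply: rle_trans.
    by apply: rle_addr => //; apply: P.
  - have H' : m ∈ succ n.
    { rewrite mem_succ_iff // => K; apply: H; rewrite in_succ; by left. }
    case: (partial_sum_le A Hm Hn H') => H3 _; apply: (rle_trans H3).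
    by apply: rle_addr => //; apply: P.
Qed.

Lemma real_ofP A : upper_bound R (img omega (partial_sum A)) (real_of A) /\
  forall b, upper_bound R (img omega (partial_sum A)) b -> real_of A <== b.
Proof.
  rewrite /real_of locked_withE.
  apply: (theP (P := fun l => upper_bound R (img omega (partial_sum A)) l /\
    forall b, upper_bound R (img omega (partial_sum A)) b -> l <== b)).
  case: (Rcomplete hR (s := img omega (partial_sum A))).
  - by move=> x; rewrite in_img => -[n [Hn ->]]; apply: partial_sum_in.
  - exists (partial_sum A empty); rewrite in_img; exists empty.
    by split => //; apply: zero_in.
  - by exists (partial_sum A empty +++ (eps empty +++ eps empty));
      apply: partial_sum_upper; apply: zero_in.
  - move=> l [Ul Ll]; exists l; split => // l' [Ul' Ll'].
    by apply: (Rle_antisym hR); [apply: Ll|apply: Ll'].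
Qed.

Lemma real_of_in A : real_of A ∈ RR.
Proof. by case: (real_ofP A) => -[]. Qed.

(** At the first difference [n] between [A] and [B] the term [eps n] outweighs
    the remaining terms. *)
Lemma real_of_lt A B n : n ∈ omega -> n ∈ A -> n ∉ B ->
  partial_sum A n = partial_sum B n -> real_of B <<< real_of A.
Proof.
  move=> Hn HA HB E; have HS := succ_in Hn; have HP := partial_sum_in B Hn.
  case: (real_ofP A) => -[_ UA] _; case: (real_ofP B) => _ LB.
  apply: (rle_lt_trans (LB _ (partial_sum_upper B HS))).
  apply: (@rlt_le_trans _ _ _ _ (partial_sum A (succ n))); last first.
    by apply: UA; rewrite in_img; exists (succ n).
  rewrite !partial_sumS // ite_false // ite_true // E.
  rewrite (radd_comm HP (eps_in Hn)) radd_comm //; last first.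
    by apply: radd_in; apply: eps_in.
  by apply: rlt_add2 (eps_two_lt Hn) (rle_refl HP).
Qed.

Lemma real_of_inj A B : subset A omega -> subset B omega ->
  real_of A = real_of B -> A = B.
Proof.
  move=> HA HB E; apply: NNPP => N.
  have D : definable1 (fun n => ~ (n ∈ A <-> n ∈ B)) by definability.
  case: (omega_least (P := fun n => ~ (n ∈ A <-> n ∈ B))).
  - apply: NNPP => C; apply: N; apply: set_ext => x.
    apply: NNPP => C'; apply: C; exists x; split => //.
    case: (classic (x ∈ A)) => [/HA //|H]; case: (classic (x ∈ B)) => [/HB //|H'].
    by case: C'.
  - move=> n [Hn [Pn Ln]].
    have Es k : k ∈ omega -> k ∈ succ n -> partial_sum A k = partial_sum B k.
    { move: k; apply: omega_ind; first by rewrite !partial_sum0.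
      move=> k Hk IH Hkn.
      have K : k ∈ n.
      { move: Hkn; rewrite in_succ => -[H|<-]; last exact: mem_succ.
        exact: (omega_trans Hn H (mem_succ k)). }
      have Ek : partial_sum A k = partial_sum B k by apply: IH; rewrite in_succ; left.
      have /NNPP EAB := Ln k K.
      rewrite !partial_sumS // Ek.
      case: (classic (k ∈ A)) => H.
      - by rewrite !ite_true //; apply/EAB.
      - by rewrite !ite_false // => /EAB. }
    have En := Es n Hn (mem_succ n).
    case: (classic (n ∈ A)) => H.
    + have H' : n ∉ B by tauto.
      by case: (real_of_lt Hn H H' En); rewrite E.
    + have H' : n ∈ B by tauto.
      by case: (real_of_lt Hn H' H (esym En)); rewrite E.
Qed.

Context (hAC : AC_omega R).

(** Countable choice for subsets of a set that embeds into [P(ω)]. *)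
Lemma countable_choice S (J : M -> M) (Q : M -> M -> Prop)
    {HJ : definable_fun J} {HQ : definable2 Q} :
  (forall x, x ∈ S -> subset (J x) omega) ->
  (forall x y, x ∈ S -> y ∈ S -> J x = J y -> x = y) ->
  (forall n, n ∈ omega -> exists x, x ∈ S /\ Q n x) ->
  exists c, is_fun c omega S /\ forall n, n ∈ omega -> Q n (app c n).
Proof.
  move=> HJS inj HE.
  pose (F := lam omega (fun n => sep RR (fun r => exists x, x ∈ S /\ Q n x /\ r = real_of (J x)))).
  have FF : is_fun F omega (power RR).
    by apply: lam_fun => n Hn; rewrite in_power => r; rewrite in_sep => -[].
  have AF n : n ∈ omega -> app F n = sep RR (fun r => exists x, x ∈ S /\ Q n x /\ r = real_of (J x)).
    by move=> Hn; rewrite /F app_lam.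
  have PF : is_power RR (power RR) by apply/is_powerE.
  case: (hAC omega_spec PF FF).
    move=> n s; rewrite (fun_related _ _ FF) => -[Hn ->].
    case: (HE n Hn) => x [Hx Qx]; exists (real_of (J x)); rewrite AF // in_sep.
    by split; [apply: real_of_in|exists x].
  move=> r [Fr Cr].
  have K n : n ∈ omega -> exists x, x ∈ S /\ Q n x /\ app r n = real_of (J x).
  { move=> Hn.
    have : app r n ∈ app F n.
    { apply: (Cr n); [by rewrite (fun_related _ _ FF)|by rewrite (fun_related _ _ Fr)]. }
    by rewrite AF // in_sep => -[_]. }
  pose (t := fun n => the (fun x => x ∈ S /\ Q n x /\ app r n = real_of (J x))).
  have Ht n : n ∈ omega -> t n ∈ S /\ Q n (t n) /\ app r n = real_of (J (t n)).
  { move=> Hn; apply: (theP (P := fun x => x ∈ S /\ Q n x /\ app r n = real_of (J x))).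
    case: (K n Hn) => x [Hx [Qx E]]; exists x; split => // y [Hy [Qy E']].
    apply: inj => //; apply: real_of_inj; [exact: HJS|exact: HJS|by rewrite -E -E']. }
  have Dt : definable_fun t by rewrite /t; definability.
  exists (lam omega t); split; first by apply: lam_fun => n /Ht [].
  by move=> n Hn; rewrite app_lam //; case: (Ht n Hn) => _ [].
Qed.

(** In particular for sets of binary relations on [ω]. *)
Lemma countable_choice_relations (Q : M -> M -> Prop) {HQ : definable2 Q} :
  (forall n, n ∈ omega -> exists x, subset x (prod omega omega) /\ Q n x) ->
  exists c, forall n, n ∈ omega ->
    subset (app c n) (prod omega omega) /\ Q n (app c n).
Proof.
  move=> H.
  case: (@countable_choice (power (prod omega omega))
    (fun x => sep omega (fun k => unpair k ∈ x)) Q).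
  - by move=> x _ k; rewrite in_sep => -[].
  - move=> x y; rewrite !in_power => Hx Hy E.
    have K a b : subset a (prod omega omega) ->
      sep omega (fun k => unpair k ∈ a) = sep omega (fun k => unpair k ∈ b) ->
      subset a b.
    { move=> Ha Eab p Hp; have := Ha p Hp; rewrite in_prod => -[u [v [Hu [Hv Ep]]]].
      case: (unpair_surj Hu Hv) => k [Hk Ek].
      have : k ∈ sep omega (fun k => unpair k ∈ a) by rewrite in_sep Ek -Ep.
      by rewrite Eab in_sep Ek -Ep => -[]. }
    by apply: set_ext => p; split; apply: K.
  - by move=> n /H [x [Hx Qx]]; exists x; rewrite in_power.
  - move=> c [Fc Qc]; exists c => n Hn; split; last exact: Qc.
    by rewrite -in_power; apply: app_in Fc Hn.
Qed.
End Choice.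

(** * Separable metrizable spaces *)

Section Metric.
Context {M : eps_structure} {hZF : ZF M} (R : real_structure M)
  {hR : complete_ordered_field R}.

Notation RR := (Rcarrier R).
Notation "'OO'" := (Rzero R).
Notation "x <== y" := (rle R x y) (at level 70).
Notation "x <<< y" := (rlt R x y) (at level 70).
Notation "x +++ y" := (radd R x y) (at level 50, left associativity).
Notation eps := (eps R).

(** The function [u] on [ω] enumerates a base that witnesses regularity: each
    point of an open set [O] has a basic neighbourhood whose closure lies in
    [O]. By the last clause points are closed, so that the space is Hausdorff. *)
Definition regular_base X T u : Prop :=
  is_topology X T /\
  (forall i, i ∈ omega -> app u i ∈ T) /\
  (forall O x, O ∈ T -> x ∈ O -> exists i, i ∈ omega /\ x ∈ app u i /\
     forall y, y ∈ X -> y ∉ O ->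
     exists j, j ∈ omega /\ y ∈ app u j /\ forall z, z ∈ app u i -> z ∉ app u j) /\
  (forall x y, x ∈ X -> y ∈ X -> x <> y -> exists O, O ∈ T /\ x ∈ O /\ y ∉ O).

(** The distance, as an operation. *)
Definition dist d x y : M := app d (pair x y).

#[local] Instance def_dist : definable_fun3 dist.
Proof. rewrite /dist; definability. Qed.

Lemma is_metricE X d : is_metric R X d <->
  is_fun d (prod X X) RR /\
  (forall x y, x ∈ X -> y ∈ X -> OO <== dist d x y) /\
  (forall x y, x ∈ X -> y ∈ X -> (dist d x y = OO <-> x = y)) /\
  (forall x y, x ∈ X -> y ∈ X -> dist d x y = dist d y x) /\
  (forall x y z, x ∈ X -> y ∈ X -> z ∈ X ->
     dist d x z <== dist d x y +++ dist d y z).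
Proof.
  rewrite /is_metric is_fun2E; split.
  - move=> [Fd [H1 [H2 [H3 H4]]]]; split => //.
    have E x y r : related2 d x y r <-> x ∈ X /\ y ∈ X /\ r = dist d x y
      by exact: (fun2_related _ _ _ Fd).
    have P x y : x ∈ X -> y ∈ X -> related2 d x y (dist d x y).
      by move=> Hx Hy; apply/E.
    split; first by move=> x y Hx Hy; apply: H1; apply: (P x y).
    split.
    { move=> x y Hx Hy; rewrite -(H2 x y) // E; split; last by move=> [_ [_ ->]].
      by move=> <-. }
    split.
    { by move=> x y Hx Hy; have := H3 _ _ _ (P x y Hx Hy); rewrite E => -[_ [_ ->]]. }
    move=> x y z Hx Hy Hz.
    apply: (H4 x y z (dist d x y) (dist d y z)); try exact: P.
    by apply/raddE; split; [|split => //]; apply: (app_in Fd); rewrite pair_in_prod.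
  - move=> [Fd [H1 [H2 [H3 H4]]]]; split => //.
    have E x y r : related2 d x y r <-> x ∈ X /\ y ∈ X /\ r = dist d x y
      by exact: (fun2_related _ _ _ Fd).
    split; first by move=> x y r /E [Hx [Hy ->]]; apply: H1.
    split; first by move=> x y Hx Hy; rewrite E -(H2 x y) //; split; [move=> [_ [_ <-]]|move=> <-].
    split; first by move=> x y r /E [Hx [Hy ->]]; rewrite E; split => //; split => //; apply: H3.
    move=> x y z r s t w /E [Hx [Hy ->]] /E [_ [Hz ->]] /E [_ [_ ->]].
    by rewrite raddE => -[_ [_ ->]]; apply: H4.
Qed.

Lemma metric_openE X d U : is_fun d (prod X X) RR ->
  (metric_open R X d U <-> subset U X /\ forall x, x ∈ U ->
    exists e, OO <<< e /\ forall y, y ∈ X -> dist d x y <<< e -> y ∈ U).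
Proof.
  move=> Fd; rewrite /metric_open; split=> -[H1 H2]; split => // x Hx.
  - case: (H2 x Hx) => e [He K]; exists e; split => // y Hy L.
    by apply: (K y _ _ L); rewrite (fun2_related _ _ _ Fd); split => //; apply: H1.
  - case: (H2 x Hx) => e [He K]; exists e; split => // y r.
    by rewrite (fun2_related _ _ _ Fd) => -[_ [Hy ->]]; apply: K.
Qed.

Section RegularBase.
Context (X T d D : M) (HT : is_topology X T) (Hd : is_metric R X d).
Context (OT : set_of (metric_open R X d) T).
Context (cD : countable D) (dD : is_dense X T D).

Let Fd : is_fun d (prod X X) RR. Proof. by case/is_metricE: Hd. Qed.
Let dist_in x y : x ∈ X -> y ∈ X -> dist d x y ∈ RR.
Proof. by move=> Hx Hy; apply: (app_in Fd); rewrite pair_in_prod. Qed.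
Let dist_sym x y : x ∈ X -> y ∈ X -> dist d x y = dist d y x.
Proof. by case/is_metricE: Hd => _ [_ [_ [H _]]]; apply: H. Qed.
Let dist_tri x y z : x ∈ X -> y ∈ X -> z ∈ X ->
  dist d x z <== dist d x y +++ dist d y z.
Proof. by case/is_metricE: Hd => _ [_ [_ [_ H]]]; apply: H. Qed.
Let dist_self x : x ∈ X -> dist d x x = OO.
Proof. by move=> Hx; case/is_metricE: Hd => _ [_ [H _]]; apply/H. Qed.

(** The open ball. *)
Definition ball a r : M := sep X (fun y => dist d a y <<< r).

#[local] Instance def_ball : definable_fun2 ball.
Proof. rewrite /ball; definability. Qed.

Lemma in_ball a r y : y ∈ ball a r <-> y ∈ X /\ dist d a y <<< r.
Proof. exact: in_sep. Qed.

Lemma ball_open a r : a ∈ X -> r ∈ RR -> ball a r ∈ T.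
Proof.
  move=> Ha Hr; apply/OT/(metric_openE _ Fd); split.
    by move=> y; rewrite in_ball => -[].
  move=> x; rewrite in_ball => -[Hx L].
  have Hax := dist_in Ha Hx.
  case: (ropp_exists Hax) => w [Hw E]; exists (r +++ w).
  have Hrw : r +++ w ∈ RR by apply: radd_in.
  split.
  - by rewrite -E; apply: rlt_add2 L (rle_refl Hw).
  - move=> y Hy L'; rewrite in_ball; split => //.
    apply: rle_lt_trans (dist_tri Ha Hx Hy) _.
    have L2 : dist d x y +++ dist d a x <<< (r +++ w) +++ dist d a x.
      by apply: rlt_add2 L' (rle_refl Hax).
    rewrite radd_comm //; last exact: dist_in.
    by rewrite radd_assoc // (radd_comm Hw Hax) E radd0 in L2.
Qed.

Lemma ball_center a r : a ∈ X -> OO <<< r -> a ∈ ball a r.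
Proof. by move=> Ha Hr; rewrite in_ball dist_self. Qed.

(** The balls of radius [eps n] around the points of a countable dense set. *)
Lemma metrizable_regular_base : exists u, regular_base X T u.
Proof.
  case/countableE: cD => phi [Fphi inj]; case: dD => DX HD.
  pose (b := fun k => sep X (fun y => exists a, a ∈ D /\
     app phi a = fst (unpair k) /\ y ∈ ball a (eps (snd (unpair k))))).
  have Db : definable_fun b by rewrite /b; definability.
  exists (lam omega b).
  have bE k a n : k ∈ omega -> n ∈ omega -> a ∈ D -> unpair k = pair (app phi a) n ->
      app (lam omega b) k = ball a (eps n).
  { move=> Hk Hn Ha E; rewrite app_lam // /b E fst_pair snd_pair.
    apply: set_ext => y; rewrite in_sep; split.
    - by move=> [_ [a' [Ha' [/inj E' H]]]]; rewrite -E'.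
    - by move=> H; split; [move: H; rewrite in_ball => -[]|exists a]. }
  (* every point is within [eps n] of the centre of a ball of that radius *)
  have cover x n : x ∈ X -> n ∈ omega -> exists a k, a ∈ X /\ k ∈ omega /\
      app (lam omega b) k = ball a (eps n) /\ dist d x a <<< eps n.
  { move=> Hx Hn; have He : eps n ∈ RR by apply: eps_in.
    case: (HD (ball x (eps n))).
    - exact: ball_open.
    - by exists x; apply: ball_center => //; apply: eps_pos.
    - move=> a []; rewrite in_ball => -[HaX L] HaD.
      case: (codeP (app_in Fphi HaD) Hn) => Hc Ec.
      by exists a, (code (app phi a) n); split => //; split => //; split => //; apply: bE Ec. }
  split => //; split; last split.
  - move=> k Hk; rewrite app_lam //.
    case: (unpair_eta Hk) => _ [Hn _]; have He : eps (snd (unpair k)) ∈ RR by apply: eps_in.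
    apply: (open_local HT) => x; rewrite /b in_sep => -[Hx [a [Ha [E Hb]]]].
    exists (ball a (eps (snd (unpair k)))); split; first by apply: ball_open => //; apply: DX.
    split => // y Hy; rewrite in_sep; split; first by move: Hy; rewrite in_ball => -[].
    by exists a.
  - move=> O x HO Hx; move/OT/(metric_openE _ Fd): (HO) => -[OX /(_ x Hx) [e [He HeO]]].
    have HxX := OX x Hx.
    case: (eps_small He) => n [Hn Ln]; have HS := succ_in Hn.
    (* a chain of four distances below [eps (succ n)] is below [eps n] *)
    case: (cover x _ HxX HS) => a [k [HaX [Hk [Ek La]]]].
    exists k; split => //; rewrite Ek; split.
      by rewrite in_ball dist_sym.
    move=> y Hy HyO.
    case: (cover y _ Hy HS) => c [j [HcX [Hj [Ej Lc]]]].
    exists j; split => //; rewrite Ej; split; first by rewrite in_ball dist_sym.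
    move=> z; rewrite !in_ball => -[Hz L1] [_ L2]; apply: HyO; apply: HeO => //.
    apply: rle_lt_trans Ln.
    have I1 := dist_in HxX HaX; have I2 := dist_in HaX Hz.
    have I3 := dist_in Hz HcX; have I4 := dist_in HcX Hy.
    apply: (rle_trans (dist_tri HxX Hz Hy)).
    rewrite -(eps_four Hn); apply: rle_add2.
    + apply: (rle_trans (dist_tri HxX HaX Hz)); exact: rle_add2 (rltW La) (rltW L1).
    + apply: (rle_trans (dist_tri Hz HcX Hy)).
      rewrite (dist_sym Hz HcX) (dist_sym HcX Hy).
      exact: rle_add2 (rltW L2) (rltW Lc).
  - move=> x y Hx Hy N; have Hxy := dist_in Hx Hy.
    exists (ball x (dist d x y)); split; first exact: ball_open.
    split; last by rewrite in_ball => -[_]; apply: rlt_irrefl.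
    apply: ball_center => //; case/is_metricE: Hd => _ [P [Z _]].
    by split; [apply: P|move=> E; apply: N; apply/Z].
Qed.
End RegularBase.

Lemma separable_metrizable_regular_base X T :
  separable_metrizable R X T -> exists u, regular_base X T u.
Proof.
  move=> [HT [[d [Hd OT]] [D [cD dD]]]].
  exact: (metrizable_regular_base HT Hd OT cD dD).
Qed.

(** A countable dense set of sequences: the number [c] codes the sequence of
    first components obtained by unpairing [c] again and again, following the
    second component. *)
Definition tail : M -> M -> M := locked_with seal
  (fun c n => natrec c (fun _ s => snd (unpair s)) n).
Definition point : M -> M := locked_with seal
  (fun c => lam omega (fun n => fst (unpair (tail c n)))).

#[local] Instance def_tail : definable_fun2 tail.
Proof. rewrite /tail locked_withE; definability. Qed.
#[local] Instance def_point : definable_fun point.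
Proof. rewrite /point locked_withE; definability. Qed.

Lemma tail0 c : tail c empty = c.
Proof. rewrite /tail locked_withE; exact: natrec0. Qed.

Lemma tailS c n : n ∈ omega -> tail c (succ n) = snd (unpair (tail c n)).
Proof.
  rewrite /tail locked_withE => Hn.
  exact: (natrecS (G := fun _ s => snd (unpair s)) _ Hn).
Qed.

Lemma tail_shift c n : n ∈ omega -> tail c (succ n) = tail (snd (unpair c)) n.
Proof.
  move: n; apply: omega_ind; first by rewrite tailS ?tail0 //; apply: zero_in.
  by move=> n Hn IH; rewrite tailS ?IH ?tailS //; apply: succ_in.
Qed.

Lemma app_point c n : n ∈ omega -> app (point c) n = fst (unpair (tail c n)).
Proof. by move=> Hn; rewrite /point locked_withE app_lam. Qed.

Lemma succ_mem_succ n m : n ∈ omega -> m ∈ omega -> succ m ∈ succ n -> m ∈ n.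
Proof.
  move=> Hn Hm H; apply: NNPP => N.
  have : n ∈ succ m by apply/mem_succ_iff.
  rewrite in_succ => -[K|K].
  - by apply: (mem_asym (succ_mono Hm Hn K) H).
  - by move: H; rewrite K; apply: mem_irrefl.
Qed.

Lemma point_dense n : n ∈ omega -> forall x, x ∈ seqs omega ->
  exists c, c ∈ omega /\ agree n (point c) x.
Proof.
  move: n; apply: omega_ind.
  - by move=> x _; exists empty; split; [apply: zero_in|apply: agree_zero].
  - move=> n Hn IH x Hx.
    have Hy : lam omega (fun i => app x (succ i)) ∈ seqs omega.
      by apply: lam_seqs => i Hi; apply: (seqs_app Hx); apply: succ_in.
    case: (IH _ Hy) => c [Hc A].
    case: (codeP (seqs_app Hx zero_in) Hc) => Hk Ek.
    exists (code (app x empty) c); split => // i Hi.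
    have Hio : i ∈ omega by apply: omega_mem Hi; apply: succ_in.
    case: (omega_case Hio) => [E|[j [Hj E]]].
    + by rewrite E app_point ?tail0 ?Ek ?fst_pair //; apply: zero_in.
    + subst i; rewrite app_point // tail_shift // Ek snd_pair -app_point // A ?app_lam //.
      exact: succ_mem_succ.
Qed.

(** The metric of the Baire space: two sequences are at distance [eps n] when [n]
    is the first place where they differ. *)
Definition first_diff x y : M := least (fun n => app x n <> app y n).
Definition Baire_dist : M -> M -> M := locked_with seal
  (fun x y => ite (x = y) OO (eps (first_diff x y))).

#[local] Instance def_first_diff : definable_fun2 first_diff.
Proof. rewrite /first_diff; definability. Qed.
#[local] Instance def_Baire_dist : definable_fun2 Baire_dist.
Proof. rewrite /Baire_dist locked_withE; definability. Qed.

Lemma first_diffP x y : x ∈ seqs omega -> y ∈ seqs omega -> x <> y ->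
  first_diff x y ∈ omega /\ app x (first_diff x y) <> app y (first_diff x y) /\
  agree (first_diff x y) x y.
Proof.
  move=> Hx Hy N; rewrite /first_diff.
  case: (leastP (P := fun n => app x n <> app y n)).
  - apply: NNPP => C; apply: N; apply: (seqs_ext Hx Hy) => n Hn.
    by apply: NNPP => C'; apply: C; exists n.
  - move=> H1 [H2 H3]; split => //; split => // i Hi.
    by apply: NNPP; apply: H3.
Qed.

Lemma Baire_dist_self x : Baire_dist x x = OO.
Proof. by rewrite /Baire_dist locked_withE ite_true. Qed.

Lemma Baire_dist_neq x y : x <> y -> Baire_dist x y = eps (first_diff x y).
Proof. by move=> N; rewrite /Baire_dist locked_withE ite_false. Qed.

Lemma Baire_dist_pos x y : x ∈ seqs omega -> y ∈ seqs omega -> x <> y ->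
  OO <<< Baire_dist x y.
Proof.
  move=> Hx Hy N; rewrite Baire_dist_neq //; apply: eps_pos.
  by case: (first_diffP Hx Hy N).
Qed.

Lemma Baire_dist_ge0 x y : x ∈ seqs omega -> y ∈ seqs omega ->
  OO <== Baire_dist x y.
Proof.
  move=> Hx Hy; case: (classic (x = y)) => [->|N].
  - by rewrite Baire_dist_self; apply: rle_refl; apply: zero_real.
  - by apply: rltW; apply: Baire_dist_pos.
Qed.

Lemma Baire_dist_in x y : x ∈ seqs omega -> y ∈ seqs omega -> Baire_dist x y ∈ RR.
Proof. by move=> Hx Hy; case: (rle_real (Baire_dist_ge0 Hx Hy)). Qed.

(** A point that differs from [x] at [n] is at distance at least [eps n]. *)
Lemma Baire_dist_ge x y n : x ∈ seqs omega -> y ∈ seqs omega -> n ∈ omega ->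
  app x n <> app y n -> eps n <== Baire_dist x y.
Proof.
  move=> Hx Hy Hn N.
  have Nxy : x <> y by move=> E; apply: N; rewrite E.
  case: (first_diffP Hx Hy Nxy) => Hm [_ A].
  rewrite Baire_dist_neq //; apply: eps_anti => //.
  by apply/mem_succ_iff => // H; apply: N; apply: A.
Qed.

Lemma Baire_dist_lt x y n : x ∈ seqs omega -> y ∈ seqs omega -> n ∈ omega ->
  Baire_dist x y <<< eps n -> agree n x y.
Proof.
  move=> Hx Hy Hn L i Hi; apply: NNPP => N.
  have Hio := omega_mem Hn Hi.
  have K1 := Baire_dist_ge Hx Hy Hio N.
  have K2 : eps n <== eps i by apply: eps_anti => //; rewrite in_succ; left.
  exact: (rlt_irrefl (rlt_le_trans L (rle_trans K2 K1))).
Qed.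

Lemma agree_Baire_dist x y n : x ∈ seqs omega -> y ∈ seqs omega -> n ∈ omega ->
  agree n x y -> Baire_dist x y <== eps n.
Proof.
  move=> Hx Hy Hn A; case: (classic (x = y)) => [->|N].
  - by rewrite Baire_dist_self; apply: rltW; apply: eps_pos.
  - case: (first_diffP Hx Hy N) => Hm [Nm _].
    rewrite Baire_dist_neq //; apply: eps_anti => //.
    by apply/mem_succ_iff => // H; apply: Nm; apply: A.
Qed.

Lemma Baire_dist_sym x y : x ∈ seqs omega -> y ∈ seqs omega ->
  Baire_dist x y = Baire_dist y x.
Proof.
  move=> Hx Hy; case: (classic (x = y)) => [-> //|N].
  have N' : y <> x by exact: nesym.
  case: (first_diffP Hy Hx N') => Hm [Nm A].
  rewrite !Baire_dist_neq //; congr eps; apply: least_eq => //.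
  - exact: nesym.
  - by move=> i Hi; apply; rewrite A.
Qed.

Lemma Baire_dist_tri x y z : x ∈ seqs omega -> y ∈ seqs omega -> z ∈ seqs omega ->
  Baire_dist x z <== Baire_dist x y +++ Baire_dist y z.
Proof.
  move=> Hx Hy Hz; have Ixy := Baire_dist_in Hx Hy; have Iyz := Baire_dist_in Hy Hz.
  have Pxy := Baire_dist_ge0 Hx Hy; have Pyz := Baire_dist_ge0 Hy Hz.
  case: (classic (x = z)) => [E|N].
  - subst z; rewrite Baire_dist_self; apply: (rle_trans Pxy); exact: rle_addr.
  - case: (first_diffP Hx Hz N) => Hm [Nm _].
    rewrite Baire_dist_neq //.
    case: (classic (app x (first_diff x z) = app y (first_diff x z))) => E.
    + rewrite E in Nm; apply: (rle_trans (Baire_dist_ge Hy Hz Hm Nm)).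
      by rewrite radd_comm //; apply: rle_addr.
    + apply: (rle_trans (Baire_dist_ge Hx Hy Hm E)); exact: rle_addr.
Qed.

Context (hAC : AC_omega R).

(** Every subspace of the Baire space is separable and metrizable. *)
Lemma seqs_separable_metrizable X : subset X (seqs omega) ->
  separable_metrizable R X (agree_top X).
Proof.
  move=> HX; split; first exact: agree_topology.
  pose (d := lam (prod X X) (fun p => Baire_dist (fst p) (snd p))).
  have Fd : is_fun d (prod X X) RR.
  { apply: lam_fun => p /in_prod [x [y [Hx [Hy ->]]]].
    by rewrite fst_pair snd_pair; apply: Baire_dist_in; apply: HX. }
  have dE x y : x ∈ X -> y ∈ X -> dist d x y = Baire_dist x y.
    by move=> Hx Hy; rewrite /dist /d app_lam ?pair_in_prod // fst_pair snd_pair.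
  split.
  - exists d; split.
    + apply/is_metricE; split => //.
      split; first by move=> x y Hx Hy; rewrite dE //; apply: Baire_dist_ge0; apply: HX.
      split.
      { move=> x y Hx Hy; rewrite dE //; split=> [E|->]; last exact: Baire_dist_self.
        apply: NNPP => N.
        by case: (Baire_dist_pos (HX x Hx) (HX y Hy) N) => _; rewrite E. }
      split; first by move=> x y Hx Hy; rewrite !dE //; apply: Baire_dist_sym; apply: HX.
      by move=> x y z Hx Hy Hz; rewrite !dE //; apply: Baire_dist_tri; apply: HX.
    + move=> U; rewrite in_agree_top (metric_openE _ Fd); split=> -[HU OU]; split => // x Hx.
      * case: (OU x Hx) => n [Hn A]; exists (eps n); split; first exact: eps_pos.
        move=> y Hy; rewrite dE //; last exact: HU.
        by move=> L; apply: A => //; apply: Baire_dist_lt L => //; apply: HX => //; apply: HU.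
      * case: (OU x Hx) => e [He A]; case: (eps_small He) => n [Hn L].
        exists n; split => // y Hy Ag; apply: A => //; rewrite dE //; last exact: HU.
        by apply: rle_lt_trans L; apply: agree_Baire_dist => //; apply: HX => //; apply: HU.
  - case: (classic (nonempty X)) => [[x0 Hx0]|E]; last first.
    { exists empty; split.
        apply/countableE; exists empty; split; last by move=> x y /not_in_empty.
        by split=> p /not_in_empty.
      split; first by move=> x /not_in_empty.
      move=> U; rewrite in_agree_top => -[HU _] [x Hx]; case: E; exists x; exact: HU. }
    (* a point in each basic set that meets [X] *)
    pose (Q := fun k x => x ∈ X /\ ((exists y, y ∈ X /\
      agree (snd (unpair k)) (point (fst (unpair k))) y) ->
      agree (snd (unpair k)) (point (fst (unpair k))) x)).
    have DQ : definable2 Q by rewrite /Q; definability.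
    case: (@countable_choice_relations _ _ R _ hAC Q).
    + move=> k Hk.
      have [x Hx] : exists x, Q k x.
      { case: (classic (exists y, y ∈ X /\
          agree (snd (unpair k)) (point (fst (unpair k))) y)) => [[y [Hy A]]|N].
        - by exists y.
        - by exists x0. }
      exists x; split => //; case: (Hx) => /HX; rewrite in_seqs => -[K _] _ p /K.
      by move=> [u [v [Hu [Hv /is_pairE ->]]]]; rewrite pair_in_prod.
    + move=> c Hc; exists (img omega (app c)); split.
        by apply: countable_img; apply: countable_omega.
      split; first by move=> x; rewrite in_img => -[k [Hk ->]]; case: (Hc k Hk) => _ [].
      move=> U; rewrite in_agree_top => -[HU OU] [x Hx].
      case: (OU x Hx) => n [Hn A].
      case: (point_dense Hn (HX x (HU x Hx))) => a [Ha B].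
      case: (codeP Ha Hn) => Hk Ek; exists (app c (code a n)).
      rewrite in_img; split; last by exists (code a n).
      case: (Hc _ Hk) => _ [Hy]; rewrite Ek fst_pair snd_pair => K.
      apply: A => //; apply: agree_trans (agree_sym B) (K _).
      by exists x; split => //; apply: HU.
Qed.
End Metric.

(** * Unions of countably many closed sets, and points of continuity *)

Section Category.
Context {M : eps_structure} {hZF : ZF M}.

#[export] Instance def_is_diff : definable3 (@is_diff M).
Proof. rewrite /is_diff /set_of; definability. Qed.
#[export] Instance def_is_closed : definable3 (@is_closed M).
Proof. rewrite /is_closed; definability. Qed.

Lemma is_closedE X T F : is_closed X T F <-> subset F X /\ diff X F ∈ T.
Proof.
  split=> [[H [U [/is_diffE -> HU]]] //|[H HU]].
  by split => //; exists (diff X F); rewrite is_diffE.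
Qed.

Lemma Fsigma_bigcup X T I (F : M -> M) {HF : definable_fun F} :
  countable I -> (forall i, i ∈ I -> is_closed X T (F i)) ->
  is_Fsigma X T (union (img I F)).
Proof.
  move=> cI HC; exists (img I F); split; first exact: countable_img.
  split; last by apply/is_unionE.
  by move=> A; rewrite in_img => -[i [Hi ->]]; apply: HC.
Qed.

(** The closed set whose complement is the union of the basic sets [u i] with
    [(m, i) ∈ c]: every [F_σ] set is the union over [m] of these sets for some
    [c ⊆ ω × ω]. *)
Definition coded_closed X u c m : M :=
  sep X (fun x => forall i, i ∈ omega -> pair m i ∈ c -> x ∉ app u i).

Lemma in_coded_closed X u c m x : x ∈ coded_closed X u c m <->
  x ∈ X /\ forall i, i ∈ omega -> pair m i ∈ c -> x ∉ app u i.
Proof. exact: in_sep. Qed.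

Lemma coded_closed_closed X T u c m : regular_base X T u ->
  is_closed X T (coded_closed X u c m).
Proof.
  move=> [HT [Hu _]]; apply/is_closedE; split.
    by move=> x; rewrite in_coded_closed => -[].
  apply: (open_local HT) => x; rewrite in_diff in_coded_closed => -[Hx N].
  have [i [Hi [Hc Hxi]]] : exists i, i ∈ omega /\ pair m i ∈ c /\ x ∈ app u i.
  { apply: NNPP => C; apply: N; split => // i Hi Hc Hxi.
    by apply: C; exists i. }
  exists (app u i); split; first exact: Hu.
  split => // y Hy; rewrite in_diff in_coded_closed; split.
    exact: (open_sub HT (Hu i Hi)).
  by move=> [_ /(_ i Hi Hc)].
Qed.

Lemma Fsigma_coded X T u S : regular_base X T u -> is_Fsigma X T S ->
  exists c, subset c (prod omega omega) /\
    S = union (img omega (coded_closed X u c)).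
Proof.
  move=> [HT [Hu [Hb _]]] [FF [/countableE [phi [Fphi inj]] [HC /is_unionE ->]]].
  pose (c := sep (prod omega omega) (fun p => forall F, F ∈ FF ->
     app phi F = fst p -> forall x, x ∈ app u (snd p) -> x ∉ F)).
  have Hc m i : pair m i ∈ c <-> m ∈ omega /\ i ∈ omega /\ forall F, F ∈ FF ->
     app phi F = m -> forall x, x ∈ app u i -> x ∉ F.
    by rewrite in_sep pair_in_prod fst_pair snd_pair; tauto.
  have D : definable_fun (coded_closed X u c) by rewrite /coded_closed; definability.
  exists c; split; first by move=> p; rewrite in_sep => -[].
  apply: set_ext => x; rewrite !in_union; split.
  - move=> [F [HF Hx]]; have Hm := app_in Fphi HF.
    exists (coded_closed X u c (app phi F)); rewrite in_img; split.
      by exists (app phi F).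
    rewrite in_coded_closed; split; first by case: (HC F HF) => K _; apply: K.
    by move=> i Hi /Hc [_ [_ K]] Hxi; apply: (K F HF _ x).
  - move=> [G []]; rewrite in_img => -[m [Hm ->]]; rewrite in_coded_closed => -[Hx K].
    apply: NNPP => N.
    have [O [HO [HxO A]]] : exists O, O ∈ T /\ x ∈ O /\ forall F, F ∈ FF ->
        app phi F = m -> forall y, y ∈ O -> y ∉ F.
    { case: (classic (exists F, F ∈ FF /\ app phi F = m)) => [[F [HF EF]]|C].
      - exists (diff X F); split; first by case/is_closedE: (HC F HF).
        split; first by rewrite in_diff; split => // HxF; apply: N; exists F.
        move=> F' HF' EF' y; have -> : F' = F by apply: inj => //; rewrite EF'.
        by rewrite in_diff => -[].
      - exists X; split; first exact: open_full HT.
        by split => // F HF EF; case: C; exists F. }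
    case: (Hb O x HO HxO) => i [Hi [Hxi B]].
    apply: (K i Hi) => //; apply/Hc; split => //; split => // F HF EF y Hy.
    apply: (A F HF EF); apply: NNPP => NO.
    have HyX : y ∈ X by exact: (open_sub HT (Hu i Hi)).
    by case: (B y HyX NO) => j [_ [Hyj Dj]]; apply: (Dj y).
Qed.

Section WithReals.
Context (R : real_structure M) {hR : complete_ordered_field R}.
Context (hAC : AC_omega R).

(** Countably many [F_σ] sets can be decomposed into closed sets at once. *)
Lemma Fsigma_choice X T u (Q : M -> M -> Prop) {HQ : definable2 Q} :
  regular_base X T u ->
  (forall n, n ∈ omega -> exists S, is_Fsigma X T S /\ Q n S) ->
  exists g, (forall n m, n ∈ omega -> m ∈ omega -> is_closed X T (app g (pair n m))) /\
    forall n, n ∈ omega -> Q n (union (img omega (fun m => app g (pair n m)))).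
Proof.
  move=> Hu HE.
  case: (@countable_choice_relations _ _ R _ hAC
    (fun n c => Q n (union (img omega (coded_closed X u c))))).
  - rewrite /coded_closed; definability.
  - move=> n Hn; case: (HE n Hn) => S [FS QS].
    by case: (Fsigma_coded Hu FS) => c [Hc E]; exists c; rewrite -E.
  - move=> c Hc.
    pose (g := lam (prod omega omega) (fun p => coded_closed X u (app c (fst p)) (snd p))).
    have Dg : definable_fun (fun p => coded_closed X u (app c (fst p)) (snd p)).
      by rewrite /coded_closed; definability.
    have gE n m : n ∈ omega -> m ∈ omega ->
        app g (pair n m) = coded_closed X u (app c n) m.
      by move=> Hn Hm; rewrite /g app_lam ?pair_in_prod // fst_pair snd_pair.
    exists g; split; first by move=> n m Hn Hm; rewrite gE //; apply: coded_closed_closed.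
    move=> n Hn; case: (Hc n Hn) => _.
    have D1 : definable_fun (coded_closed X u (app c n)) by rewrite /coded_closed; definability.
    have -> // : img omega (coded_closed X u (app c n)) = img omega (fun m => app g (pair n m)).
    apply: set_ext => y; rewrite !in_img; split=> -[m [Hm ->]]; exists m; by rewrite gE.
Qed.
End WithReals.

Section BaireCategory.
Context (X T u K TK H : M) (Hu : regular_base X T u) (HK : subset K X).
Context (HTK : is_subspace T K TK) (cK : compact_ideal K TK) (nK : nonempty K).
Context (closed_H : forall k, k ∈ omega -> is_closed X T (app H k)).

Definition meets i : Prop := exists y, y ∈ K /\ y ∈ app u i.

(** The basic set [j] is inside [i], with its closure, and inside [H k] or
    disjoint from it (relatively to [K]). *)
Definition refines k i j : Prop :=
  meets j /\
  (forall y, y ∈ K -> y ∉ app u i ->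
     exists l, l ∈ omega /\ y ∈ app u l /\ forall z, z ∈ app u j -> z ∉ app u l) /\
  ((forall y, y ∈ K -> y ∈ app u j -> y ∈ app H k) \/
   (forall y, y ∈ K -> y ∈ app u j -> y ∉ app H k)).

Lemma refines_exists k i : k ∈ omega -> i ∈ omega -> meets i ->
  exists j, j ∈ omega /\ refines k i j.
Proof.
  move=> Hk Hi Mi; case: (Hu) => HT [Hopen [Hb _]].
  have [x [O [HO [HxK [HxO [Oi D]]]]]] : exists x O, O ∈ T /\ x ∈ K /\ x ∈ O /\
      subset O (app u i) /\ ((forall y, y ∈ K -> y ∈ O -> y ∈ app H k) \/
       (forall y, y ∈ K -> y ∈ O -> y ∉ app H k)).
  { case: (classic (exists x, x ∈ K /\ x ∈ app u i /\ x ∉ app H k)) => [[x [HxK [Hxi N]]]|C].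
    - exists x, (inter (app u i) (diff X (app H k))); split.
        by apply: (open_inter HT); [apply: Hopen|case/is_closedE: (closed_H Hk)].
      split => //; split; first by rewrite in_inter in_diff; do 2 (split => //); apply: HK.
      split; first by move=> y; rewrite in_inter => -[].
      by right=> y _; rewrite in_inter in_diff => -[_ []].
    - case: Mi => x [HxK Hxi]; exists x, (app u i); split; first exact: Hopen.
      split => //; split => //; split => //; left=> y HyK Hyi.
      by apply: NNPP => N; apply: C; exists y. }
  case: (Hb O x HO HxO) => j [Hj [Hxj A]]; exists j; split => //.
  have jO : subset (app u j) O.
  { move=> y Hy; apply: NNPP => N; have HyX := open_sub HT (Hopen j Hj) Hy.
    by case: (A y HyX N) => l [_ [Hyl B]]; apply: (B y). }
  split; first by exists x.
  split.
  - move=> y HyK Hyi; apply: A; first exact: HK.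
    by move=> /Oi.
  - by case: D => D; [left|right] => y HyK /jO; apply: D.
Qed.

Definition base_seq i0 n : M := natrec i0 (fun k i => least (refines k i)) n.

(** Baire: some point of the compact set [K] is on the boundary, relatively to
    [K], of none of the closed sets [H k]. *)
Lemma Baire_category : exists x, x ∈ K /\ forall k, k ∈ omega -> x ∈ app H k ->
  exists i, i ∈ omega /\ x ∈ app u i /\ forall y, y ∈ K -> y ∈ app u i -> y ∈ app H k.
Proof.
  case: (Hu) => HT [Hopen [Hb _]]; case: nK => x0 Hx0.
  case: (Hb X x0 (open_full HT) (HK Hx0)) => i0 [Hi0 [Hxi0 _]].
  have Dr : definable3 refines by rewrite /refines /meets; definability.
  have Ds : definable_fun2 (fun k i => least (refines k i)).
    by rewrite /refines /meets; definability.
  pose (s := base_seq i0).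
  have Dseq : definable_fun s by rewrite /s /base_seq /refines /meets; definability.
  have sS n : n ∈ omega -> s (succ n) = least (refines n (s n)).
    by move=> Hn; apply: (natrecS (G := fun k i => least (refines k i)) _ Hn).
  have Hs n : n ∈ omega -> s n ∈ omega /\ meets (s n).
  { move: n; apply: omega_ind; first by rewrite /meets; definability.
    - by rewrite /s /base_seq natrec0; split => //; exists x0.
    - move=> n Hn [H1 H2]; rewrite sS //.
      by case: (leastP (P := refines n (s n)) (refines_exists Hn H1 H2)) => ? [[]]. }
  have Rs n : n ∈ omega -> refines n (s n) (s (succ n)).
  { move=> Hn; case: (Hs n Hn) => H1 H2; rewrite sS //.
    by case: (leastP (P := refines n (s n)) (refines_exists Hn H1 H2)) => ? []. }
  pose (L := fun n => sep K (fun y => forall l, l ∈ omega -> y ∈ app u l ->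
     exists z, z ∈ app u l /\ z ∈ app u (s n))).
  have DL : definable_fun L by rewrite /L; definability.
  have HL n y : y ∈ L n <-> y ∈ K /\ forall l, l ∈ omega -> y ∈ app u l ->
     exists z, z ∈ app u l /\ z ∈ app u (s n) by rewrite in_sep.
  have Sub n y : n ∈ omega -> y ∈ L (succ n) -> y ∈ app u (s n).
  { move=> Hn /HL [HyK A]; apply: NNPP => N.
    case: (Rs n Hn) => _ [B _]; case: (B y HyK N) => l [Hl [Hyl C]].
    by case: (A l Hl Hyl) => z [Hz1 Hz2]; apply: (C z). }
  have HTK' : is_topology K TK by exact: (subspace_topology HT HTK HK).
  case: (compact_nested (L := L) cK HTK').
  - move=> n Hn; case: (Hs n Hn) => _ [y [HyK Hy]]; exists y; split => //.
    by apply/HL; split => // l Hl Hyl; exists y.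
  - move=> n y Hn HyK Hy; apply/HL; split => // l Hl Hyl; exists y; split => //.
    exact: Sub.
  - move=> n y Hn HyK N.
    have [l [Hl [Hyl A]]] : exists l, l ∈ omega /\ y ∈ app u l /\
        forall z, z ∈ app u l -> z ∉ app u (s n).
    { apply: NNPP => C; apply: N; apply/HL; split => // l Hl Hyl.
      apply: NNPP => C'; apply: C; exists l; split => //; split => // z Hz1 Hz2.
      by apply: C'; exists z. }
    exists (inter (app u l) K); split.
      by move/subspaceE: HTK => ->; rewrite in_img; exists (app u l); split => //; apply: Hopen.
    split; first by rewrite in_inter.
    move=> z; rewrite in_inter => -[Hz _] /HL [_ /(_ l Hl Hz) [w [Hw1 Hw2]]].
    exact: (A w).
  - move=> x [HxK Hx]; exists x; split => // k Hk HxH.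
    have Hk1 := succ_in Hk; have Hk2 := succ_in Hk1.
    exists (s (succ k)); case: (Hs _ Hk1) => H1 _; split => //.
    have Hxs : x ∈ app u (s (succ k)) by apply: Sub => //; apply: Hx.
    split => //; case: (Rs k Hk) => _ [_ [A|A]]; first exact: A.
    by case: (A x HxK Hxs).
Qed.
End BaireCategory.

(** The restriction of [f] to [K]. *)
Definition restr f K : M := sep f (fun p => exists x y, x ∈ K /\ p = pair x y).

Lemma is_restrictionE f K g : is_restriction f K g <-> g = restr f K.
Proof.
  apply: set_ofE => p; rewrite in_sep.
  by split=> -[Hp [x [y [Hx E]]]]; split => //; exists x, y; split => //; exact/is_pairE.
Qed.

Lemma related_restr f K X Y x y : is_fun f X Y -> subset K X ->
  (related (restr f K) x y <-> x ∈ K /\ y = app f x).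
Proof.
  move=> Ff HK; rewrite relatedE in_sep (fun_pair _ _ Ff); split.
  - by move=> [[Hx ->] [x' [y' [Hx' /pair_inj [-> _]]]]].
  - move=> [Hx ->]; split; first by split => //; apply: HK.
    by exists x, (app f x).
Qed.

Lemma is_preimageE f X Y V P : is_fun f X Y ->
  (is_preimage f V P <-> P = sep X (fun x => app f x ∈ V)).
Proof.
  move=> Ff; apply: set_ofE => x; rewrite in_sep; split.
  - by move=> [Hx HV]; exists (app f x); rewrite (fun_related _ _ Ff).
  - by move=> [y [Hy]]; rewrite (fun_related _ _ Ff) => -[Hx E]; rewrite -E.
Qed.

(** A function of the first Baire class has points of continuity on compact
    sets: every point of [K] that avoids the boundaries of the closed sets into
    which the preimages of the basic open sets decompose. *)
Lemma Baire_class_1_continuity_point (R : real_structure M)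
    {hR : complete_ordered_field R} (hAC : AC_omega R) X TX u Y TY v f K TK :
  regular_base X TX u -> regular_base Y TY v -> is_fun f X Y ->
  Baire_class_1 X TX TY f -> subset K X -> nonempty K ->
  is_subspace TX K TK -> is_compact K TK ->
  restriction_has_continuity_point TX TY f K.
Proof.
  move=> Hu Hv Ff B1 HK nK HTK cK.
  case: (@Fsigma_choice R _ hAC X TX u
    (fun n S => S = sep X (fun x => app f x ∈ app v n)) _ Hu).
  { move=> n Hn; case: (Hv) => _ [Hopen _].
    by case: (B1 _ (Hopen n Hn)) => P [/(is_preimageE _ _ Ff) -> FP]; exists (sep X (fun x => app f x ∈ app v n)). }
  move=> g [Cg Eg].
  have HT : is_topology X TX by case: Hu.
  have HTK' : is_topology K TK by exact: (subspace_topology HT HTK HK).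
  have cK' : compact_ideal K TK by exact/is_compactE.
  case: (@Baire_category X TX u K TK (lam omega (fun k => app g (unpair k))) Hu HK HTK cK' nK).
  { move=> k Hk; rewrite app_lam //; case: (unpair_eta Hk) => H1 [H2 ->]; exact: Cg. }
  move=> x [HxK A]; exists TK, (restr f K), x; split => //.
  split; first exact/is_restrictionE.
  split => // y V; rewrite (related_restr _ _ Ff HK) => -[_ ->] HV HfV.
  case: (Hv) => _ [_ [Hb _]]; case: (Hb V _ HV HfV) => n [Hn [Hfn B]].
  have : x ∈ union (img omega (fun m => app g (pair n m))).
    by rewrite Eg // in_sep; split => //; apply: HK.
  rewrite in_union => -[S []]; rewrite in_img => -[m [Hm ->]] HxS.
  case: (codeP Hn Hm) => Hc Ec.
  have [i [Hi [Hxi C]]] : exists i, i ∈ omega /\ x ∈ app u i /\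
      forall y, y ∈ K -> y ∈ app u i -> y ∈ app g (pair n m).
  { have := A (code n m) Hc; rewrite app_lam // Ec; exact. }
  exists (inter (app u i) K); split.
    move/subspaceE: HTK => ->; rewrite in_img; exists (app u i); split => //.
    by case: Hu => _ [Ho _]; apply: Ho.
  split; first by rewrite in_inter.
  move=> x' y'; rewrite in_inter => -[Hx'i Hx'K].
  rewrite (related_restr _ _ Ff HK) => -[_ ->].
  have : x' ∈ union (img omega (fun m => app g (pair n m))).
    by rewrite in_union; exists (app g (pair n m)); rewrite in_img; split; [exists m|exact: C].
  rewrite Eg // in_sep => -[Hx'X Hf'].
  apply: NNPP => N; case: (B _ (app_in Ff Hx'X) N) => j [_ [H1 H2]].
  exact: (H2 _ Hf').
Qed.
End Category.

(** * From Cantor sets to functions of the first class *)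

Section Resolution.
Context {M : eps_structure} {hZF : ZF M}.

(** The point [x] of [X] has the binary expansion [z] along the base [u]: [x]
    is outside [u i] when the digit [z i] is [0], and in the closure of [u i]
    when it is [1]. *)
Definition expansion X u z x : Prop :=
  x ∈ X /\ forall i, i ∈ omega ->
    (app z i = empty -> x ∉ app u i) /\
    (app z i = one -> forall l, l ∈ omega -> x ∈ app u l ->
       exists y, y ∈ app u l /\ y ∈ app u i).

#[export] Instance def_expansion : definable4 expansion.
Proof. rewrite /expansion; definability. Qed.

Context (X T u : M) (Hu : regular_base X T u).

Lemma expansion_unique z x x' : z ∈ seqs two ->
  expansion X u z x -> expansion X u z x' -> x = x'.
Proof.
  move=> Hz [Hx Ex] [Hx' Ex']; apply: NNPP => N.
  case: (Hu) => _ [_ [Hb Hs]]; case: (Hs x x' Hx Hx' N) => O [HO [HxO Nx']].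
  case: (Hb O x HO HxO) => i [Hi [Hxi A]]; case: (A x' Hx' Nx') => j [Hj [Hx'j B]].
  have := seqs_app Hz Hi; rewrite in_two => -[E|E].
  - by case: (Ex i Hi) => /(_ E).
  - case: (Ex' i Hi) => _ /(_ E j Hj Hx'j) [y [Hyj Hyi]]; exact: (B y).
Qed.

Lemma expansion_exists x : x ∈ X -> exists z, z ∈ seqs two /\ expansion X u z x.
Proof.
  move=> Hx; exists (lam omega (fun i => ite (x ∈ app u i) one empty)).
  have E i : i ∈ omega -> app (lam omega (fun i => ite (x ∈ app u i) one empty)) i =
     ite (x ∈ app u i) one empty by move=> Hi; rewrite app_lam.
  split.
  - apply: lam_seqs => i Hi; rewrite in_two; case: (classic (x ∈ app u i)) => H.
    + by rewrite ite_true //; right.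
    + by rewrite ite_false //; left.
  - split => // i Hi; rewrite E //; case: (classic (x ∈ app u i)) => H.
    + rewrite ite_true //; split; first by move=> /one_neq0.
      by move=> _ l Hl Hxl; exists x.
    + by rewrite ite_false //; split => // /esym /one_neq0.
Qed.

(** The point is a continuous function of the expansion. *)
Lemma expansion_continuous z x O : z ∈ seqs two -> expansion X u z x ->
  O ∈ T -> x ∈ O -> exists n, n ∈ omega /\ forall z' x', agree n z z' ->
    expansion X u z' x' -> x' ∈ O.
Proof.
  move=> Hz [Hx Ex] HO HxO.
  case: (Hu) => _ [_ [Hb _]]; case: (Hb O x HO HxO) => i [Hi [Hxi A]].
  exists (succ i); split; first exact: succ_in.
  move=> z' x' Ag [Hx' Ex']; apply: NNPP => N.
  case: (A x' Hx' N) => j [Hj [Hx'j B]].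
  have E1 : app z i = one.
  { have := seqs_app Hz Hi; rewrite in_two => -[E|//].
    by case: (Ex i Hi) => /(_ E). }
  have E2 : app z' i = one by rewrite -E1 (Ag i (mem_succ i)).
  by case: (Ex' i Hi) => _ /(_ E2 j Hj Hx'j) [y [Hyj Hyi]]; apply: (B y).
Qed.

(** The set of points with an expansion in [F]. *)
Definition expanded F : M :=
  sep X (fun x => exists z, z ∈ F /\ z ∈ seqs two /\ expansion X u z x).

#[export] Instance def_expanded : definable_fun expanded.
Proof. rewrite /expanded; definability. Qed.

Lemma in_expanded F x : x ∈ expanded F <-> x ∈ X /\
  exists z, z ∈ F /\ z ∈ seqs two /\ expansion X u z x.
Proof. by rewrite in_sep. Qed.

(** By compactness of the Cantor space, taking expansions is a closed map. *)
Lemma expanded_closed F :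
  is_closed (seqs omega) (agree_top (seqs omega)) F -> is_closed X T (expanded F).
Proof.
  move=> /is_closedE [HF]; rewrite in_agree_top => -[_ OF].
  case: (Hu) => HT [Hopen _].
  apply/is_closedE; split; first by move=> x; rewrite in_expanded => -[].
  apply: (open_local HT) => x; rewrite in_diff in_expanded => -[Hx N].
  have [O [HO [HxO A]]] : exists O, O ∈ T /\ x ∈ O /\
      forall z x', z ∈ seqs two -> z ∈ F -> x' ∈ O -> ~ expansion X u z x'.
  { apply: (compact_ideal_use (P := fun L => exists O, O ∈ T /\ x ∈ O /\
      forall z x', z ∈ L -> z ∈ F -> x' ∈ O -> ~ expansion X u z x') Cantor_compact).
    - by exists X; split; [exact: open_full HT|split => // z x' /not_in_empty].
    - move=> a b [Oa [H1 [H2 H3]]] [Ob [K1 [K2 K3]]]; exists (inter Oa Ob).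
      split; first exact: (open_inter HT).
      split; first by rewrite in_inter.
      move=> z x'; rewrite in_cup in_inter => -[Hz|Hz] HzF [Hx1 Hx2].
      + exact: H3.
      + exact: K3.
    - move=> a b [Oa [H1 [H2 H3]]] Hb; exists Oa; split => //; split => // z x' /Hb.
      exact: H3.
    - move=> z Hz.
      have cyl n : n ∈ omega -> sep (seqs two) (fun y => agree n z y) ∈ agree_top (seqs two).
        by move=> Hn; rewrite in_agree_top; apply: cylinder_agree_open.
      case: (classic (z ∈ F)) => HzF; last first.
      { have HzN : z ∈ diff (seqs omega) F.
          by rewrite in_diff; split => //; move: Hz; rewrite !in_seqs; apply: is_fun_sub two_sub.
        case: (OF z HzN) => n [Hn B].
        exists (sep (seqs two) (fun y => agree n z y)); split; first exact: cyl.
        split; first by move=> y; rewrite in_sep => -[].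
        split; first by rewrite in_sep.
        exists X; split; first exact: open_full HT.
        split => // y x'; rewrite in_sep => -[Hy Ag] HyF.
        have := B y; rewrite in_diff => K; case: K => //.
        by move: Hy; rewrite !in_seqs; apply: is_fun_sub two_sub. }
      have NE : ~ expansion X u z x by move=> E; apply: N; split => //; exists z.
      have [i [Hi Ci]] : exists i, i ∈ omega /\ ~ ((app z i = empty -> x ∉ app u i) /\
         (app z i = one -> forall l, l ∈ omega -> x ∈ app u l ->
          exists y, y ∈ app u l /\ y ∈ app u i)).
      { apply: NNPP => D; apply: NE; split => // i Hi.
        by apply: NNPP => D'; apply: D; exists i. }
      exists (sep (seqs two) (fun y => agree (succ i) z y)); split; first by apply: cyl; apply: succ_in.
      split; first by move=> y; rewrite in_sep => -[].
      split; first by rewrite in_sep.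
      have Ez y : y ∈ sep (seqs two) (fun y => agree (succ i) z y) -> app y i = app z i.
        by rewrite in_sep => -[_ Ag]; rewrite (Ag i (mem_succ i)).
      case: (classic (app z i = empty /\ x ∈ app u i)) => [[E Hxi]|D1].
      + exists (app u i); split; first exact: Hopen.
        split => // y x' /Ez Ey _ Hx' [_ /(_ i Hi) [H _]].
        by apply: H => //; rewrite Ey.
      + have [E [l [Hl [Hxl B]]]] : app z i = one /\ exists l, l ∈ omega /\ x ∈ app u l /\
            forall y, y ∈ app u l -> y ∉ app u i.
        { apply: NNPP => D2; apply: Ci; split; first by move=> E Hxi; apply: D1.
          move=> E l Hl Hxl; apply: NNPP => D3; apply: D2; split => //.
          exists l; split => //; split => // y H1 H2; apply: D3; by exists y. }
        exists (app u l); split; first exact: Hopen.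
        split => // y x' /Ez Ey _ Hx' [_ /(_ i Hi) [_ H]].
        rewrite Ey in H; case: (H E l Hl Hx') => w [Hw1 Hw2]; exact: (B w). }
  exists O; split => //; split => // y Hy; rewrite in_diff in_expanded; split.
    exact: (open_sub HT HO).
  by move=> [_ [z [HzF [Hz]]]]; apply: A.
Qed.

Lemma expanded_Fsigma S :
  is_Fsigma (seqs omega) (agree_top (seqs omega)) S -> is_Fsigma X T (expanded S).
Proof.
  move=> [FF [cF [HC /is_unionE ->]]].
  have -> : expanded (union FF) = union (img FF expanded).
  { apply: set_ext => x; rewrite in_expanded in_union; split.
    - move=> [Hx [z [Hz Ez]]]; move: Hz; rewrite in_union => -[F [HF HzF]].
      exists (expanded F); rewrite in_img in_expanded; split; first by exists F.
      by split => //; exists z.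
    - move=> [G []]; rewrite in_img => -[F [HF ->]]; rewrite in_expanded.
      move=> [Hx [z [Hz Ez]]]; split => //; exists z; split => //.
      by rewrite in_union; exists F. }
  apply: Fsigma_bigcup => // F HF; apply: expanded_closed; exact: HC.
Qed.

Lemma expanded_compact C : subset C (seqs two) ->
  compact_ideal C (agree_top C) ->
  (forall z, z ∈ C -> exists x, expansion X u z x) ->
  forall TK, is_subspace T (expanded C) TK -> compact_ideal (expanded C) TK.
Proof.
  move=> HC cC Tot TK /subspaceE ->.
  apply: (compact_ideal_image (E := expansion X u) cC (agree_topology C)).
  - by move=> x; rewrite in_expanded => -[_ [z [Hz [_ E]]]]; exists z.
  - move=> z Hz; case: (Tot z Hz) => x E; exists x; split => //.
    by rewrite in_expanded; split; [case: E|exists z; split => //; split => //; apply: HC].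
  - move=> z x O Hz HxK E; rewrite in_img => -[U [HU ->]]; rewrite in_inter => -[HxU _].
    case: (expansion_continuous (HC z Hz) E HU HxU) => n [Hn A].
    exists (sep C (fun y => agree n z y)); split.
      by rewrite in_agree_top; apply: cylinder_agree_open.
    split; first by rewrite in_sep.
    move=> z' x'; rewrite in_sep => -[Hz' Ag] Hx' E'; rewrite in_inter; split => //.
    exact: A E'.
Qed.
End Resolution.

Section CantorSets.
Context {M : eps_structure} {hZF : ZF M}.

Lemma Cantor_set_compact N C : is_Cantor_set N (agree_top N) C ->
  compact_ideal C (agree_top C) /\ nonempty C.
Proof.
  move=> [HCN [TC [Z [TZ [h [HTC [/Cantor_spaceE [-> ->] [Bh [Ch Oh]]]]]]]]].
  move/(subspace_agree _ HCN): HTC => ETC; subst TC.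
  case/is_bijectionE: Bh => Fh [inj surj].
  split.
  - apply: (compact_ideal_image (E := fun a z => related h z a) Cantor_compact
      (agree_topology _)).
    + move=> z Hz; exists (app h z); split; first exact: app_in Fh Hz.
      by rewrite (fun_related _ _ Fh).
    + by move=> a /surj [z [Hz E]]; exists z; rewrite (fun_related _ _ Fh).
    + move=> a z O Ha Hz Rza HO HzO; case: (Oh O HO) => W [EW HW].
      exists W; split => //; split; first by apply/EW; exists z.
      move=> a' z' /EW [w [Hw Rw]] Hz' Rz'.
      move: Rw Rz'; rewrite !(fun_related _ _ Fh) => -[HwC ->] [_ E].
      by rewrite -(inj w z').
  - case: (surj (lam omega (fun _ => empty))).
      by apply: lam_seqs => n _; rewrite in_two; left.
    by move=> z [Hz _]; exists z.
Qed.
End CantorSets.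

Section FromWHSP.
Context {M : eps_structure} {hZF : ZF M}.
Context (X TX Y TY u v f : M).
Context (Hu : regular_base X TX u) (Hv : regular_base Y TY v) (Ff : is_fun f X Y).
Context (cont : forall K TK : M, subset K X -> nonempty K ->
  is_subspace TX K TK -> is_compact K TK ->
  restriction_has_continuity_point TX TY f K).
Context (hW : WHSP M).

(** The closure of the basic set [n] of [Y] is inside [V]. *)
Definition well_inside V n : Prop := forall y, y ∈ Y -> y ∉ V ->
  exists j, j ∈ omega /\ y ∈ app v j /\ forall z, z ∈ app v n -> z ∉ app v j.

(** Otherwise [WHSP], applied to the expansions of the points of the two sets,
    gives a Cantor set [C]; the points of [X] with an expansion in [C] form a
    compact set on which [f] has no point of continuity. *)
Lemma Fsigma_between V n : V ∈ TY -> n ∈ omega -> well_inside V n ->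
  exists S, is_Fsigma X TX S /\ (forall x, x ∈ X -> app f x ∈ app v n -> x ∈ S) /\
    (forall x, x ∈ S -> app f x ∈ V).
Proof.
  move=> HV Hn In; apply: NNPP => C0.
  have HTX : is_topology X TX by case: Hu.
  pose (A := sep (seqs two) (fun z => exists x, expansion X u z x /\ app f x ∈ app v n)).
  pose (B := sep (seqs two) (fun z => exists x, expansion X u z x /\ app f x ∉ V)).
  have HA z : z ∈ A <-> z ∈ seqs two /\ exists x, expansion X u z x /\ app f x ∈ app v n.
    by rewrite in_sep.
  have HB z : z ∈ B <-> z ∈ seqs two /\ exists x, expansion X u z x /\ app f x ∉ V.
    by rewrite in_sep.
  have two_omega : subset (seqs two) (seqs omega).
    by move=> z; rewrite !in_seqs; apply: is_fun_sub two_sub.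
  have vV y : y ∈ Y -> y ∈ app v n -> y ∈ V.
  { move=> Hy Hyn; apply: NNPP => N; case: (In y Hy N) => j [_ [Hyj D]]; exact: (D y). }
  have HBs : is_Baire_space (seqs omega) (agree_top (seqs omega)) by apply/Baire_spaceE.
  have AN : subset A (seqs omega) by move=> z /HA [/two_omega].
  have BN : subset B (seqs omega) by move=> z /HB [/two_omega].
  have AB z : z ∈ A -> z ∉ B.
  { move=> /HA [Hz [x [Ex Hx]]] /HB [_ [x' [Ex' Nx']]].
    rewrite -(expansion_unique Hu Hz Ex Ex') in Nx'; apply: Nx'; apply: vV => //.
    by apply: (app_in Ff); case: Ex. }
  have NS : ~ exists S, subset S (seqs omega) /\
      is_Fsigma (seqs omega) (agree_top (seqs omega)) S /\ separates S A B.
  { move=> [S [_ [FS [SA SB]]]]; apply: C0; exists (expanded X u S).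
    split; first exact: expanded_Fsigma FS.
    split.
    + move=> x Hx Hfx; rewrite in_expanded; split => //.
      case: (expansion_exists u Hx) => z [Hz Ez]; exists z; split => //.
      by apply: SA; apply/HA; split => //; exists x.
    + move=> x; rewrite in_expanded => -[Hx [z [HzS [Hz Ez]]]].
      by apply: NNPP => N; apply: (SB z) => //; apply/HB; split => //; exists x. }
  case: (hW HBs AN BN AB NS) => C [TC [D [CC [CAB [HTC [/is_interE ED [dD cD]]]]]]].
  have HCN : subset C (seqs omega) by case: CC.
  move/(subspace_agree _ HCN): HTC => ETC; subst TC D.
  case: (Cantor_set_compact CC) => cC [z0 Hz0].
  have HC2 : subset C (seqs two) by move=> z /CAB [/HA []|/HB []].
  have Tot z : z ∈ C -> exists x, expansion X u z x.
    by move=> /CAB [/HA [_ [x [E _]]]|/HB [_ [x [E _]]]]; exists x.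
  have HK z x : z ∈ C -> expansion X u z x -> x ∈ expanded X u C.
  { move=> Hz E; rewrite in_expanded; split; first by case: E.
    by exists z; split => //; split => //; apply: HC2. }
  have KX : subset (expanded X u C) X by move=> x; rewrite in_expanded => -[].
  pose (TK := img TX (fun U => inter U (expanded X u C))).
  have HTK : is_subspace TX (expanded X u C) TK by apply/subspaceE.
  have nK : nonempty (expanded X u C).
    by case: (Tot z0 Hz0) => x E; exists x; apply: HK E.
  have cK : is_compact (expanded X u C) TK.
  { apply/is_compactE; first exact: (subspace_topology HTX HTK KX).
    exact: (expanded_compact Hu HC2 cC Tot HTK). }
  case: (cont KX nK HTK cK) => TK' [g [x [/subspaceE -> [/is_restrictionE -> [HxK cx]]]]].
  move: (HxK); rewrite in_expanded => -[Hx [z [Hz [Hz2 Ez]]]].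
  (* near [z] the images of the points of [C] stay in any open set around [f x] *)
  have near W : W ∈ TY -> app f x ∈ W -> exists U, U ∈ agree_top C /\ z ∈ U /\
      forall z' x', z' ∈ U -> expansion X u z' x' -> app f x' ∈ W.
  { move=> HW HfW.
    have Rx : related (restr f (expanded X u C)) x (app f x).
      by rewrite (related_restr _ _ Ff KX).
    case: (cx _ W Rx HW HfW) => U []; rewrite in_img => -[U0 [HU0 ->]] [].
    rewrite in_inter => -[HxU0 _] A1.
    case: (expansion_continuous Hu Hz2 Ez HU0 HxU0) => m [Hm A2].
    exists (sep C (fun y => agree m z y)); split.
      by rewrite in_agree_top; apply: cylinder_agree_open.
    split; first by rewrite in_sep.
    move=> z' x'; rewrite in_sep => -[Hz' Ag] E'.
    apply: (A1 x'); last by rewrite (related_restr _ _ Ff KX); split => //; apply: HK E'.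
    by rewrite in_inter; split; [apply: A2 E'|apply: HK E']. }
  have HfY : app f x ∈ Y by exact: app_in Ff Hx.
  case: (classic (app f x ∈ V)) => HfV.
  - case: (near V HV HfV) => U [HU [HzU A1]].
    case: cD => _ [D' [/is_diffE -> [_ dD']]].
    case: (dD' U HU); first by exists z.
    move=> z' [Hz'U]; rewrite in_diff in_inter => -[Hz'C N].
    case: (CAB z' Hz'C) => [HzA|/HB [_ [x' [E' N']]]]; first by apply: N.
    by apply: N'; apply: A1 E'.
  - case: (In _ HfY HfV) => j [Hj [Hfj Dj]].
    have HvT : app v j ∈ TY by case: Hv => _ [Ho _]; apply: Ho.
    case: (near _ HvT Hfj) => U [HU [HzU A1]].
    case: dD => _ dD; case: (dD U HU); first by exists z.
    move=> z' [Hz'U]; rewrite in_inter => -[_ /HA [_ [x' [E' H']]]].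
    by apply: (Dj _ H'); apply: A1 E'.
Qed.

(** The open set [V] is the union of the basic sets that are well inside. *)
Lemma Baire_class_1_from_WHSP (R : real_structure M)
    {hR : complete_ordered_field R} (hAC : AC_omega R) : Baire_class_1 X TX TY f.
Proof.
  move=> V HV; exists (sep X (fun x => app f x ∈ V)).
  split; first exact/(is_preimageE _ _ Ff).
  case: (@Fsigma_choice M hZF R hR hAC X TX u (fun n S =>
     (well_inside V n -> forall x, x ∈ X -> app f x ∈ app v n -> x ∈ S) /\
     (forall x, x ∈ S -> app f x ∈ V)) _ Hu).
  - rewrite /well_inside; definability.
  - move=> n Hn; case: (classic (well_inside V n)) => In.
    + by case: (Fsigma_between HV Hn In) => S [FS [H1 H2]]; exists S.
    + exists (union (img empty (fun x => x))); split.
        apply: Fsigma_bigcup; last by move=> i /not_in_empty.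
        apply/countableE; exists empty; split; last by move=> x y /not_in_empty.
        by split=> p /not_in_empty.
      split => // x; rewrite in_union => -[y []].
      by rewrite in_img => -[w [/not_in_empty]].
  - move=> g [Cg Qg].
    have -> : sep X (fun x => app f x ∈ V) = union (img (prod omega omega) (app g)).
    { apply: set_ext => x; rewrite in_sep in_union; split.
      - move=> [Hx HfV]; case: (Hv) => _ [_ [Hb _]].
        case: (Hb V _ HV HfV) => n [Hn [Hfn In]].
        case: (Qg n Hn) => /(_ In x Hx Hfn) + _.
        rewrite in_union => -[S []]; rewrite in_img => -[m [Hm ->]] HxS.
        exists (app g (pair n m)); rewrite in_img; split => //.
        by exists (pair n m); rewrite pair_in_prod.
      - move=> [S []]; rewrite in_img => -[p []].
        rewrite in_prod => -[n [m [Hn [Hm ->]]]] -> HxS.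
        have HxX : x ∈ X by case/is_closedE: (Cg n m Hn Hm) => K _; apply: K.
        split => //; case: (Qg n Hn) => _; apply.
        rewrite in_union; exists (app g (pair n m)); rewrite in_img; split => //.
        by exists m. }
    apply: Fsigma_bigcup; first exact: countable_omega2.
    by move=> p; rewrite in_prod => -[n [m [Hn [Hm ->]]]]; apply: Cg.
Qed.
End FromWHSP.

(** * From functions of the first class to Cantor sets *)

Section FromGBT.
Context {M : eps_structure} {hZF : ZF M} (R : real_structure M)
  {hR : complete_ordered_field R}.

(** An [F_σ] subset of the subspace [X] is the trace of an [F_σ] set of
    sequences: take the closures of the closed pieces. *)
Lemma Fsigma_extension X A : subset X (seqs omega) ->
  is_Fsigma X (agree_top X) A ->
  exists S, subset S (seqs omega) /\ is_Fsigma (seqs omega) (agree_top (seqs omega)) S /\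
    forall x, x ∈ X -> (x ∈ S <-> x ∈ A).
Proof.
  move=> HX [FF [cF [HC /is_unionE ->]]].
  pose (cl := fun F => sep (seqs omega) (fun x => forall n, n ∈ omega ->
     exists y, y ∈ F /\ agree n x y)).
  have Hcl F x : x ∈ cl F <-> x ∈ seqs omega /\ forall n, n ∈ omega ->
     exists y, y ∈ F /\ agree n x y by rewrite in_sep.
  have Dcl : definable_fun cl by rewrite /cl; definability.
  have clX F x : F ∈ FF -> x ∈ X -> (x ∈ cl F <-> x ∈ F).
  { move=> HF Hx; case/is_closedE: (HC F HF) => HFX; rewrite in_agree_top => -[_ OF].
    split.
    - move=> /Hcl [_ K]; apply: NNPP => N.
      have HxD : x ∈ diff X F by rewrite in_diff.
      case: (OF x HxD) => n [Hn A1]; case: (K n Hn) => y [Hy Ag].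
      by have := A1 y (HFX y Hy) Ag; rewrite in_diff => -[].
    - by move=> HxF; apply/Hcl; split; [apply: HX|move=> n Hn; exists x]. }
  exists (union (img FF cl)); split; last split.
  - by move=> x; rewrite in_union => -[G []]; rewrite in_img => -[F [_ ->]] /Hcl [].
  - apply: Fsigma_bigcup => // F HF; apply/is_closedE; split; first by move=> x /Hcl [].
    rewrite in_agree_top; split=> [x|x]; rewrite in_diff => -[Hx N] //.
    have [n [Hn A1]] : exists n, n ∈ omega /\ forall y, y ∈ F -> ~ agree n x y.
    { apply: NNPP => C; apply: N; apply/Hcl; split => // n Hn.
      apply: NNPP => C'; apply: C; exists n; split => // y Hy Ag; apply: C'; by exists y. }
    exists n; split => // y Hy Ag; rewrite in_diff; split => // /Hcl [_ /(_ n Hn)].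
    by move=> [w [Hw Ag']]; apply: (A1 w Hw); apply: agree_trans Ag'.
  - move=> x Hx; rewrite !in_union; split.
    + move=> [G []]; rewrite in_img => -[F [HF ->]] /(clX F x HF Hx) HxF.
      by exists F.
    + move=> [F [HF HxF]]; exists (cl F); rewrite in_img; split; first by exists F.
      exact/clX.
Qed.

(** Apply [GBT] to the characteristic function of [A] on [A ∪ B]. *)
Lemma WHSP_from_GBT (hAC : AC_omega R) : GBT R -> WHSP M.
Proof.
  move=> G N T A B /Baire_spaceE [-> ->] HA HB AB NS.
  pose (X := cup A B).
  pose (c0 := lam omega (fun _ => empty)); pose (c1 := lam omega (fun _ => one)).
  pose (Y := upair c0 c1).
  pose (f := lam X (fun x => ite (x ∈ A) c1 c0)).
  have HX : subset X (seqs omega) by move=> x; rewrite in_cup => -[/HA|/HB].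
  have Hc0 : c0 ∈ seqs omega by apply: lam_seqs => n _; apply: zero_in.
  have Hc1 : c1 ∈ seqs omega by apply: lam_seqs => n _; apply: one_in.
  have HY : subset Y (seqs omega) by move=> x; rewrite in_upair => -[->|->].
  have Nc : app c0 empty <> app c1 empty.
  {
    have H0 : empty ∈ omega by apply: zero_in.
    by rewrite /c0 /c1 !(app_lam H0) => /esym /one_neq0. }
  have Nc' : c0 <> c1 by move=> E; apply: Nc; rewrite E.
  have Df : definable_fun (fun x => ite (x ∈ A) c1 c0) by definability.
  have Ff : is_fun f X Y.
  { apply: lam_fun => x _; rewrite in_upair; case: (classic (x ∈ A)) => H.
    - by rewrite ite_true //; right.
    - by rewrite ite_false //; left. }
  have fA x : x ∈ X -> x ∈ A -> app f x = c1.
    by move=> Hx H; rewrite app_lam // ite_true.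
  have fB x : x ∈ X -> x ∉ A -> app f x = c0.
    by move=> Hx H; rewrite app_lam // ite_false.
  have sX : separable_metrizable R X (agree_top X) by exact: seqs_separable_metrizable.
  have sY : separable_metrizable R Y (agree_top Y) by exact: seqs_separable_metrizable.
  have NB1 : ~ Baire_class_1 X (agree_top X) (agree_top Y) f.
  { move=> B1.
    have V1 : single c1 ∈ agree_top Y.
    { rewrite in_agree_top; split=> [y|y]; rewrite in_single => ->.
        by rewrite in_upair; right.
      exists one; split; first exact: one_in.
      move=> w; rewrite in_upair in_single => -[->|-> //] Ag.
      by case: Nc; rewrite Ag // oneE; apply: mem_succ. }
    case: (B1 _ V1) => P [/(is_preimageE _ _ Ff) -> FP].
    case: (Fsigma_extension HX FP) => S [HS [FS ES]]; apply: NS; exists S.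
    split => //; split => //.
    have EA x : x ∈ X -> (x ∈ S <-> x ∈ A).
    { move=> Hx; rewrite ES // in_sep in_single; split.
      - by move=> [_ E]; apply: NNPP => N1; apply: Nc'; rewrite -E fB.
      - by move=> H; rewrite fA. }
    split=> x Hx.
    - by apply/EA => //; rewrite in_cup; left.
    - by move=> HxS; apply: (AB x) => //; apply/EA => //; rewrite in_cup; right. }
  have [K [TK [HK [nK [HTK [cK NC]]]]]] : exists K TK, subset K X /\ nonempty K /\
      is_subspace (agree_top X) K TK /\ is_compact K TK /\
      ~ restriction_has_continuity_point (agree_top X) (agree_top Y) f K.
  { apply: NNPP => C; apply: NB1; apply/(G _ _ _ _ _ sX sY Ff) => K TK H1 H2 H3 H4.
    by apply: NNPP => N1; apply: C; exists K, TK. }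
  move/(subspace_agree _ HK): (HTK) => ETK; subst TK.
  have NoConst U x : agree_open K U -> x ∈ U ->
      (forall y, y ∈ U -> (y ∈ A <-> x ∈ A)) -> False.
  { move=> HU HxU Ct; have UK : subset U K by case: HU.
    apply: NC; exists (agree_top K), (restr f K), x.
    split => //; split; first exact/is_restrictionE.
    split; first exact: UK.
    move=> y V; rewrite (related_restr _ _ Ff HK) => -[_ ->] HV HfV.
    exists U; rewrite in_agree_top; split => //; split => // x' y' Hx'.
    rewrite (related_restr _ _ Ff HK) => -[_ ->].
    have HxX := HK x (UK x HxU); have Hx'X := HK x' (UK x' Hx').
    case: (classic (x ∈ A)) => H.
    - by rewrite fA; [rewrite -(fA x)| |apply/Ct].
    - rewrite fB // ?Ct // -(fB x) //. }
  have inA U : agree_open K U -> nonempty U -> exists x, x ∈ U /\ x ∈ A.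
  { move=> HU [x Hx]; apply: NNPP => C; apply: (NoConst U x) => // y Hy.
    by split=> H; case: C; [exists y|exists x]. }
  have notA U : agree_open K U -> nonempty U -> exists x, x ∈ U /\ x ∉ A.
  { move=> HU [x Hx]; apply: NNPP => C; apply: (NoConst U x) => // y Hy.
    by split=> _; apply: NNPP => H; apply: C; [exists x|exists y]. }
  exists K, (agree_top K), (inter K A).
  split.
  { apply: perfect_compact_Cantor => //.
    - by move=> x /HK /HX.
    - by apply/is_compactE => //; apply: agree_topology.
    - move=> U HU nU; case: (inA U HU nU) => x [Hx xA]; case: (notA U HU nU) => y [Hy yA].
      by exists x, y; split => //; split => // E; apply: yA; rewrite -E. }
  split; first by move=> x /HK; rewrite in_cup.
  split; first by apply/subspace_agree => // x /HK /HX.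
  split; first exact/is_interE.
  have DK : subset (inter K A) K by move=> x; rewrite in_inter => -[].
  split; split => //.
  - move=> U; rewrite in_agree_top => HU nU; case: (inA U HU nU) => x [Hx xA].
    by exists x; rewrite in_inter; split => //; split => //; case: HU => H _; apply: H.
  - exists (diff K (inter K A)); split; first exact/is_diffE.
    split; first by move=> x; rewrite in_diff => -[].
    move=> U; rewrite in_agree_top => HU nU; case: (notA U HU nU) => x [Hx xA].
    exists x; rewrite in_diff in_inter; split => //; split; first by case: HU => H _; apply: H.
    by case.
Qed.

Lemma GBT_from_WHSP (hAC : AC_omega R) : WHSP M -> GBT R.
Proof.
  move=> W X TX Y TY f sX sY Ff.
  case: (separable_metrizable_regular_base sX) => u Hu.
  case: (separable_metrizable_regular_base sY) => v Hv.
  split.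
  - move=> B1 K TK HK nK HTK cK.
    exact: (Baire_class_1_continuity_point hAC Hu Hv Ff B1 HK nK HTK cK).
  - move=> cont; exact: (Baire_class_1_from_WHSP Hu Hv Ff cont W hAC).
Qed.
End FromGBT.

Theorem theorem3p4 (M : eps_structure) (hZF : ZF M) (R : real_structure M)
  (hR : complete_ordered_field R) (hAC : AC_omega R) :
  GBT R <-> WHSP M.
Proof.
  split; [exact: WHSP_from_GBT|exact: GBT_from_WHSP].
Qed.
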